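(* Assume the standing hypotheses described in the context. Let $(\bar S,\bar w^0,\bar w,\bar\alpha,\bar y^0,\bar y,\bar\beta)$ be a canonical local minimizer for the space-time problem. Then, for every Boltyanski approximating cone $\Gamma$ of the target $\mathfrak{T}$ at $(\bar y^0,\bar y)(\bar S)$, there exists a multiplier $(p_0,p,\pi,\lambda)\in\mathbb{R}\times AC([0,\bar S],\mathbb{R}^n)\times(-\infty,0]\times[0,+\infty)$ such that: (i) (non-triviality) $(p_0,p,\lambda)\neq(0,0,0)$ (i.e. $p_0$, the function $p$ and $\lambda$ do not all vanish); moreover, if $\bar y^0(\bar S)>0$ then $(p,\lambda)\neq(0,0)$; (ii) (non-transversality) $(p_0,p(\bar S))\in -\lambda\Big(\frac{\partial\Psi}{\partial t}((\bar y^0,\bar y)(\bar S)),\frac{\partial\Psi}{\partial x}((\bar y^0,\bar y)(\bar S))\Big)-\Gamma^\perp$, and $\pi=0$ whenever $\bar\beta(\bar S)<K$; (iii) (adjoint equation) for a.e. $s\in[0,\bar S]$, $\frac{dp}{ds}(s)=-\frac{\partial H}{\partial x}\big(\bar y(s),p_0,p(s),\pi,\lambda,\bar w^0(s),\bar w(s),\bar\alpha(s)\big)$; (iv) (maximization) for a.e. $s\in[0,\bar S]$, $H\big(\bar y(s),p_0,p(s),\pi,\lambda,\bar w^0(s),\bar w(s),\bar\alpha(s)\big)=\mathbf{H}\big(\bar y(s),p_0,p(s),\pi,\lambda\big)$; (v) (vanishing of the Hamiltonian) $\mathbf{H}\big(\bar y(s),p_0,p(s),\pi,\lambda\big)=0$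 for all $s\in[0,\bar S]$.
   Context: Let $n,m,q\ge1$ be integers, $m=m_1+m_2$ with $m_1,m_2\ge 0$; $\mathbf{e}_i$ denotes the $i$-th canonical basis vector, $\mathbb{R}_+=[0,+\infty)$. A set $\mathcal{K}$ is a cone if $\alpha x\in\mathcal K$ for all $\alpha>0$, $x\in\mathcal K$. Standing hypotheses: (1) the target $\mathfrak{T}\subset\mathbb{R}_+\times\mathbb{R}^n$ is closed; $A\subset\mathbb{R}^q$ is compact; $\mathcal{C}=\mathcal{C}_1\times\mathcal{C}_2\subseteq\mathbb{R}^m$, where $\mathcal C_1\subseteq\mathbb{R}^{m_1}$ is a closed cone containing the lines $\{r\mathbf e_i:r\in\mathbb{R}\}$, $i=1,\dots,m_1$, and $\mathcal C_2\subseteq\mathbb{R}^{m_2}$ is a closed cone containing no straight line; (2) $f:\mathbb{R}^n\times A\to\mathbb{R}^n$ is continuous with continuous partial derivatives with respect to $x$; (3) $g_1,\dots,g_m:\mathbb{R}^n\to\mathbb{R}^n$ are $C^1$; (4) $\ell(x,u,a)=\ell_0(x,a)+\ell_1(x,u)$ on $\mathbb{R}^n\times\mathcal C\times A$, where the recession function $\hat\ell_1(x,w^0,w):=\lim_{r\to w^0}r\,\ell_1(x,w/r)$, $(x,w^0,w)\in\mathbb{R}^n\times\mathbb{R}_+\times\mathcal C$, exists, and $\ell_0,\hat\ell_1$ are continuous with continuous partial derivatives with respect to $x$; (5) $\Psi:\mathbb{R}\times\mathbb{R}^n\to\mathbb{R}$ is $C^1$. Fix $K\in(0,+\infty]$ and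 $\check x\in\mathbb{R}^n$. Extended Lagrangian: $\ell^e(x,w^0,w,a):=\ell_0(x,a)w^0+\hat\ell_1(x,w^0,w)$. Space-time process: $S>0$, $(w^0,w,\alpha)\in L^\infty([0,S],\mathbb{R}_+\times\mathcal C\times A)$ with $\operatorname{ess\,inf}(w^0+|w|)>0$, and $(y^0,y,\beta)$ the Carathéodory solution on $[0,S]$ of $\frac{dy^0}{ds}=w^0$, $\frac{dy}{ds}=f(y,\alpha)w^0+\sum_{i=1}^m g_i(y)w^i$, $\frac{d\beta}{ds}=|w|$, $(y^0,y,\beta)(0)=(0,\check x,0)$. It is feasible if $(y^0(S),y(S))\in\mathfrak T$ and $\beta(S)\le K$; its cost is $\Psi(y^0(S),y(S))+\int_0^S\ell^e(y,w^0,w,\alpha)\,ds$. It is canonical if $w^0+|w|=1$ a.e. A feasible process is a local minimizer (of the space-time problem) if there is $\delta>0$ such that its cost is $\le$ the cost of every feasible process with $|S-\bar S|+\sup_{s\ge0}|\tilde z(s)-\tilde{\bar z}(s)|<\delta$, where $z=(y^0,y,\beta)$ and $\tilde z$ is the extension of $z$ to $\mathbb{R}_+$ that is constant after the final time. Boltyanski approximating cone: a convex cone $\mathcal K\subseteq\mathbb{R}^N$ is one for $Z\subseteq\mathbb{R}^N$ at $z\in Z$ if there exist a convex cone $C\subset\mathbb{R}^M$ ($M\ge0$), a neighborhood $V$ of $0$ in $\mathbb{R}^M$, a continuous $F:V\cap C\to Z$ with $F(0)=z$ and a linear $L:\mathbb{R}^M\to\mathbb{R}^N$ with $F(v)=z+Lv+o(|v|)$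 on $V\cap C$ and $LC=\mathcal K$. Polar: $X^\perp=\{p:p\cdot x\le0\ \forall x\in X\}$. Hamiltonians: $W:=\{(w^0,w)\in\mathbb{R}_+\times\mathcal C:w^0+|w|=1\}$, $H(x,p_0,p,\pi,\lambda,w^0,w,a):=p_0w^0+p\cdot\big(f(x,a)w^0+\sum_{i=1}^m g_i(x)w^i\big)+\pi|w|-\lambda\ell^e(x,w^0,w,a)$, and $\mathbf H(x,p_0,p,\pi,\lambda):=\max_{(w^0,w,a)\in W\times A}H(x,p_0,p,\pi,\lambda,w^0,w,a)$. *)

(* Defs.v *)
From HB Require Import structures.
From mathcomp Require Import all_boot all_order all_algebra.
From mathcomp Require Import all_classical all_reals all_analysis.
Import Order.TTheory GRing.Theory Num.Theory.
Import numFieldNormedType.Exports.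
Set Implicit Arguments.
Unset Strict Implicit.
Unset Printing Implicit Defensive.
Local Open Scope classical_set_scope.
Local Open Scope ring_scope.

Definition dotv {R : realType} {n : nat} (u v : 'rV[R]_n) : R :=
  \sum_(i < n) u 0 i * v 0 i.

Definition enorm {R : realType} {n : nat} (u : 'rV[R]_n) : R := Num.sqrt (dotv u u).

Definition evec {R : realType} {n : nat} (j : 'I_n) : 'rV[R]_n := delta_mx 0 j.

Definition dotp {R : realType} {n : nat} (p z : R * 'rV[R]_n) : R :=
  p.1 * z.1 + dotv p.2 z.2.

Definition is_cone {R : realType} {V : lmodType R} (K : set V) : Prop :=
  forall (a : R) x, 0 < a -> K x -> K (a *: x).

Definition is_convex {R : realType} {V : lmodType R} (K : set V) : Prop :=
  forall x y (t : R), K x -> K y -> 0 <= t <= 1 -> K (t *: x + (1 - t) *: y).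

Definition convex_cone {R : realType} {V : lmodType R} (K : set V) : Prop :=
  is_cone K /\ is_convex K.

Definition no_line {R : realType} {n : nat} (K : set 'rV[R]_n) : Prop :=
  forall (x0 v : 'rV[R]_n), v != 0 -> ~ (forall r : R, K (x0 + r *: v)).

Definition prod_cone {R : realType} {m1 m2 : nat}
  (C1 : set 'rV[R]_m1) (C2 : set 'rV[R]_m2) : set 'rV[R]_(m1 + m2) :=
  [set w | C1 (lsubmx w) /\ C2 (rsubmx w)].

Definition polar {R : realType} {n : nat} (X : set (R * 'rV[R]_n)) : set (R * 'rV[R]_n) :=
  [set p | forall x, X x -> dotp p x <= 0].

(* Boltyanski approximating cone Kc of Z at z (the cone C is required to
   contain 0, since F is defined on V /\ C with F(0) = z). *)
Definition boltyanski_cone {R : realType} {n : nat}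
  (Kc Z : set (R * 'rV[R]_n)) (z : R * 'rV[R]_n) : Prop :=
  convex_cone Kc /\ Z z /\
  exists (M : nat) (C V : set 'rV[R]_M)
         (F L : 'rV[R]_M -> R * 'rV[R]_n),
    [/\ convex_cone C, C 0 & nbhs (0 : 'rV[R]_M) V] /\
    [/\ {within V `&` C, continuous F},
        (forall v, (V `&` C) v -> Z (F v)) & F 0 = z] /\
    (forall (a : R) u v, L (a *: u + v) = a *: L u + L v) /\
    (forall eps : R, 0 < eps -> exists2 d : R, 0 < d &
       forall v, (V `&` C) v -> `|v| < d -> `|F v - z - L v| <= eps * `|v|) /\
    L @` C = Kc.

Definition gradx {R : realType} {n : nat} (h : 'rV[R]_n -> R) (x : 'rV[R]_n) : 'rV[R]_n :=
  \row_(j < n) derive h x (evec j).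

Definition abs_cont_on {R : realType} {n : nat} (S : R) (p : R -> 'rV[R]_n) : Prop :=
  forall eps : R, 0 < eps -> exists2 d : R, 0 < d &
    forall (N : nat) (a b : nat -> R),
      (forall k, (k < N)%N -> 0 <= a k /\ a k <= b k /\ b k <= S) ->
      (forall k l, (k < l)%N -> (l < N)%N -> b k <= a l) ->
      \sum_(k < N) (b k - a k) < d ->
      \sum_(k < N) enorm (p (b k) - p (a k)) < eps.

Definition ae_on {R : realType} (S : R) (P : R -> Prop) : Prop :=
  {ae (@lebesgue_measure R), forall s, `[0, S]%classic s -> P s}.

Definition RInt0 {R : realType} (s : R) (h : R -> R) : R :=
  Rintegral (@lebesgue_measure R) `[0, s]%classic h.

Definition integrable_on {R : realType} (S : R) (h : R -> R) : Prop :=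
  (@lebesgue_measure R).-integrable `[0, S]%classic (EFin \o h).

Definition dyn {R : realType} {n m q : nat}
  (f : 'rV[R]_n -> 'rV[R]_q -> 'rV[R]_n) (g : 'I_m -> 'rV[R]_n -> 'rV[R]_n)
  (x : 'rV[R]_n) (w0 : R) (w : 'rV[R]_m) (a : 'rV[R]_q) : 'rV[R]_n :=
  w0 *: f x a + \sum_(i < m) w 0 i *: g i x.

Definition lext {R : realType} {n m q : nat}
  (l0 : 'rV[R]_n -> 'rV[R]_q -> R) (lhat1 : 'rV[R]_n -> R -> 'rV[R]_m -> R)
  (x : 'rV[R]_n) (w0 : R) (w : 'rV[R]_m) (a : 'rV[R]_q) : R :=
  l0 x a * w0 + lhat1 x w0 w.

(* space-time process: (w0,w,alpha) in L^infty([0,S], R_+ x C x A) with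
   ess inf (w0 + |w|) > 0, and (y0,y,beta) the Caratheodory solution
   (written in integral form) with (y0,y,beta)(0) = (0, xc, 0). *)
Definition process {R : realType} {n m q : nat}
  (f : 'rV[R]_n -> 'rV[R]_q -> 'rV[R]_n) (g : 'I_m -> 'rV[R]_n -> 'rV[R]_n)
  (C : set 'rV[R]_m) (A : set 'rV[R]_q) (xc : 'rV[R]_n)
  (S : R) (w0 : R -> R) (w : R -> 'rV[R]_m) (al : R -> 'rV[R]_q)
  (y0 : R -> R) (y : R -> 'rV[R]_n) (be : R -> R) : Prop :=
  0 < S /\
  measurable_fun `[0, S]%classic w0 /\
  (forall i, measurable_fun `[0, S]%classic (fun s => w s 0 i)) /\
  (forall i, measurable_fun `[0, S]%classic (fun s => al s 0 i)) /\
  ae_on S (fun s => 0 <= w0 s /\ C (w s) /\ A (al s)) /\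
  (exists M : R, ae_on S (fun s => `|w0 s| + enorm (w s) + enorm (al s) <= M)) /\
  (exists2 c : R, 0 < c & ae_on S (fun s => c <= w0 s + enorm (w s))) /\
  integrable_on S w0 /\
  (forall j, integrable_on S (fun s => dyn f g (y s) (w0 s) (w s) (al s) 0 j)) /\
  integrable_on S (fun s => enorm (w s)) /\
  (forall s, 0 <= s <= S ->
     y0 s = RInt0 s w0 /\
     y s = xc + \row_(j < n) RInt0 s (fun t => dyn f g (y t) (w0 t) (w t) (al t) 0 j) /\
     be s = RInt0 s (fun t => enorm (w t))).

Definition feasible {R : realType} {n m q : nat}
  (f : 'rV[R]_n -> 'rV[R]_q -> 'rV[R]_n) (g : 'I_m -> 'rV[R]_n -> 'rV[R]_n)
  (C : set 'rV[R]_m) (A : set 'rV[R]_q) (xc : 'rV[R]_n)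
  (T : set (R * 'rV[R]_n)) (K : \bar R)
  (S : R) (w0 : R -> R) (w : R -> 'rV[R]_m) (al : R -> 'rV[R]_q)
  (y0 : R -> R) (y : R -> 'rV[R]_n) (be : R -> R) : Prop :=
  process f g C A xc S w0 w al y0 y be /\ T (y0 S, y S) /\ ((be S)%:E <= K)%E.

Definition cost {R : realType} {n m q : nat}
  (l0 : 'rV[R]_n -> 'rV[R]_q -> R) (lhat1 : 'rV[R]_n -> R -> 'rV[R]_m -> R)
  (Psi : R * 'rV[R]_n -> R)
  (S : R) (w0 : R -> R) (w : R -> 'rV[R]_m) (al : R -> 'rV[R]_q)
  (y0 : R -> R) (y : R -> 'rV[R]_n) : R :=
  Psi (y0 S, y S) + RInt0 S (fun s => lext l0 lhat1 (y s) (w0 s) (w s) (al s)).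

Definition canonical_ctrl {R : realType} {m : nat}
  (S : R) (w0 : R -> R) (w : R -> 'rV[R]_m) : Prop :=
  ae_on S (fun s => w0 s + enorm (w s) = 1).

(* Euclidean distance between the extensions (constant after the final time)
   of z = (y0,y,beta) and zb = (y0b,yb,beb), evaluated at s >= 0 *)
Definition zdist {R : realType} {n : nat}
  (S : R) (y0 : R -> R) (y : R -> 'rV[R]_n) (be : R -> R)
  (Sb : R) (y0b : R -> R) (yb : R -> 'rV[R]_n) (beb : R -> R) (s : R) : R :=
  let t := Num.min s S in let tb := Num.min s Sb in
  Num.sqrt ((y0 t - y0b tb) ^+ 2 + dotv (y t - yb tb) (y t - yb tb) + (be t - beb tb) ^+ 2).

Definition local_minimizer {R : realType} {n m q : nat}
  (f : 'rV[R]_n -> 'rV[R]_q -> 'rV[R]_n) (g : 'I_m -> 'rV[R]_n -> 'rV[R]_n)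
  (l0 : 'rV[R]_n -> 'rV[R]_q -> R) (lhat1 : 'rV[R]_n -> R -> 'rV[R]_m -> R)
  (Psi : R * 'rV[R]_n -> R)
  (C : set 'rV[R]_m) (A : set 'rV[R]_q) (xc : 'rV[R]_n)
  (T : set (R * 'rV[R]_n)) (K : \bar R)
  (Sb : R) (w0b : R -> R) (wb : R -> 'rV[R]_m) (alb : R -> 'rV[R]_q)
  (y0b : R -> R) (yb : R -> 'rV[R]_n) (beb : R -> R) : Prop :=
  feasible f g C A xc T K Sb w0b wb alb y0b yb beb /\
  exists2 delta : R, 0 < delta &
    forall S w0 w al y0 y be,
      feasible f g C A xc T K S w0 w al y0 y be ->
      (* |S - Sb| + sup_{s >= 0} |z~(s) - zb~(s)| < delta *)
      (exists eta : R, `|S - Sb| + eta < delta /\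
         forall s, 0 <= s -> zdist S y0 y be Sb y0b yb beb s <= eta) ->
      cost l0 lhat1 Psi Sb w0b wb alb y0b yb <= cost l0 lhat1 Psi S w0 w al y0 y.

Definition Ham {R : realType} {n m q : nat}
  (f : 'rV[R]_n -> 'rV[R]_q -> 'rV[R]_n) (g : 'I_m -> 'rV[R]_n -> 'rV[R]_n)
  (l0 : 'rV[R]_n -> 'rV[R]_q -> R) (lhat1 : 'rV[R]_n -> R -> 'rV[R]_m -> R)
  (x : 'rV[R]_n) (p0 : R) (p : 'rV[R]_n) (pi lam : R)
  (w0 : R) (w : 'rV[R]_m) (a : 'rV[R]_q) : R :=
  p0 * w0 + dotv p (dyn f g x w0 w a) + pi * enorm w - lam * lext l0 lhat1 x w0 w a.

Definition Wset {R : realType} {m : nat} (C : set 'rV[R]_m) : set (R * 'rV[R]_m) :=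
  [set ww | 0 <= ww.1 /\ C ww.2 /\ ww.1 + enorm ww.2 = 1].

(* bold H: the maximum over W x A (written as a supremum) *)
Definition HamMax {R : realType} {n m q : nat}
  (f : 'rV[R]_n -> 'rV[R]_q -> 'rV[R]_n) (g : 'I_m -> 'rV[R]_n -> 'rV[R]_n)
  (l0 : 'rV[R]_n -> 'rV[R]_q -> R) (lhat1 : 'rV[R]_n -> R -> 'rV[R]_m -> R)
  (C : set 'rV[R]_m) (A : set 'rV[R]_q)
  (x : 'rV[R]_n) (p0 : R) (p : 'rV[R]_n) (pi lam : R) : R :=
  sup [set r | exists w0 w a, Wset C (w0, w) /\ A a /\
                 r = Ham f g l0 lhat1 x p0 p pi lam w0 w a].

(* Main.v *)
Require Import Defs.
From HB Require Import structures.
From mathcomp Require Import all_boot all_order all_algebra all_fingroup.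
From mathcomp Require Import finmap.
From mathcomp Require Import all_classical all_reals all_analysis measurable_realfun.
From mathcomp Require Import zify ring lra.
Set Implicit Arguments.
Unset Strict Implicit.
Unset Printing Implicit Defensive.
Import Order.TTheory GRing.Theory Num.Theory.
Import numFieldNormedType.Exports.
Local Open Scope classical_set_scope.
Local Open Scope ring_scope.

(** The Lagrangian is absorbed into the state z = (y, y0, beta, c), c being the accumulated cost, so that
    the total cost is a coordinate of an end map Theta.  The reference
    trajectory is perturbed by inserting short time intervals, frozen at arbitrary times, on which
    arbitrary admissible controls run at small speed, and by slowing the reference down; all speeds are
    continuous parameters, so no measurable selection or uniform Lebesgue-point argument is needed.
    The first variation of Theta is read off through the adjoint equation.  If these variations,
    together with the directions of the Boltyanski cone, the slack of beta <= K and the slack of the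
    cost, positively span the end space, then Brouwer's theorem produces a feasible process of smaller
    cost.  Otherwise a nonzero functional nu is nonpositive on all of them, and the adjoint vector
    transporting nu is the multiplier: insertions give H <= 0 for every control at every time, and the
    slowing-down gives that the integral of H along the reference is nonnegative, whence H = 0 a.e. *)

(** * Brouwer's theorem, by Kuhn's combinatorial lemma *)

(** Admissible controls have no convex structure, so separation of convex sets is replaced by a
    dichotomy on finite families of first variations: either some nonzero functional is nonpositive
    on all of them, or finitely many span the end space with positive weights. In the second case
    the weights can be chosen Lipschitz in the displacement aimed at, as Brouwer's theorem requires.
    The lengths of the inserted intervals stay fixed and only the speeds on them tend to 0: all
    perturbations live on one interval, use one measurable control, and depend on finitely many
    scalars multiplying fixed functions. During an insertion the reference state stands still, so
    the first-order effect is the same at every time, Lebesgue point or not. The reference is only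
    slowed down, never accelerated: the sign obtained is complementary to the one given by the
    insertions. *)

Section Kuhn.
Variables (N' P : nat).
Notation N := N'.+1.
Variable lab : ('I_N -> nat) -> 'I_N.+1.

Hypothesis lab_top : forall (y : 'I_N -> nat) i, y i = P.+1 -> lab y != lift ord0 i.
Hypothesis lab_zero : forall (y : 'I_N -> nat) i, y i = 0%N ->
  (forall j : 'I_N, (j < i)%N -> y j != 0%N) -> lab y = lift ord0 i.

(* [t i] is the step at which coordinate [i] is increased along the chain. *)
Definition vert (y : 'I_N -> nat) (t : 'I_N -> 'I_N) (j : nat) : 'I_N -> nat :=
  fun i => (y i + (t i < j))%N.

(* The doors of the chain (faces carrying all labels but 0) are counted modulo 2 by determinants over
   F_2; expanding [full] along its column of ones relates the count of full chains to that of doors. *)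
Definition face (y : 'I_N -> nat) (t : 'I_N -> 'I_N) (j : nat) : 'M['F_2]_N :=
  \matrix_(r, k) (lab (vert y t (bump j r)) == lift ord0 k)%:R.

Definition full (y : 'I_N -> nat) (t : 'I_N -> 'I_N) : 'M['F_2]_N.+1 :=
  \matrix_(r, k) (if k == ord0 then 1 else (lab (vert y t r) == k)%:R).

Lemma addF2 (x : 'F_2) : x + x = 0.
Proof. by apply: addrr_pchar2; exact: (pchar_Fp (isT : prime 2)). Qed.

Lemma det_full y t : \det (full y t) = \sum_(j < N.+1) \det (face y t j).
Proof.
rewrite (expand_det_col _ ord0); apply: eq_bigr => j _.
rewrite /cofactor mxE eqxx mul1r (_ : -1 = 1 :> 'F_2); last by apply/eqP.
rewrite expr1n mul1r; congr (\det _); apply/matrixP => r k.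
by rewrite !mxE.
Qed.

(** Multiplication by a transposition exchanges even and odd permutations, so the terms cancel in
    pairs in characteristic 2. *)
Lemma sum_perm_tperm (F : {perm 'I_N} -> 'F_2) a b : a != b ->
  (forall t, F (t * tperm a b)%g = F t) -> \sum_t F t = 0.
Proof.
move=> ab Fs; rewrite (bigID (fun t : {perm 'I_N} => odd_perm t)) /=.
rewrite [X in _ + X](reindex_inj (mulIg (tperm a b))) /=.
under [X in _ + X]eq_bigr do rewrite Fs.
rewrite [X in _ + X](eq_bigl (fun t : {perm 'I_N} => odd_perm t)) ?addF2// => t.
by rewrite odd_permM odd_tperm ab addbT negbK.
Qed.

(** An interior face belongs to exactly two chains of its cell: exchanging the steps [j - 1] and [j]
    alters only the omitted vertex. *)
Lemma sum_face_mid y (j : nat) : (0 < j < N)%N ->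
  \sum_(t : {perm 'I_N}) \det (face y t j) = 0.
Proof.
case: j => // j jN.
pose a : 'I_N := Ordinal (ltnW jN); pose b : 'I_N := Ordinal jN.
apply: (@sum_perm_tperm _ a b); first by rewrite -val_eqE /= neq_ltn ltnSn.
move=> t; congr (\det _); apply/matrixP => r k; rewrite !mxE.
congr ((lab _ == _)%:R); apply/funext => i; rewrite /vert permM.
congr (_ + nat_of_bool _)%N.
have hb : bump j.+1 r != j.+1 by rewrite eq_sym neq_bump.
case: tpermP => [->|->|//] /=; move: hb; set m := bump _ _ => hb; lia.
Qed.

Definition bd (y : 'I_N -> nat) (t : {perm 'I_N}) : 'I_N -> nat :=
  fun i => (y i + (t i == ord_max))%N.

(** Dropping the first vertex of a chain leaves a chain without last vertex based in the adjacent
    cell: a cyclic shift of the permutation makes the first step the last one. *)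
Lemma sum_face0 y : \sum_(t : {perm 'I_N}) \det (face y t 0) =
  \sum_(t : {perm 'I_N}) \det (face (bd y t) t N).
Proof.
rewrite (reindex_inj (mulIg (perm (@ordS_inj N)))) /=.
apply: eq_bigr => t _; congr (\det _); apply/matrixP => r k; rewrite !mxE.
congr ((lab _ == _)%:R); apply/funext => i; rewrite /vert /bd permM permE /=.
rewrite -addnA; congr addn; rewrite -val_eqE /=.
have := ltn_ord (t i); have := ltn_ord r; rewrite /bump.
move: (val (t i)) (val r) => v m; rewrite add1n.
case: (ltngtP v N') => [h1|h1|->] h2 h3; [|lia|].
  by rewrite modn_small; lia.
by rewrite modnn; lia.
Qed.

Lemma det_face_neq0 y t j : \det (face y t j) != 0 ->
  forall k, exists r : 'I_N, lab (vert y t (bump j r)) = lift ord0 k.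
Proof.
move=> d0 k; apply: contrapT => /forallNP h.
case/eqP: d0; rewrite (expand_det_col _ k) big1// => r _.
by rewrite mxE; case: eqP => [/h//|]; rewrite mul0r.
Qed.

(** Coordinate [i] moves only in the last step, so it equals [P.+1] on the whole face, and [lab_top]
    excludes its label there. *)
Lemma face_top (y : 'I_N -> nat) t i : y i = P.+1 -> t i = ord_max ->
  \det (face y t N) = 0.
Proof.
move=> yi ti; apply/eqP; apply: contraT => /det_face_neq0 /(_ i)[r].
suff: vert y t (bump N r) i = P.+1 by move=> /lab_top /eqP.
rewrite /vert ti yi /=; have := ltn_ord r; rewrite /bump; lia.
Qed.

Lemma lab_zeroE (y : 'I_N -> nat) i k : y i = 0%N -> lab y = lift ord0 k ->
  y k = 0%N /\ (k <= i)%N.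
Proof.
move=> yi yk.
have [m /eqP ym hm] := @arg_minnP _ i (fun j => y j == 0%N) (@nat_of_ord N) (introT eqP yi).
have : lab y = lift ord0 m.
  by apply: lab_zero => // j jm; apply/eqP => /eqP /hm; rewrite leqNgt jm.
rewrite yk => /lift_inj ->; split => //; apply: hm; exact/eqP.
Qed.

(* The only boundary door is the chain 0, e_1, e_1 + e_2, ... *)
Lemma face_bottom (y : 'I_N -> nat) (t : {perm 'I_N}) i : y i = 0%N -> t i = ord_max ->
  \det (face y t N) = ((t == 1%g) && [forall j, y j == 0%N])%:R.
Proof.
move=> yi ti.
have bumpN (r : 'I_N) : bump N r = r by rewrite /bump leqNgt ltn_ord.
have vi (r : 'I_N) : vert y t r i = 0%N.
  by rewrite /vert yi ti /=; have := ltn_ord r; lia.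
case: (boolP ((t == 1%g) && [forall j, y j == 0%N])) => [/andP[/eqP t1 /forallP y0]|nt].
  rewrite (_ : face _ _ _ = 1%:M) ?det1//; apply/matrixP => r k; rewrite !mxE bumpN.
  rewrite (@lab_zero _ r) ?(inj_eq lift_inj)// /vert t1 ?perm1 ?ltnn ?(eqP (y0 _))//.
  by move=> j jr; rewrite perm1 jr addn1.
apply/eqP; apply: contraT => /det_face_neq0 dn.
(* If the [r]-th vertex vanishes in coordinate [r] for every [r], no coordinate is raised before its
   own step; this forces the identity permutation and the base point 0. *)
suff hr (r : 'I_N) : vert y t r r = 0%N.
  have tle (r : 'I_N) : (r <= t r)%N.
    by have := hr r; rewrite /vert; case: ltnP => //; rewrite addn1.
  have teq : t = 1%g.
    apply/permP => r; rewrite perm1; apply/eqP.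
    have [m _ hm] : {m : 'I_N | true & forall j : 'I_N, t j != j -> (j <= m)%N}.
      by exists ord_max => // j _; rewrite -ltnS.
    have : forall d : nat, forall j : 'I_N, (N' - j <= d)%N -> t j = j.
      elim => [|d IH] j jd.
        apply/val_inj/eqP => /=; rewrite eqn_leq tle andbT.
        by have := ltn_ord (t j); have := ltn_ord j; lia.
      have := tle j; rewrite leq_eqVlt => /orP[/eqP h|h]; first exact/val_inj.
      have /perm_inj -> // : t (t j) = t j by apply: IH; lia.
    by move=> /(_ N' r (leq_subr _ _))/eqP.
  move: nt; rewrite teq eqxx => /negP; case; apply/forallP => j.
  by move: (hr j); rewrite /vert => /eqP; rewrite addn_eq0 => /andP[].
(* Zero coordinates can only disappear along the chain, so the label, which is the first of them,
   can only increase. Since all labels but 0 occur, the position [z k] of label [k] is increasing in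
   [k], hence equal to [k]. *)
have zmono (a s : 'I_N) k l : (a <= s)%N -> lab (vert y t a) = lift ord0 k ->
    lab (vert y t s) = lift ord0 l -> (k <= l)%N.
  move=> rs hk /(lab_zeroE (vi s))[h _].
  have h' : vert y t a l = 0%N.
    by move: h; rewrite /vert => /eqP; rewrite addn_eq0 => /andP[/eqP -> ]; lia.
  by have [] := lab_zeroE h' hk.
have [z hz0] := choice dn.
have hz k : lab (vert y t (z k)) = lift ord0 k by rewrite -[nat_of_ord (z k)]bumpN hz0.
have zi : injective z.
  move=> a b ab; by have := hz a; rewrite ab hz => /lift_inj.
have zlt (a b : 'I_N) : (a < b)%N -> (z a < z b)%N.
  move=> ab; rewrite ltnNge; apply/negP => zba.
  by have := zmono _ _ _ _ zba (hz b) (hz a); rewrite leqNgt ab.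
have zge : forall m, forall a : 'I_N, (a <= m)%N -> (a <= z a)%N.
  elim => [|m IH] a am; first lia.
  case: (posnP a) => [->//|a0].
  pose b : 'I_N := Ordinal (leq_ltn_trans (leq_pred a) (ltn_ord a)).
  have /IH hb : (b <= m)%N by rewrite /=; lia.
  have /zlt : (b < a)%N by rewrite /=; lia.
  by move: hb; rewrite /=; lia.
have zle : forall m, forall a : 'I_N, (N' - a <= m)%N -> (z a <= a)%N.
  elim => [|m IH] a am; first by have := ltn_ord (z a); have := ltn_ord a; lia.
  case: (ltnP a N') => [aN|]; last by have := ltn_ord (z a); lia.
  pose b : 'I_N := Ordinal (aN : (a.+1 < N)%N).
  have /IH hb : (N' - b <= m)%N by rewrite /=; lia.
  have /zlt : (a < b)%N by rewrite /=.
  by move: hb; rewrite /=; lia.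
have zr : z r = r by apply/val_inj/eqP; rewrite eqn_leq (zle N') ?(zge r)//; lia.
have [] := lab_zeroE (vi r) (_ : _ = lift ord0 r) => //.
by rewrite -[in RHS](hz r) zr.
Qed.

Lemma sum_full : \sum_(x : {ffun 'I_N -> 'I_P.+1}) \sum_(t : {perm 'I_N})
   \det (full (fun i => x i) t) = 1.
Proof.
under eq_bigr do under eq_bigr do rewrite det_full.
under eq_bigr => x _.
  rewrite exchange_big /= big_ord_recr big_ord_recl /= [X in _ + X + _]big1 ?addr0; last first.
    by move=> j _; rewrite sum_face_mid//= /bump /=; have := ltn_ord j; lia.
  rewrite sum_face0 -big_split /=; over.

rewrite /= exchange_big /=.
pose B0 := [ffun=> ord0] : {ffun 'I_N -> 'I_P.+1}.
have key (t : {perm 'I_N}) i : t i = ord_max ->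
    \sum_(x : {ffun 'I_N -> 'I_P.+1})
     (\det (face (bd (fun i => x i) t) t N) + \det (face (fun i => x i) t N))
    = (t == 1%g)%:R.
  move=> ti.
  (* Cyclic translation in direction [i] matches the far face of a cell with the near face of the
     next one. Matched faces cancel; the top layer contributes 0 by [face_top], and the wrap-around
     leaves the bottom layer, counted by [face_bottom]. *)
  pose c (x : {ffun 'I_N -> 'I_P.+1}) := [ffun j => if j == i then ordS (x j) else x j].
  have ci : injective c.
    move=> x x' /ffunP cx; apply/ffunP => j; have := cx j; rewrite !ffunE.
    by case: ifP => // _ /ordS_inj.
  rewrite big_split /= [X in _ + X](reindex_inj ci) /= -big_split /=.
  have bdE (x : {ffun 'I_N -> 'I_P.+1}) j :
      bd (fun i => x i) t j = (x j + (j == i))%N.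
    by rewrite /bd -ti (inj_eq perm_inj).
  have cE (x : {ffun 'I_N -> 'I_P.+1}) : (x i < P)%N ->
      (fun j => nat_of_ord (c x j)) = bd (fun i => x i) t.
    move=> xP; apply/funext => j; rewrite bdE ffunE; case: eqP => [->|_] /=; last by rewrite addn0.
    by rewrite addn1 modn_small.
  transitivity (\sum_(x : {ffun 'I_N -> 'I_P.+1}) if x i == ord_max then
      \det (face (fun j => c x j) t N) else 0).
    apply: eq_bigr => x _; case: eqP => xi.
      by rewrite (@face_top _ t i) ?add0r// bdE xi eqxx addn1.
    rewrite cE ?addF2//; have := ltn_ord (x i).
    by rewrite ltnS leq_eqVlt => /orP[/eqP h|//]; case: xi; exact/val_inj.
  transitivity (\sum_(x : {ffun 'I_N -> 'I_P.+1}) if c x i == ord0 then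
      \det (face (fun j => c x j) t N) else 0).
    apply: eq_bigr => x _; congr (if _ then _ else _).
    rewrite ffunE eqxx; apply/eqP/eqP => [->|]; first by apply/val_inj; rewrite /= modnn.
    move=> /(congr1 val) /=; have := ltn_ord (x i); rewrite ltnS leq_eqVlt => /orP[/eqP h _|h].
      exact/val_inj.
    by rewrite modn_small.
  rewrite -(@reindex_inj _ _ _ _ c xpredT
     (fun x => if x i == ord0 then \det (face (fun j => x j) t N) else 0) ci) /=.
  rewrite (bigD1 B0)//= ffunE eqxx (@face_bottom _ t i) ?ffunE// big1 ?addr0.
    rewrite (_ : [forall j, _] = true) ?andbT//; apply/forallP => j; by rewrite ffunE.
  move=> x xB; case: eqP => // xi; rewrite (@face_bottom _ t i) ?xi//.
  rewrite (_ : [forall j, _] = false) ?andbF//; apply/negbTE/negP => /forallP h.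
  case/eqP: xB; apply/ffunP => j; rewrite ffunE; apply/val_inj; exact/eqP/h.
have keyt t : \sum_(x : {ffun 'I_N -> 'I_P.+1})
     (\det (face (bd (fun i => x i) t) t N) + \det (face (fun i => x i) t N))
    = (t == 1%g)%:R by apply: (key t (t^-1 ord_max)%g); rewrite permKV.
under eq_bigr do rewrite keyt.
by rewrite (bigD1 1%g)//= eqxx big1 ?addr0// => t /negPf ->.
Qed.

Lemma kuhn : exists (x : {ffun 'I_N -> 'I_P.+1}) (t : {perm 'I_N}),
  forall k : 'I_N.+1, exists j : 'I_N.+1, lab (vert (fun i => x i) t j) = k.
Proof.
have [x [t dn]] : exists (x : {ffun 'I_N -> 'I_P.+1}) (t : {perm 'I_N}),
    \det (full (fun i => x i) t) != 0.
  apply: contrapT => h; have := sum_full; rewrite big1; first by move/eqP; rewrite eq_sym oner_eq0.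
  move=> x _; rewrite big1// => t _; apply/eqP; apply: contrapT => h'.
  by apply: h; exists x, t; apply/negP.
exists x, t => k; apply: contrapT => /forallNP h.
case: (unliftP ord0 k) => [k'|] kE.
  case/eqP: dn; rewrite (expand_det_col _ k) big1// => r _.
  by rewrite mxE kE /= -kE; case: eqP => [/h//|]; rewrite mul0r.
(* If label 0 is missing, every row has exactly two ones, so the all-ones vector lies in the kernel
   over F_2. *)
have : full (fun i => x i) t *m const_mx 1 = 0 :> 'cV_N.+1.
  apply/matrixP => r s; rewrite !mxE big_ord_recl !mxE eqxx mulr1.
  have := h r; rewrite kE.
  case: (unliftP ord0 (lab (vert (fun i => x i) t r))) => [l lE _|//].
  rewrite (bigD1 l)//= big1 ?addr0; last first.
    move=> m ml; rewrite !mxE /= lE (inj_eq lift_inj) eq_sym (negPf ml) mul0r//.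
  by rewrite !mxE /= lE eqxx mulr1 addF2.
have fu : full (fun i => x i) t \in unitmx by rewrite unitmxE unitfE.
move/(congr1 (mulmx (invmx (full (fun i => x i) t)))); rewrite mulKmx// mulmx0.
by move/matrixP/(_ ord0 ord0); rewrite !mxE => /eqP; rewrite oner_eq0.
Qed.

End Kuhn.

(** * Sup norm and compactness *)

Section NormLemmas.
Context {R : realType}.

Lemma compact_seq (V : pseudoMetricNormedZmodType R) (K : set V) (u : nat -> V) :
  compact K -> (forall p, K (u p)) ->
  exists2 x, K x & forall e : R, 0 < e -> forall n, exists2 p, (n <= p)%N & `|u p - x| < e.
Proof.
move=> cK uK.
have [|x [Kx xc]] := cK (u @ \oo) _; first by exists 0%N => // p _; exact: uK.
exists x => // e e0 n.
have [|_ [[p np <-] ux]] := xc (u @` [set p | (n <= p)%N]) (ball x e) _ (nbhsx_ballx _ _ e0).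
  by exists n => // p /= np; exists p.
by exists p => //; rewrite distrC; move: ux; rewrite -ball_normE.
Qed.

Lemma norm_rV_coord n (v : 'rV[R]_n) i : `|v 0 i| <= `|v|.
Proof.
rewrite [leRHS]mx_normrE.
by apply/bigmax_geP; right; exists (0, i).
Qed.

Lemma norm_rV_le n (v : 'rV[R]_n) c : 0 <= c -> (forall i, `|v 0 i| <= c) -> `|v| <= c.
Proof.
move=> c0 h; rewrite [leLHS]mx_normrE.
by apply/bigmax_leP; split => // -[i j] _ /=; rewrite ord1.
Qed.

Lemma compact_box n (r : R) : compact [set v : 'rV[R]_n | `|v| <= r].
Proof.
apply: bounded_closed_compact.
  by exists r; split; [exact: num_real|move=> M rM v /= /le_trans; apply; exact: ltW].
have -> : [set v : 'rV[R]_n | `|v| <= r] = Num.norm @^-1` [set x | x <= r] by [].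
by apply: preimage_closed; [move=> x _; exact: norm_continuous | exact: closed_le].
Qed.

End NormLemmas.

(** Epsilon-delta form of relative continuity, convenient for restriction and composition;
    [within_cont_on] translates hypotheses stated with the subspace topology. *)
Definition cont_on {R : realType} {V W : pseudoMetricNormedZmodType R} (D : set V) (h : V -> W) :=
  forall x, D x -> forall e : R, 0 < e -> exists2 d : R, 0 < d &
    forall y, D y -> `|y - x| < d -> `|h y - h x| < e.

Section Brouwer.
Context {R : realType}.

(** Row vectors carry the sup norm, so the unit ball is a cube and Kuhn's grid fits it exactly.
    Label [i + 1] means that [phi] does not decrease coordinate [i], label 0 that it increases no
    coordinate; a cluster point of ever smaller fully labelled chains is therefore fixed. *)
Lemma brouwer N (phi : 'rV[R]_N -> 'rV[R]_N) :
  cont_on [set v | `|v| <= 1] phi -> (forall v, `|v| <= 1 -> `|phi v| <= 1) ->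
  exists2 v, `|v| <= 1 & phi v = v.
Proof.
case: N phi => [|N'] phi cphi hphi.
  by exists 0; rewrite ?normr0 ?ler01//; apply/matrixP => i [].
set N := N'.+1 in phi cphi hphi *.
pose pt (P : nat) (y : 'I_N -> nat) : 'rV[R]_N := \row_i (-1 + 2 * (y i)%:R / P.+1%:R).
have ptQ P y : (forall i, (y i <= P.+1)%N) -> `|pt P y| <= 1.
  move=> yP; apply: norm_rV_le => // i; rewrite mxE ler_norml.
  have h0 : 0 <= (y i)%:R / P.+1%:R :> R by rewrite divr_ge0.
  have h1 : (y i)%:R / P.+1%:R <= 1 :> R by rewrite ler_pdivrMr// mul1r ler_nat.
  rewrite -mulrA; move: h0 h1; set z := _ / _ => h0 h1.
  by apply/andP; split; lra.
(* The first clause secures [lab_zero]. The bound [y i <= P] in the second secures [lab_top] and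
   loses nothing, because a coordinate equal to 1 cannot be increased. *)
pose lab P (y : 'I_N -> nat) : 'I_N.+1 :=
  if [pick i | (y i == 0%N) && [forall j : 'I_N, (j < i)%N ==> (y j != 0%N)]] is Some i
  then lift ord0 i
  else if [pick i | (y i <= P)%N && (pt P y 0 i < phi (pt P y) 0 i)] is Some i
  then lift ord0 i else ord0.
have labT P y i : y i = P.+1 -> lab P y != lift ord0 i.
  move=> yi; rewrite /lab; case: pickP => [k /andP[/eqP yk _]|_].
    by rewrite (inj_eq lift_inj); apply/eqP => ki; rewrite ki yi in yk.
  case: pickP => [k /andP[yk _]|_]; last by rewrite neq_lift.
  by rewrite (inj_eq lift_inj); apply/eqP => ki; rewrite ki yi ltnn in yk.
have labZ P (y : 'I_N -> nat) i : y i = 0%N ->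
    (forall j : 'I_N, (j < i)%N -> y j != 0%N) -> lab P y = lift ord0 i.
  move=> yi hi; rewrite /lab; case: pickP => [k /andP[/eqP yk /forallP hk]|/(_ i)].
    congr (lift ord0 _); apply/val_inj/eqP; rewrite eqn_leq; apply/andP; split; rewrite leqNgt; apply/negP.
      by move=> ik; have := hk i; rewrite ik yi.
    by move=> /hi; rewrite yk.
  by rewrite yi eqxx /= => /negbT/negP; case; apply/forallP => j; apply/implyP => /hi.
have labS P y i : (forall i, (y i <= P.+1)%N) -> lab P y = lift ord0 i ->
    pt P y 0 i <= phi (pt P y) 0 i.
  move=> yP; rewrite /lab; case: pickP => [k /andP[/eqP yk _] /lift_inj <-|_].
    rewrite mxE yk mulr0 mul0r addr0.
    have := le_trans (norm_rV_coord (phi (pt P y)) k) (hphi _ (ptQ _ _ yP)).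
    by rewrite ler_norml => /andP[].
  case: pickP => [k /andP[_ yk] /lift_inj <-|_]; first exact: ltW.
  by move=> h; have := neq_lift ord0 i; rewrite -h eqxx.
have lab0 P y i : (forall i, (y i <= P.+1)%N) -> lab P y = ord0 ->
    phi (pt P y) 0 i <= pt P y 0 i.
  move=> yP; rewrite /lab; case: pickP => [k _ h|_].
    by have := neq_lift ord0 k; rewrite h eqxx.
  case: pickP => [k _ h|/(_ i) + _]; first by have := neq_lift ord0 k; rewrite h eqxx.
  have := yP i; rewrite leq_eqVlt ltnS => /orP[/eqP yi|->/=]; last by move/negbT; rewrite -leNgt.
  move=> _; rewrite [leRHS]mxE yi -mulrA divff ?pnatr_eq0// mulr1.
  have := le_trans (norm_rV_coord (phi (pt P y)) i) (hphi _ (ptQ _ _ yP)).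
  by rewrite ler_norml => /andP[_]; lra.
have ex P : exists b : 'rV[R]_N, `|b| <= 1 /\ forall k : 'I_N.+1, exists v : 'rV[R]_N,
   [/\ `|v| <= 1, `|v - b| <= 2 / P.+1%:R &
     if unlift ord0 k is Some i then v 0 i <= phi v 0 i
     else forall i, phi v 0 i <= v 0 i].
  have [x [t xt]] := kuhn (@labT P) (@labZ P).
  have vP (j : nat) i : (vert (fun i => x i) t j i <= P.+1)%N.
    by rewrite /vert; have := leq_b1 (t i < j)%N; have := ltn_ord (x i); lia.
  exists (pt P (fun i => x i)); split; first by apply: ptQ => i; have := ltn_ord (x i); lia.
  move=> k; have [j jk] := xt k; exists (pt P (vert (fun i => x i) t j)); split.
  - exact: ptQ.
  - apply: norm_rV_le => [|i]; first by rewrite divr_ge0.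
    rewrite !mxE /vert natrD.
    set a := (x i)%:R; set s := P.+1%:R.
    have -> : -1 + 2 * (a + (t i < j)%:R) / s - (-1 + 2 * a / s) = (t i < j)%:R * (2 / s) :> R by ring.
    by rewrite normrM ger0_norm// ger0_norm ?divr_ge0// ler_piMl ?divr_ge0// lern1 leq_b1.
  - case: unliftP jk => [i|] ->; first exact: labS.
    by move=> jk i; exact: lab0.
have [b hb] := choice ex.
have [x Qx xc] := compact_seq (@compact_box R N 1) (fun p => (hb p).1).
exists x => //; apply/rowP => i; apply/eqP; rewrite -subr_eq0 -normr_le0.
apply/ler_addgt0Pl => e e0; rewrite addr0.
have e3 : 0 < e / 3 by rewrite divr_gt0.
have [d d0 hd] := cphi x Qx _ e3.
pose d' := Num.min d (e / 3).
have d'0 : 0 < d' by rewrite lt_min d0.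
have [d'd d'e] : d' <= d /\ d' <= e / 3 by split; rewrite ge_min lexx ?orbT.
have d20 : 0 < d' / 2 by rewrite divr_gt0.
have [p pn bx] := xc _ d20 (Num.truncn (4 / d')).
have p2 : 2 / p.+1%:R < d' / 2 :> R.
  have : 4 / d' < p.+1%:R.
    by apply: (lt_le_trans (real_truncnS_gt (num_real _))); rewrite ler_nat ltnS.
  rewrite ltr_pdivrMr// => h; rewrite ltr_pdivrMr//; lra.
have near v : `|v| <= 1 -> `|v - b p| <= 2 / p.+1%:R ->
    `|phi v 0 i - phi x 0 i| < e / 3 /\ `|v 0 i - x 0 i| < e / 3.
  move=> vQ vb; have vx : `|v - x| < d'.
    by rewrite (_ : v - x = (v - b p) + (b p - x)); [rewrite (le_lt_trans (ler_normD _ _))// [ltRHS]splitr ltrD// (le_lt_trans vb)|rewrite addrA subrK].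
  split.
    have := norm_rV_coord (phi v - phi x) i; rewrite !mxE => /le_lt_trans; apply.
    by apply: hd => //; apply: lt_le_trans vx _.
  have := norm_rV_coord (v - x) i; rewrite !mxE => /le_lt_trans; apply.
  exact: lt_le_trans vx _.
have [v1 [v1Q v1b]] := (hb p).2 ord0; rewrite unlift_none => /(_ i) h1.
have [v2 [v2Q v2b]] := (hb p).2 (lift ord0 i); rewrite liftK => h2.
have [] := near _ v1Q v1b; have [] := near _ v2Q v2b.
rewrite !ltr_norml ler_norml => /andP[? ?] /andP[? ?] /andP[? ?] /andP[? ?].
by apply/andP; split; lra.
Qed.

(** The hypothesis says that [v - G v] maps the ball into itself. *)
Lemma zero_of_near_id N (G : 'rV[R]_N -> 'rV[R]_N) :
  cont_on [set v | `|v| <= 1] G -> (forall v, `|v| <= 1 -> `|G v - v| <= 1) ->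
  exists2 v, `|v| <= 1 & G v = 0.
Proof.
move=> cG hG; have [||v v1 vG] := @brouwer N (fun v => v - G v).
- move=> x Qx e e0; have e2 : 0 < e / 2 by rewrite divr_gt0.
  have [d d0 hd] := cG x Qx _ e2; exists (Num.min d (e / 2)).
    by rewrite lt_min d0.
  move=> y Qy; rewrite lt_min => /andP[/(hd _ Qy) h1 h2].
  rewrite (_ : _ - _ = (y - x) - (G y - G x)); last by apply/rowP => i; rewrite !mxE; ring.
  by rewrite (le_lt_trans (ler_normB _ _))//; lra.
- by move=> v v1; rewrite distrC; exact: hG.
exists v => //; apply/eqP; rewrite -oppr_eq0 -(inj_eq (addrI v)) addr0.
exact/eqP.
Qed.

End Brouwer.

(** * Positive spanning and separation *)

Section Dot.
Context {R : realType}.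

Lemma continuous_sumr (T : topologicalType) (I : Type) (s : seq I) (F : I -> T -> R) :
  (forall i, continuous (F i)) -> continuous (fun x => \sum_(i <- s) F i x).
Proof.
move=> cF; elim: s => [|a s IH] x.
  rewrite (_ : (fun x => _) = fun=> 0); first exact: cvg_cst.
  by apply/funext => y; rewrite big_nil.
rewrite (_ : (fun x => _) = (F a \+ fun x => \sum_(i <- s) F i x)).
  by apply: cvgD; [exact: cF|exact: IH].
by apply/funext => y; rewrite big_cons.
Qed.

Lemma continuous_mulr_cst (T : topologicalType) (f : T -> R) (c : R) :
  continuous f -> continuous (fun x => f x * c).
Proof. by move=> cf x; apply: cvgM; [exact: cf|exact: cvg_cst]. Qed.

Lemma continuous_dotv n (b : 'rV[R]_n) : continuous (fun u => dotv u b).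
Proof.
by apply: continuous_sumr => i; apply: continuous_mulr_cst; exact: coord_continuous.
Qed.

Lemma dotvC n (u v : 'rV[R]_n) : dotv u v = dotv v u.
Proof. by apply: eq_bigr => i _; rewrite mulrC. Qed.

Lemma dotvDl n (u v w : 'rV[R]_n) : dotv (u + v) w = dotv u w + dotv v w.
Proof. by rewrite -big_split; apply: eq_bigr => i _; rewrite !mxE mulrDl. Qed.

Lemma dotvZl n a (u w : 'rV[R]_n) : dotv (a *: u) w = a * dotv u w.
Proof. by rewrite mulr_sumr; apply: eq_bigr => i _; rewrite !mxE mulrA. Qed.

Lemma dotvDr n (w u v : 'rV[R]_n) : dotv w (u + v) = dotv w u + dotv w v.
Proof. by rewrite dotvC dotvDl !(dotvC w). Qed.

Lemma dotvZr n a (w u : 'rV[R]_n) : dotv w (a *: u) = a * dotv w u.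
Proof. by rewrite dotvC dotvZl dotvC. Qed.

Lemma dotv0r n (w : 'rV[R]_n) : dotv w 0 = 0.
Proof. by rewrite /dotv big1// => i _; rewrite mxE mulr0. Qed.

Lemma dotv0l n (w : 'rV[R]_n) : dotv 0 w = 0.
Proof. by rewrite dotvC dotv0r. Qed.

Lemma dotvNl n (u w : 'rV[R]_n) : dotv (- u) w = - dotv u w.
Proof. by rewrite -scaleN1r dotvZl mulN1r. Qed.

Lemma dotvNr n (u w : 'rV[R]_n) : dotv w (- u) = - dotv w u.
Proof. by rewrite dotvC dotvNl dotvC. Qed.

Lemma dotv_sumr n (I : Type) (s : seq I) (P : pred I) (F : I -> 'rV[R]_n) w :
  dotv w (\sum_(i <- s | P i) F i) = \sum_(i <- s | P i) dotv w (F i).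
Proof.
elim/big_rec2 : _ => [|i x y _ <-]; by rewrite ?dotv0r// dotvDr.
Qed.

Lemma dotv_evec n (u : 'rV[R]_n) j : dotv u (evec j) = u 0 j.
Proof.
rewrite /dotv (bigD1 j)//= big1 ?addr0; first by rewrite /evec mxE !eqxx mulr1.
by move=> i ij; rewrite /evec mxE eqxx (negPf ij) mulr0.
Qed.

Lemma dotv_le n (u v : 'rV[R]_n) : `|dotv u v| <= n%:R * (`|u| * `|v|).
Proof.
rewrite (le_trans (ler_norm_sum _ _ _))//.
rewrite (_ : n%:R * _ = \sum_(i < n) (`|u| * `|v|)); last first.
  by rewrite sumr_const card_ord mulr_natl.
apply: ler_sum => i _; by rewrite normrM ler_pM// norm_rV_coord.
Qed.

Lemma compact_sphere n : compact [set v : 'rV[R]_n | `|v| = 1].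
Proof.
apply: (@subclosed_compact _ _ [set v : 'rV[R]_n | `|v| <= 1]).
- have -> : [set v : 'rV[R]_n | `|v| = 1] = Num.norm @^-1` [set x | x = 1] by [].
  by apply: preimage_closed; [move=> x _; exact: norm_continuous | exact: closed_eq].
- exact: compact_box.
- by move=> v /= ->.
Qed.

(** Multiply by [1 - y]: on the left [(1 - y) * expR y <= 1], on the right [(1 - y) * (1 + y + 2 * y
    ^+ 2) = 1 + y ^+ 2 * (1 - 2 * y) >= 1]. *)
Lemma expR_le_quad (y : R) : `|y| <= 1 / 2 -> expR y <= 1 + y + 2 * y ^+ 2.
Proof.
rewrite ler_norml => /andP[h1 h2].
have h := expR_ge1Dx (- y).
have e0 := expR_gt0 y.
have : expR (- y) * expR y = 1 by rewrite -expRD addNr expR0.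
set a := expR y in e0 *; set b := expR (- y) in h *.
move=> ba.
have : (1 - y) * a <= 1 by rewrite -[leRHS]ba ler_wpM2r// ltW.
have : 1 <= (1 - y) * (1 + y + 2 * y ^+ 2).
  rewrite [leRHS](_ : _ = 1 + y ^+ 2 * (1 - 2 * y)); last by ring.
  rewrite lerDl mulr_ge0 ?sqr_ge0//; lra.
move=> h3 h4; have y1 : 0 < 1 - y by lra.
by rewrite -(ler_pM2l y1); exact: le_trans h4 h3.
Qed.

Lemma expR_ge_quad (y : R) : 0 <= y -> y ^+ 2 / 2 <= expR y.
Proof.
by move=> y0; have := @expR_ge1Dxn R y 1 y0; rewrite (_ : 2`! = 2)%N//; lra.
Qed.

(* A family meeting every open half-space spans the space with positive weights:
   the weights are read off at the minimiser of the coercive function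
   sum_k exp (mu . k) - mu . b. *)
Lemma pos_comb n (M : nat) (k : 'I_M -> 'rV[R]_n) :
  (forall mu, mu != 0 -> exists i, 0 < dotv mu (k i)) ->
  forall b, exists2 c : 'I_M -> R, (forall i, 0 < c i) & \sum_i c i *: k i = b.
Proof.
move=> hk b.
(* Compactness of the sphere makes the half-space condition uniform; the margin [eta] is the source
   of coercivity of [Phi]. *)
have [eta eta0 heta] : exists2 eta : R, 0 < eta & forall mu : 'rV[R]_n, `|mu| = 1 ->
    exists i, eta < dotv mu (k i).
  apply: contrapT => h.
  have ex (p : nat) : exists mu : 'rV[R]_n, `|mu| = 1 /\ forall i, dotv mu (k i) <= p.+1%:R^-1.
    apply: contrapT => h'; apply: h; exists p.+1%:R^-1; first by rewrite invr_gt0.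
    move=> mu mu1; apply: contrapT => h2; apply: h'; exists mu; split => // i.
    by rewrite leNgt; apply/negP => h3; apply: h2; exists i.
  have [u hu] := choice ex.
  have [x x1 xc] := compact_seq (@compact_sphere n) (fun p => (hu p).1).
  have x0 : x != 0 by rewrite -normr_gt0 x1.
  have [i xi] := hk _ x0.
  set e := dotv x (k i) in xi.
  set m : R := 1 + n%:R * `|k i|.
  have m0 : 0 < m by rewrite ltr_pwDl// mulr_ge0.
  have [p pn px] := xc (e / (2 * m)) (divr_gt0 xi (mulr_gt0 (ltr0Sn R 1) m0)) (Num.truncn (2 / e)).
  have := (hu p).2 i; apply/negP; rewrite -ltNge.
  have h1 : p.+1%:R^-1 < e / 2.
    rewrite -[ltRHS]invrK ltf_pV2 ?posrE ?invr_gt0 ?divr_gt0// invf_div.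
    by apply: (lt_le_trans (real_truncnS_gt (num_real _))); rewrite ler_nat ltnS.
  have h2 : `|dotv (u p - x) (k i)| <= e / 2.
    rewrite (le_trans (dotv_le _ _))// mulrCA.
    rewrite (@le_trans _ _ (e / (2 * m) * m))//; last by rewrite invfM mulrA mulfVK ?gt_eqF.
    by rewrite ler_pM// ?mulr_ge0//; [exact: ltW|rewrite /m lerDr].
  move: h2; rewrite dotvDl dotvNl -/e ler_norml => /andP[h2 _].
  by rewrite (lt_le_trans h1)//; lra.
pose Phi (mu : 'rV[R]_n) : R := \sum_(i < M) expR (dotv mu (k i)) - dotv mu b.
have cPhi : continuous Phi.
  have cE : continuous (fun mu => \sum_(i < M) expR (dotv mu (k i))).
    apply: continuous_sumr => i y; apply: continuous_comp; first exact: continuous_dotv.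
    exact: continuous_expR.
  by move=> x; apply: (@continuousB _ _ _ _ (fun mu => dotv mu b) x); [exact: cE|exact: continuous_dotv].
have coer mu : Phi mu >= `|mu| * (eta ^+ 2 / 2 * `|mu| - n%:R * `|b|).
  have [->|mu0] := eqVneq mu 0.
    rewrite normr0 mul0r /Phi dotv0l subr0 sumr_ge0// => i _; exact: expR_ge0.
  have nmu : 0 < `|mu| by rewrite normr_gt0.
  have [|i hi] := heta (`|mu|^-1 *: mu); first by rewrite normrZ normfV normr_id mulVf ?gt_eqF.
  rewrite dotvZl ltr_pdivlMl// in hi.
  have h1 : eta ^+ 2 / 2 * `|mu| ^+ 2 <= \sum_(i < M) expR (dotv mu (k i)).
    rewrite (bigD1 i)//= (@le_trans _ _ (expR (dotv mu (k i))))//; last first.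
      by rewrite lerDl sumr_ge0// => j _; exact: expR_ge0.
    apply: le_trans (expR_ge_quad _); last by rewrite (le_trans _ (ltW hi))// mulr_ge0// ltW.
    rewrite mulrAC ler_pM2r ?invr_gt0// -exprMn mulrC ler_sqr ?nnegrE ?mulr_ge0 ?(ltW hi)// ?ltW//.
    by rewrite (lt_trans _ hi)// mulr_gt0.
  have := dotv_le mu b; rewrite ler_norml /Phi => /andP[_ h2].
  by rewrite mulrBr mulrCA -expr2 lerB// mulrCA.
(* Beyond radius [rho] the coercivity bound is at least [M%:R + 1], while [Phi 0 = M%:R]; the
   minimum over the box is thus global. *)
pose rho := (M%:R + 1 + n%:R * `|b|) / (eta ^+ 2 / 2) + 1.
have e20 : 0 < eta ^+ 2 / 2 by rewrite divr_gt0// exprn_gt0.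
have rho1 : 1 <= rho by rewrite lerDr divr_ge0 ?(ltW e20)// !addr_ge0// mulr_ge0.
have Phi0 : Phi 0 = M%:R.
  rewrite /Phi dotv0l subr0; under eq_bigr do rewrite dotv0l expR0.
  by rewrite sumr_const card_ord.
have [||mu muB hmu] := @compact_EVT_min _ _ Phi [set v : 'rV[R]_n | `|v| <= rho] _ (@compact_box R n rho).
- by exists 0; rewrite /= normr0 (le_trans _ rho1).
- exact: continuous_subspaceT.
have hmuT v : Phi mu <= Phi v.
  case: (leP `|v| rho) => vr; first by apply: hmu; rewrite inE.
  apply: (@le_trans _ _ M%:R); first by rewrite -Phi0; apply: hmu; rewrite inE /= normr0 (le_trans _ rho1).
  apply: le_trans (coer v).
  have h : M%:R + 1 <= eta ^+ 2 / 2 * `|v| - n%:R * `|b|.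
    rewrite lerBrDr -ler_pdivrMl// mulrC (le_trans _ (ltW vr))// /rho lerDl//.
  have v1 : 1 <= `|v| by rewrite (le_trans rho1)// ltW.
  have M0 : 0 <= M%:R :> R by [].
  rewrite (@le_trans _ _ (eta ^+ 2 / 2 * `|v| - n%:R * `|b|))//; first lra.
  by rewrite ler_peMl//; lra.
exists (fun i => expR (dotv mu (k i))); first by move=> i; exact: expR_gt0.
apply/rowP => j; apply/eqP; rewrite -subr_eq0 -normr_le0.
pose C := \sum_(i < M) expR (dotv mu (k i)) * (2 * (k i 0 j) ^+ 2) + 1.
have C0 : 0 < C.
  by rewrite ltr_wpDl// sumr_ge0// => i _; rewrite mulr_ge0 ?expR_ge0// mulr_ge0 ?sqr_ge0.
pose K := 1 + \sum_(i < M) `|k i 0 j|.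
have K0 : 0 < K by rewrite ltr_pwDl// sumr_ge0.
set g := _ - _.
(* First-order condition in direction [evec j] without differentiation: minimality and
   [expR_le_quad] give this inequality for small [t] of both signs, which forces [g = 0]. The bound
   on [t] keeps the exponents within 1/2. *)
have hg t : `|t| <= (2 * K)^-1 -> 0 <= t * g + C * t ^+ 2.
  move=> tK; have := hmuT (mu + t *: evec j).
  rewrite -subr_ge0 => /le_trans; apply.
  rewrite /Phi [dotv (mu + _) b]dotvDl dotvZl [dotv (evec _) b]dotvC dotv_evec.
  have hs : \sum_(i < M) expR (dotv (mu + t *: evec j) (k i)) <=
     \sum_(i < M) expR (dotv mu (k i)) * (1 + t * k i 0 j + 2 * (t * k i 0 j) ^+ 2).
    apply: ler_sum => i _; rewrite dotvDl dotvZl [dotv (evec _) _]dotvC dotv_evec expRD.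
    rewrite ler_pM2l ?expR_gt0//; apply: expR_le_quad; rewrite normrM.
    apply: (@le_trans _ _ ((2 * K)^-1 * K)); last by rewrite invfM mulfVK ?gt_eqF// div1r.
    rewrite ler_pM// /K (bigD1 i)//= addrCA lerDl addr_ge0// sumr_ge0//.
  have hs2 : \sum_(i < M) expR (dotv mu (k i)) * (1 + t * k i 0 j + 2 * (t * k i 0 j) ^+ 2) =
     \sum_(i < M) expR (dotv mu (k i)) + t * (\sum_(i < M) expR (dotv mu (k i)) *: k i) 0 j
      + (C - 1) * t ^+ 2.
    rewrite /C addrK summxE mulr_sumr mulr_suml -!big_split; apply: eq_bigr => i _ /=.
    by rewrite mxE; ring.
  have t2 : 0 <= t ^+ 2 by rewrite sqr_ge0.
  rewrite /g; move: hs; rewrite hs2 summxE.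
  lra.
have gC : forall s : R, 0 < s -> s <= (2 * K)^-1 -> `|g| <= C * s.
  move=> s s0 sK.
  have sn : `|s| = s by rewrite gtr0_norm.
  have := hg s; rewrite sn => /(_ sK) h1.
  have := hg (- s); rewrite normrN sn => /(_ sK) h2.
  rewrite ler_norml; apply/andP; split.
    by rewrite -(ler_pM2l s0); lra.
  by rewrite -(ler_pM2l s0); lra.
apply/ler_addgt0Pl => e e0; rewrite addr0.
have k20 : 0 < (2 * K)^-1 by rewrite invr_gt0 mulr_gt0.
have s0 : 0 < Num.min ((2 * K)^-1) (e / C) by rewrite lt_min k20 divr_gt0.
apply: le_trans (gC _ s0 _) _; first by rewrite ge_min lexx.
by rewrite -ler_pdivlMl// [leRHS]mulrC ge_min lexx orbT.
Qed.

(** If every nonzero functional is positive somewhere on [G], the open sets of [mu] with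
    [0 < dotv mu k] cover the compact unit sphere, and a finite subcover provides the family. *)
Lemma cone_alternative n (G : set 'rV[R]_n) :
  (exists2 mu, mu != 0 & forall k, G k -> dotv mu k <= 0) \/
  (exists2 s : seq 'rV[R]_n, (forall k, k \in s -> G k) &
     forall mu, mu != 0 -> exists2 k, k \in s & 0 < dotv mu k).
Proof.
have [h|h] := pselect (exists2 mu, mu != 0 & forall k, G k -> dotv mu k <= 0); [by left|right].
have hG mu : mu != 0 -> exists2 k, G k & 0 < dotv mu k.
  move=> mu0; apply: contrapT => h'; apply: h; exists mu => // k Gk.
  by rewrite leNgt; apply/negP => h2; apply: h'; exists k.
have := @compact_sphere n; rewrite compact_cover.
move=> /(_ _ G (fun k => [set mu | 0 < dotv mu k])) [].
- move=> k _; have -> : [set mu | 0 < dotv mu k] = (dotv^~ k) @^-1` [set x | 0 < x] by [].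
  by apply: open_comp; [move=> x _; exact: continuous_dotv|exact: open_gt].
- move=> mu /= mu1; have [|k Gk h1] := hG mu; first by rewrite -normr_gt0 mu1.
  by exists k.
move=> D DG Dc; exists (enum_fset D) => [k kD|mu mu0]; first by apply/set_mem; exact: DG.
have [|k kD /=] := Dc (`|mu|^-1 *: mu).
  by rewrite /= normrZ normfV normr_id mulVf ?normr_eq0.
by rewrite dotvZl pmulr_rgt0 ?invr_gt0 ?normr_gt0// => h1; exists k.
Qed.

End Dot.

(** * Bounded measurable functions, Lipschitz curves and integral equations *)

Section BoundedMeasurable.
Context {R : realType}.
Implicit Types (h k : R -> R) (s t a b L T : R).
Notation mu := (@lebesgue_measure R).

(** Boundedness and measurability on the whole line give integrability on every compact interval, so
    that the calculus of [RInt0] carries no side conditions on domains. *)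
Definition bmeas h := measurable_fun setT h /\ exists M, forall x, `|h x| <= M.

Lemma bmeas_integrable h a b : bmeas h -> mu.-integrable `[a, b] (EFin \o h).
Proof.
move=> [mh [M hM]].
have fin : (mu `[a, b]%classic < +oo)%E.
  by rewrite lebesgue_measure_itv /=; case: ifP => // _; rewrite -EFinB ltry.
apply: measurable_bounded_integrable => //.
- exact: measurable_funS mh.
- exists M; split; first exact: num_real.
  by move=> x Mx y _ /=; rewrite (le_trans (hM y))// ltW.
Qed.

Lemma bmeas_cst c : bmeas (fun=> c).
Proof. by split=> //; exists `|c|. Qed.

Lemma bmeasD h k : bmeas h -> bmeas k -> bmeas (fun x => h x + k x).
Proof.
move=> [mh [M hM]] [mk [N kN]]; split; first exact: measurable_funD.
by exists (M + N) => x; rewrite (le_trans (ler_normD _ _))// lerD.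
Qed.

Lemma bmeasM h k : bmeas h -> bmeas k -> bmeas (fun x => h x * k x).
Proof.
move=> [mh [M hM]] [mk [N kN]]; split; first exact: measurable_funM.
by exists (M * N) => x; rewrite normrM ler_pM.
Qed.

Lemma bmeasZ c h : bmeas h -> bmeas (fun x => c * h x).
Proof. by move=> bh; apply: bmeasM => //; exact: bmeas_cst. Qed.

Lemma bmeasN h : bmeas h -> bmeas (fun x => - h x).
Proof.
move=> bh; rewrite (_ : (fun x => - h x) = (fun x => -1 * h x)); first exact: bmeasZ.
by apply/funext => x; rewrite mulN1r.
Qed.

Lemma bmeasB h k : bmeas h -> bmeas k -> bmeas (fun x => h x - k x).
Proof. by move=> bh bk; apply: bmeasD => //; exact: bmeasN. Qed.

Lemma bmeas_sum (I : Type) (s : seq I) (P : pred I) (F : I -> R -> R) :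
  (forall i, bmeas (F i)) -> bmeas (fun x => \sum_(i <- s | P i) F i x).
Proof.
move=> bF; elim: s => [|i s IH].
  rewrite (_ : (fun x => _) = fun=> 0); first exact: bmeas_cst.
  by apply/funext => x; rewrite big_nil.
rewrite (_ : (fun x => _) = fun x => (if P i then F i x else 0) + \sum_(i <- s | P i) F i x).
  by apply: bmeasD => //; case: (P i) => //; exact: bmeas_cst.
by apply/funext => x; rewrite big_cons; case: (P i); rewrite ?add0r.
Qed.

Definition blip h := exists C, (forall t, `|h t| <= C) /\ forall s t, `|h t - h s| <= C * `|t - s|.

Lemma blip_bmeas h : blip h -> bmeas h.
Proof.
move=> [C [hC hL]]; split; last by exists C.
apply: continuous_measurable_fun => x; apply/cvgrPdist_lt => e e0.
have C0 : 0 <= C by exact: le_trans (hC 0).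
have C1 : 0 < C + 1 by rewrite ltr_wpDl.
apply/nbhs_ballP; exists (e / (C + 1)) => /=; first exact: divr_gt0.
move=> t xt'; have : `|x - t| < e / (C + 1) by [].
rewrite ltr_pdivlMr// mulrC => xt.
rewrite distrC (le_lt_trans (hL _ _))// distrC (le_lt_trans _ xt)//.
by rewrite ler_wpM2r// lerDl.
Qed.

Lemma RInt0_eq h k t : (forall r, 0 <= r <= t -> h r = k r) -> RInt0 t h = RInt0 t k.
Proof.
move=> hk; apply: eq_Rintegral => r; rewrite inE /= in_itv /=; exact: hk.
Qed.

Lemma RInt0_at0 h : RInt0 0 h = 0.
Proof. by rewrite /RInt0 set_itv1 Rintegral_set1. Qed.

Lemma RInt0D h k t : bmeas h -> bmeas k -> RInt0 t (fun r => h r + k r) = RInt0 t h + RInt0 t k.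
Proof. by move=> bh bk; apply: RintegralD => //; exact: bmeas_integrable. Qed.

Lemma RInt0B h k t : bmeas h -> bmeas k -> RInt0 t (fun r => h r - k r) = RInt0 t h - RInt0 t k.
Proof. by move=> bh bk; apply: RintegralB => //; exact: bmeas_integrable. Qed.

Lemma RInt0Z c h t : bmeas h -> RInt0 t (fun r => c * h r) = c * RInt0 t h.
Proof. by move=> bh; apply: RintegralZl => //; exact: bmeas_integrable. Qed.

Lemma RInt0_cst c t : 0 <= t -> RInt0 t (fun=> c) = c * t.
Proof.
move=> t0; rewrite /RInt0 Rintegral_cst//= lebesgue_measure_itv /= lte_fin.
move: t0; rewrite le_eqVlt => /predU1P[<-|t0]; first by rewrite ltxx.
by rewrite t0 /= subr0.
Qed.

Lemma RInt0_sum (I : Type) (s : seq I) (F : I -> R -> R) t :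
  (forall i, bmeas (F i)) -> RInt0 t (fun x => \sum_(i <- s) F i x) = \sum_(i <- s) RInt0 t (F i).
Proof.
move=> bF; elim: s => [|i s IH].
  rewrite big_nil (_ : (fun x => _) = fun=> 0 * 0); first by rewrite RInt0Z ?mul0r//; exact: bmeas_cst.
  by apply/funext => x; rewrite big_nil mul0r.
rewrite big_cons -IH -RInt0D//; last exact: bmeas_sum.
by apply: RInt0_eq => x _; rewrite big_cons.
Qed.

Lemma RInt0_le h k s t : bmeas h -> bmeas k -> 0 <= s -> s <= t ->
  (forall r, s <= r <= t -> h r <= k r) ->
  RInt0 t h - RInt0 s h <= RInt0 t k - RInt0 s k.
Proof.
move=> bh bk s0 st hk.
have ib g : bmeas g -> mu.-integrable `]s, t] (EFin \o g).
  move=> bg; apply: integrableS (bmeas_integrable s t bg) => //.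
  by apply: subset_itvr; rewrite bnd_simp.
rewrite /RInt0 !Rintegral_itvB ?bnd_simp//; try exact: bmeas_integrable.
apply: le_Rintegral => //; try exact: ib.
by move=> r /=; rewrite in_itv /= => /andP[sr rt]; apply: hk; rewrite ltW.
Qed.

Lemma RInt0_bound h M s t : bmeas h -> 0 <= s -> s <= t ->
  (forall r, s <= r <= t -> `|h r| <= M) -> `|RInt0 t h - RInt0 s h| <= M * (t - s).
Proof.
move=> bh s0 st hM.
have t0 := le_trans s0 st.
have := @RInt0_le h (fun=> M) s t bh (bmeas_cst _) s0 st _.
have := @RInt0_le (fun=> - M) h s t (bmeas_cst _) bh s0 st _.
rewrite !RInt0_cst// => h1 h2.
rewrite ler_norml; apply/andP; split.
  rewrite -mulNr mulrBr; apply: h1 => r rst.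
  by have := hM r rst; rewrite ler_norml => /andP[].
rewrite mulrBr; apply: h2 => r rst.
by have := hM r rst; rewrite ler_norml => /andP[].
Qed.

Lemma RInt0_bound0 h M t : bmeas h -> 0 <= t ->
  (forall r, 0 <= r <= t -> `|h r| <= M) -> `|RInt0 t h| <= M * t.
Proof. by move=> bh t0 hM; have := @RInt0_bound h M 0 t bh (lexx _) t0 hM; rewrite RInt0_at0 !subr0. Qed.

Lemma RInt0_norm_le h phi t : bmeas h -> bmeas phi -> 0 <= t ->
  (forall r, 0 <= r <= t -> `|h r| <= phi r) -> `|RInt0 t h| <= RInt0 t phi.
Proof.
move=> bh bp t0 hp.
have := @RInt0_le h phi 0 t bh bp (lexx _) t0 _.
have := @RInt0_le (fun r => - phi r) h 0 t (bmeasN bp) bh (lexx _) t0 _.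
have -> : RInt0 t (fun r => - phi r) = - RInt0 t phi.
  by rewrite -mulN1r -RInt0Z//; apply: RInt0_eq => r _; rewrite mulN1r.
rewrite !RInt0_at0 !subr0 => h1 h2; rewrite ler_norml h1 ?h2// => r /hp;
by rewrite ler_norml => /andP[].
Qed.

(** Curves are extended constantly outside [[0, T]] through this clamp, which keeps them bounded and
    Lipschitz on the whole line. *)
Definition clip (T t : R) : R := Num.max 0 (Num.min t T).

Lemma clip_itv T t : 0 <= T -> 0 <= clip T t <= T.
Proof. by move=> T0; rewrite /clip le_max lexx /= ge_max T0 ge_min lexx orbT. Qed.

Lemma clip_id T t : 0 <= t <= T -> clip T t = t.
Proof. by move=> /andP[t0 tT]; rewrite /clip min_l// max_r. Qed.

Lemma clip_lip T s t : `|clip T t - clip T s| <= `|t - s|.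
Proof.
have a1 := ler_norm (t - s).
have a2 := ler_norm (s - t); rewrite distrC in a2.
have a3 := normr_ge0 (t - s).
rewrite /clip ler_norml; move: a1 a2 a3; set d := `|t - s| => a1 a2 a3.
by have [h1|h1] := leP t T; have [h2|h2] := leP s T;
  repeat match goal with |- context [Num.max ?a ?b] => have [?|?] := leP a b end;
  apply/andP; split; lra.
Qed.

Lemma blip_RInt0 h T c : 0 <= T -> bmeas h -> blip (fun t => c + RInt0 (clip T t) h).
Proof.
move=> T0 bh; have [mh [M hM]] := bh.
have M0 : 0 <= M by exact: le_trans (hM 0).
exists (`|c| + M * T + M); split=> [t|s t].
  have /andP[c0 cT] := clip_itv t T0.
  rewrite (le_trans (ler_normD _ _))// -addrA lerD// (le_trans (RInt0_bound0 bh c0 (fun r _ => hM r)))//.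
  by rewrite ler_wpDr// ler_wpM2l.
rewrite opprD addrACA subrr add0r.
have key s' t' : s' <= t' -> `|RInt0 (clip T t') h - RInt0 (clip T s') h| <= M * `|t' - s'|.
  move=> st; have /andP[c0 cT] := clip_itv s' T0.
  have cst : clip T s' <= clip T t'.
    rewrite /clip; rewrite ge_max le_max lexx /= le_max; apply/orP; right.
    by rewrite le_min !ge_min st lexx orbT.
  rewrite (le_trans (RInt0_bound bh c0 cst (fun r _ => hM r)))// ler_wpM2l//.
  by rewrite (le_trans _ (clip_lip T _ _))// ler_norm.
apply: (@le_trans _ _ (M * `|t - s|)).
  by case: (leP s t) => [|/ltW] st; [|rewrite distrC [X in _ * X]distrC]; exact: key.
by rewrite ler_wpM2r// lerDr addr_ge0// mulr_ge0.
Qed.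

(** The rate of the weight is twice the Lipschitz constant, so one integration gains the factor 1/2
    that drives both Gronwall's lemma and Picard's iteration. *)
Lemma RInt0_expR L T t : 0 < L -> 0 <= t <= T ->
  L * RInt0 t (fun r => expR (2 * L * clip T r)) <= expR (2 * L * t) / 2.
Proof.
move=> L0 /andP[t0 tT].
case: (ltgtP t 0) t0 => // [t0 _|->_]; last first.
  by rewrite RInt0_at0 mulr0 divr_ge0// expR_ge0.
have L2 : 0 < 2 * L by rewrite mulr_gt0.
rewrite (@RInt0_eq _ (fun r => expR (2 * L * r))); last first.
  by move=> r /andP[r0 rt]; rewrite clip_id// r0 (le_trans rt).
have D (x : R) : is_derive x (1 : R) (fun r : R => (2 * L)^-1 * expR (2 * L * r)) (expR (2 * L * x)).
  apply: is_derive_eq; rewrite /GRing.scale /=.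
  by field; rewrite gt_eqF.
have cE : continuous (fun r : R => expR (2 * L * r)).
  move=> x; apply: continuous_comp; last exact: continuous_expR.
  by apply: cvgM; [exact: cvg_cst|exact: cvg_id].
have cF : continuous (fun r : R => (2 * L)^-1 * expR (2 * L * r)).
  by move=> x; apply: cvgM; [exact: cvg_cst|exact: cE].
have F2 := @continuous_FTC2 R (fun r : R => expR (2 * L * r)) (fun r : R => (2 * L)^-1 * expR (2 * L * r)) 0 t t0.
rewrite /RInt0 /Rintegral F2; first last.
- by move=> x _; rewrite derive1E; exact: derive_val.
- split; first by move=> x _; exact: ex_derive.
  + by apply: cvg_at_right_filter; exact: cF.
  + by apply: cvg_at_left_filter; exact: cF.
- exact: continuous_subspaceT.
rewrite /= mulr0 expR0 mulr1.
have : 0 <= (2 * L)^-1 by rewrite invr_ge0 ltW.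
have -> : L * ((2 * L)^-1 * expR (2 * L * t) - (2 * L)^-1) =
  expR (2 * L * t) / 2 - 1 / 2 by field; rewrite gt_eqF.
lra.
Qed.

Lemma bmeas_expR L T : 0 <= L -> 0 <= T -> bmeas (fun r => expR (2 * L * clip T r)).
Proof.
move=> L0 T0; split.
  apply: measurableT_comp => //; apply: measurable_funM => //.
  apply: measurable_maxr => //; exact: measurable_minr.
exists (expR (2 * L * T)) => r; have /andP[c0 cT] := clip_itv r T0.
by rewrite ger0_norm ?expR_ge0// ler_expR ler_wpM2l// mulr_ge0.
Qed.

(* Iterating [phi <= c E => phi <= (a + c / 2) E], with E the exponential weight, drives c to 2 a. *)
Lemma gronwall (phi : R -> R) a L T : bmeas phi -> 0 <= a -> 0 < L -> 0 <= T ->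
  (forall t, 0 <= t <= T -> phi t <= a + L * RInt0 t phi) ->
  forall t, 0 <= t <= T -> phi t <= 2 * a * expR (2 * L * T).
Proof.
move=> bp a0 L0 T0 hphi; have [_ [M hM]] := bp.
have M0 : 0 <= M by exact: le_trans (hM 0).
have step (k : nat) t : 0 <= t <= T -> phi t <= (2 * a + M / 2 ^+ k) * expR (2 * L * t).
  elim: k t => [|k IH] t tT; have /andP[t0 tT'] := tT.
    have e1 : 1 <= expR (2 * L * t).
      by rewrite (le_trans _ (expR_ge1Dx _))// lerDl !mulr_ge0// ltW.
    have := hM t; rewrite ler_norml => /andP[_ h].
    rewrite expr0 divr1 (le_trans h)//; nra.
  have hJ : RInt0 t phi <= (2 * a + M / 2 ^+ k) * RInt0 t (fun r => expR (2 * L * clip T r)).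
    have bE := bmeas_expR (ltW L0) T0.
    rewrite -RInt0Z//; have := @RInt0_le phi _ 0 t bp (bmeasZ (2 * a + M / 2 ^+ k) bE) (lexx _) t0.
    rewrite !RInt0_at0 !subr0; apply => r /andP[r0 rt].
    have rT : 0 <= r <= T by rewrite r0 (le_trans rt).
    by rewrite clip_id//; exact: IH.
  have c0 : 0 <= 2 * a + M / 2 ^+ k by rewrite addr_ge0 ?divr_ge0 ?exprn_ge0// mulr_ge0.
  have hE := @RInt0_expR L T t L0 tT.
  apply: le_trans (hphi t tT) _.
  have h1 : L * RInt0 t phi <= (2 * a + M / 2 ^+ k) * (expR (2 * L * t) / 2).
    apply: (@le_trans _ _ ((2 * a + M / 2 ^+ k) * (L * RInt0 t (fun r => expR (2 * L * clip T r))))).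
      by rewrite mulrCA ler_pM2l.
    by rewrite ler_wpM2l.
  have e1 : 1 <= expR (2 * L * t).
    by rewrite (le_trans _ (expR_ge1Dx _))// lerDl !mulr_ge0// ltW.
  have h2 : a <= a * expR (2 * L * t) by rewrite ler_peMr.
  rewrite exprS invfM (_ : _ * expR _ = a * expR (2 * L * t) +
      (2 * a + M / 2 ^+ k) * (expR (2 * L * t) / 2)); first exact: lerD.
  by field; rewrite expf_neq0.
move=> t tT; have /andP[t0 tT'] := tT.
have e0 := expR_gt0 (2 * L * T).
apply/ler_addgt0Pl => e e_gt0.
have [k hk] : exists k : nat, M * expR (2 * L * T) / 2 ^+ k <= e.
  exists (Num.truncn (M * expR (2 * L * T) / e)).+1.
  rewrite ler_pdivrMr ?exprn_gt0// -ler_pdivrMl// mulrC.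
  apply: ltW; apply: (lt_le_trans (real_truncnS_gt (num_real _))).
  set m := _.+1; rewrite -natrX ler_nat ltnW// ltn_expl//.
apply: le_trans (step k t tT) _.
have eT : expR (2 * L * t) <= expR (2 * L * T).
  by rewrite ler_expR ler_wpM2l// mulr_ge0// ltW.
have c0 : 0 <= 2 * a + M / 2 ^+ k by rewrite addr_ge0 ?divr_ge0 ?exprn_ge0// mulr_ge0.
apply: le_trans (ler_wpM2l c0 eT) _.
by rewrite mulrDl addrC lerD2r mulrAC.
Qed.

(** Cutting [[0, t]] into [n] equal pieces bounds the total increment by [C * t ^+ 2 / n]. *)
Lemma quad_const (F : R -> R) C T : 0 <= C ->
  (forall s t, 0 <= s -> s <= t -> t <= T -> `|F t - F s| <= C * (t - s) ^+ 2) ->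
  forall t, 0 <= t <= T -> F t = F 0.
Proof.
move=> C0 hF t /andP[t0 tT]; apply/eqP; rewrite -subr_eq0 -normr_le0.
have key n : `|F t - F 0| <= C * t ^+ 2 / n.+1%:R.
  pose x i : R := i%:R * (t / n.+1%:R).
  have -> : F t - F 0 = \sum_(i < n.+1) (F (x i.+1) - F (x i)).
    rewrite -(big_mkord xpredT (fun i => F (x i.+1) - F (x i))) telescope_sumr//.
    by rewrite /x mul0r mulrC divfK.
  apply: le_trans (ler_norm_sum _ _ _) _.
  apply: (@le_trans _ _ (\sum_(i < n.+1) C * (t / n.+1%:R) ^+ 2)).
    apply: ler_sum => i _.
    have d0 : 0 <= t / n.+1%:R by rewrite divr_ge0.
    have xi : x i.+1 - x i = t / n.+1%:R by rewrite /x -mulrBl -natrB// subSnn mul1r.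
    rewrite -xi; apply: hF.
    - by rewrite mulr_ge0.
    - by rewrite -subr_ge0 xi.
    - apply: le_trans tT; rewrite /x mulrCA ler_piMr// ler_pdivrMr// mul1r ler_nat.
      exact: ltn_ord.
  rewrite sumr_const card_ord -mulr_natr le_eqVlt; apply/orP; left; apply/eqP.
  by field; rewrite addr_eq0 eq_sym; apply/negP => /eqP h; have : 0 <= n%:R :> R; [by []|lra].
apply/ler_addgt0Pl => e e0; rewrite addr0.
apply: le_trans (key (Num.truncn (C * t ^+ 2 / e))) _.
rewrite ler_pdivrMr// -ler_pdivrMl// mulrC ltW//.
exact: (real_truncnS_gt (num_real _)).
Qed.

(** The densities are merely measurable, so nothing is differentiated: over [[s, t]] the increment
    of the difference of both sides is the integral of a function of size [O(t - s)], hence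
    quadratic, and [quad_const] applies. *)
Lemma product_rule (a b : R -> R) da db T : bmeas da -> bmeas db -> blip a -> blip b ->
  (forall t, 0 <= t <= T -> a t = a 0 + RInt0 t da) ->
  (forall t, 0 <= t <= T -> b t = b 0 + RInt0 t db) ->
  forall t, 0 <= t <= T -> a t * b t = a 0 * b 0 + RInt0 t (fun r => da r * b r + a r * db r).
Proof.
move=> mda mdb [Ca [aC aL]] [Cb [bC bL]] ha hb.
have ba : bmeas a by apply: blip_bmeas; exists Ca.
have bb : bmeas b by apply: blip_bmeas; exists Cb.
have [_ [A hA]] := mda; have [_ [B hB]] := mdb.
have A0 : 0 <= A by exact: le_trans (hA 0).
have B0 : 0 <= B by exact: le_trans (hB 0).
have Ca0 : 0 <= Ca by exact: le_trans (aC 0).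
have Cb0 : 0 <= Cb by exact: le_trans (bC 0).
pose g r := da r * b r + a r * db r.
have bg : bmeas g by apply: bmeasD; apply: bmeasM.
suff H t : 0 <= t <= T -> a t * b t - RInt0 t g = a 0 * b 0 - RInt0 0 g.
  by move=> t /H; rewrite RInt0_at0 subr0 => <-; rewrite subrK.
apply: (@quad_const (fun t => a t * b t - RInt0 t g) (A * Cb + Ca * B)).
  by rewrite addr_ge0// mulr_ge0.
move=> s t' s0 st tT.
have t0 := le_trans s0 st.
have ht : 0 <= t' <= T by rewrite t0.
have hs : 0 <= s <= T by rewrite s0 (le_trans st).
have da' : a t' - a s = RInt0 t' da - RInt0 s da by rewrite ha// (ha s)//; ring.
have db' : b t' - b s = RInt0 t' db - RInt0 s db by rewrite hb// (hb s)//; ring.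
pose k r := da r * (b t' - b r) + (a s - a r) * db r.
have bk : bmeas k.
  by apply: bmeasD; apply: bmeasM => //; apply: bmeasB => //; exact: bmeas_cst.
have e1 : (a t' * b t' - RInt0 t' g) - (a s * b s - RInt0 s g) = RInt0 t' k - RInt0 s k.
  have kE u : RInt0 u k = b t' * RInt0 u da + a s * RInt0 u db - RInt0 u g.
    rewrite -!RInt0Z// -RInt0D; [|exact: bmeasZ..]; rewrite -RInt0B//; last by apply: bmeasD; exact: bmeasZ.
    by apply: RInt0_eq => r _; rewrite /k /g; ring.
  rewrite !kE; transitivity (b t' * (a t' - a s) + a s * (b t' - b s) - (RInt0 t' g - RInt0 s g)); first by ring.
  by rewrite da' db'; ring.
rewrite e1 expr2 mulrA; apply: RInt0_bound => // r /andP[sr rt].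
rewrite (le_trans (ler_normD _ _))// [leRHS]mulrDl lerD// normrM.
  rewrite -mulrA ler_pM// (le_trans (bL _ _))// ler_wpM2l// ger0_norm ?subr_ge0//; lra.
rewrite mulrAC ler_pM// (le_trans (aL _ _))// ler_wpM2l// distrC ger0_norm ?subr_ge0//; lra.
Qed.

End BoundedMeasurable.

Section Curves.
Context {R : realType}.

Definition vblip n (z : R -> 'rV[R]_n) := exists C, (forall t, `|z t| <= C) /\
  forall s t, `|z t - z s| <= C * `|t - s|.

Lemma vblip_coord n (z : R -> 'rV[R]_n) j : vblip z -> blip (fun t => z t 0 j).
Proof.
move=> [C [h1 h2]]; exists C; split=> [t|s t].
  exact: le_trans (norm_rV_coord _ _) (h1 t).
apply: le_trans (h2 s t); have := norm_rV_coord (z t - z s) j; by rewrite !mxE.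
Qed.

Lemma coord_vblip n (z : R -> 'rV[R]_n) : (forall j, blip (fun t => z t 0 j)) -> vblip z.
Proof.
move=> /choice[C hC].
have C0 j : 0 <= C j by apply: le_trans (proj1 (hC j) 0).
have CS j : C j <= \sum_i C i by rewrite (bigD1 j)//= lerDl sumr_ge0.
exists (\sum_j C j); split=> [t|s t].
  apply: norm_rV_le => [|j]; first exact: sumr_ge0.
  exact: le_trans (proj1 (hC j) t) (CS j).
apply: norm_rV_le => [|j]; first by rewrite mulr_ge0// sumr_ge0.
by rewrite !mxE; apply: le_trans (proj2 (hC j) s t) _; rewrite ler_wpM2r.
Qed.

Lemma vblip_norm n (z : R -> 'rV[R]_n) : vblip z -> bmeas (fun t => `|z t|).
Proof.
move=> [C [h1 h2]]; apply: blip_bmeas; exists C; split=> [t|s t]; first by rewrite normr_id.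
exact: le_trans (ler_dist_dist _ _) (h2 s t).
Qed.

Lemma vblip_bmeas n (z : R -> 'rV[R]_n) j : vblip z -> bmeas (fun t => z t 0 j).
Proof. by move=> vz; apply: blip_bmeas; exact: vblip_coord. Qed.

Lemma vblipB n (z y : R -> 'rV[R]_n) : vblip z -> vblip y -> vblip (fun t => z t - y t).
Proof.
move=> [C [h1 h2]] [D [k1 k2]]; exists (C + D); split=> [t|s t].
  by rewrite (le_trans (ler_normB _ _))// lerD.
rewrite (_ : _ - _ = (z t - z s) - (y t - y s)); last by apply/rowP => j; rewrite !mxE; ring.
by rewrite (le_trans (ler_normB _ _))// mulrDl lerD.
Qed.

(* The limit is squeezed between the monotone sequences [u k -+ 2 D / 2 ^ k]. *)
Lemma geometric_limit (u : nat -> R) D : (forall k, `|u k.+1 - u k| <= D / 2 ^+ k) ->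
  exists l, forall k, `|u k - l| <= 2 * D / 2 ^+ k.
Proof.
move=> hu.
pose w k := u k - 2 * D / 2 ^+ k; pose v k := u k + 2 * D / 2 ^+ k.
have half k : 2 * D / 2 ^+ k.+1 = D / 2 ^+ k.
  by rewrite exprS; field; rewrite expf_neq0.
have split2 k : 2 * D / 2 ^+ k = 2 * (D / 2 ^+ k) by rewrite mulrA.
have wS k : w k <= w k.+1.
  by rewrite /w half split2; have := hu k; rewrite ler_norml => /andP[]; lra.
have vS k : v k.+1 <= v k.
  by rewrite /v half split2; have := hu k; rewrite ler_norml => /andP[]; lra.
have wm : {homo w : m n / (m <= n)%N >-> m <= n}.
  by apply: homo_leq => //; exact: le_trans.
have vm : {homo v : m n / (m <= n)%N >-> n <= m}.
  by apply: homo_leq => // x y z yx zx; exact: le_trans zx yx.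
have wv m n : w m <= v n.
  have h k : w k <= v k.
    have : 0 <= D / 2 ^+ k by apply: le_trans (hu k).
    by rewrite /w /v split2; lra.
  by apply: le_trans (le_trans (h (maxn m n)) (vm _ _ (leq_maxr m n))); apply: wm; exact: leq_maxl.
have hs : has_sup (range w).
  by split; [exists (w 0), 0|exists (v 0) => _ [k _ <-]].
exists (sup (range w)) => k.
have h1 : w k <= sup (range w) by apply: ub_le_sup; [case: hs|exists k].
have h2 : sup (range w) <= v k by apply: ge_sup; [case: hs|move=> _ [m _ <-]].
by rewrite ler_norml; apply/andP; move: h1 h2; rewrite /w /v; split; lra.
Qed.

Lemma half_pow_small (D e : R) : 0 < e -> exists k : nat, D / 2 ^+ k < e.
Proof.
move=> e0; exists (Num.truncn (D / e)).+1.
rewrite ltr_pdivrMr ?exprn_gt0// mulrC -ltr_pdivrMr//.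
apply: (lt_trans (real_truncnS_gt (num_real _))).
by rewrite -natrX ltr_nat ltn_expl.
Qed.

Lemma geometric_cvg (u : nat -> R) l D : (forall k, `|u k - l| <= D / 2 ^+ k) -> u @ \oo --> l.
Proof.
move=> h; apply/cvgrPdist_lt => e e0.
have [m hm] := half_pow_small D e0.
have D0 : 0 <= D by have := h 0%N; rewrite expr0 divr1; exact: le_trans.
exists m => // k /= mk; rewrite distrC (le_lt_trans (h k))// (le_lt_trans _ hm)//.
by rewrite ler_wpM2l// lef_pV2 ?posrE ?exprn_gt0// ler_eXn2l// ltr1n.
Qed.

Lemma le0_geometric (x D : R) : (forall k : nat, x <= D / 2 ^+ k) -> x <= 0.
Proof.
move=> h; apply/ler_addgt0Pl => e e0; rewrite addr0.
by have [k hk] := half_pow_small D e0; exact: le_trans (h k) (ltW hk).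
Qed.

End Curves.

(** * Carathéodory solutions by successive approximation *)

Section Picard.
Context {R : realType}.
Variables (n : nat) (T L M : R) (Y : R -> 'rV[R]_n -> 'rV[R]_n) (z0 : 'rV[R]_n).
Hypotheses (T0 : 0 <= T) (L0 : 0 < L).
Hypothesis YL : forall t z z', `|Y t z - Y t z'| <= L * `|z - z'|.
Hypothesis YM : forall t, `|Y t 0| <= M.
Hypothesis Ym : forall z : R -> 'rV[R]_n,
  (forall j, measurable_fun setT (fun t => z t 0 j)) ->
  forall j, measurable_fun setT (fun t => Y t (z t) 0 j).

Let vmb (z : R -> 'rV[R]_n) := (forall j, measurable_fun setT (fun t => z t 0 j)) /\
  exists C, forall t, `|z t| <= C.

Let Ybm z j : vmb z -> bmeas (fun t => Y t (z t) 0 j).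
Proof.
move=> [zm [C zC]]; split; first exact: Ym.
exists (M + L * C) => t.
rewrite (le_trans (norm_rV_coord _ _))// -[Y t (z t)](subrK (Y t 0)) addrC.
rewrite (le_trans (ler_normD _ _))// lerD// (le_trans (YL _ _ _))// subr0.
by rewrite ler_wpM2l// ltW.
Qed.

Let P (z : R -> 'rV[R]_n) t : 'rV[R]_n :=
  z0 + \row_j RInt0 (clip T t) (fun r => Y r (z r) 0 j).

Let P_vblip z : vmb z -> vblip (P z).
Proof.
move=> vz; apply: coord_vblip => j.
rewrite (_ : (fun t => _) = fun t => z0 0 j + RInt0 (clip T t) (fun r => Y r (z r) 0 j)).
  by apply: blip_RInt0 => //; exact: Ybm.
by apply/funext => t; rewrite !mxE.
Qed.

Let vblip_vmb (z : R -> 'rV[R]_n) : vblip z -> vmb z.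
Proof.
move=> vz; split; last by have [C [h _]] := vz; exists C.
by move=> j; have [] := vblip_bmeas j vz.
Qed.

Let zs k := iter k P (fun=> z0).

Let zs_vmb k : vmb (zs k).
Proof.
elim: k => [|k IH]; last exact/vblip_vmb/P_vblip.
by split=> [j|]; [exact: measurable_cst|exists `|z0|].
Qed.

(** In the sup norm weighted by [expR (- 2 * L * t)] the iteration contracts by 1/2, so one series
    of iterates converges on all of [[0, T]]. The limit is measurable as a pointwise limit, and
    Lipschitz because it is a primitive of a bounded function. *)
Lemma picard : exists2 z : R -> 'rV[R]_n, vblip z &
  forall t, z t = z0 + \row_j RInt0 (clip T t) (fun r => Y r (z r) 0 j).
Proof.
pose D := (M + L * `|z0|) * T.
have B0 : 0 <= M + L * `|z0|.
  by rewrite addr_ge0 ?mulr_ge0 ?(ltW L0)//; exact: le_trans (YM 0).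
have D0 : 0 <= D by rewrite mulr_ge0.
have cT t := clip_itv t T0.
have e1 t : 1 <= expR (2 * L * clip T t).
  have /andP[c0 _] := cT t.
  by rewrite (le_trans _ (expR_ge1Dx _))// lerDl !mulr_ge0// ltW.
have inc k t : `|zs k.+1 t - zs k t| <= D / 2 ^+ k * expR (2 * L * clip T t).
  elim: k t => [|k IH] t.
    have /andP[c0 ct] := cT t.
    rewrite expr0 divr1 (@le_trans _ _ D)//; last by rewrite ler_peMr.
    rewrite /= /P addrAC subrr add0r; apply: norm_rV_le => // j; rewrite mxE.
    apply: (@le_trans _ _ ((M + L * `|z0|) * clip T t)); last by rewrite ler_wpM2l.
    apply: RInt0_bound0 => // [|r _]; first exact: (Ybm _ (zs_vmb 0)).
    rewrite (le_trans (norm_rV_coord _ _))// -[Y r z0](subrK (Y r 0)) addrC.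
    by rewrite (le_trans (ler_normD _ _))// lerD// (le_trans (YL _ _ _))// subr0.
  have /andP[c0 ct] := cT t.
  have C0 : 0 <= D / 2 ^+ k by rewrite divr_ge0// exprn_ge0.
  have bE := bmeas_expR (ltW L0) T0.
  apply: norm_rV_le => [|j]; first by rewrite mulr_ge0 ?expR_ge0// divr_ge0// exprn_ge0.
  rewrite /= {1 3}/P !mxE opprD addrACA subrr add0r.
  rewrite -RInt0B; [|exact: (Ybm _ (zs_vmb k.+1))|exact: (Ybm _ (zs_vmb k))].
  apply: (@le_trans _ _ (RInt0 (clip T t) (fun r => (L * (D / 2 ^+ k)) * expR (2 * L * clip T r)))).
    apply: RInt0_norm_le => //.
    - by apply: bmeasB; [exact: (Ybm _ (zs_vmb k.+1))|exact: (Ybm _ (zs_vmb k))].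
    - exact: bmeasZ.
    move=> r _; have := norm_rV_coord (Y r (zs k.+1 r) - Y r (zs k r)) j; rewrite !mxE => h.
    apply: le_trans h _; apply: le_trans (YL _ _ _) _; rewrite -mulrA ler_pM2l//; exact: IH.
  rewrite RInt0Z// [L * _]mulrC -(mulrA (D / 2 ^+ k)).
  have := RInt0_expR L0 (cT t).
  move=> h; apply: le_trans (ler_wpM2l C0 h) _.
  by rewrite exprS invfM; lra.
have E t : expR (2 * L * clip T t) <= expR (2 * L * T).
  by have /andP[c0 ct] := cT t; rewrite ler_expR ler_wpM2l// mulr_ge0// ltW.
pose D' := D * expR (2 * L * T).
have D'0 : 0 <= D' by rewrite mulr_ge0// expR_ge0.
have inc' k t : `|zs k.+1 t - zs k t| <= D' / 2 ^+ k.
  apply: le_trans (inc k t) _; rewrite /D' [leRHS]mulrAC ler_wpM2l//.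
  by rewrite divr_ge0// exprn_ge0.
have lim t : exists l : 'rV[R]_n, forall k, `|zs k t - l| <= 2 * D' / 2 ^+ k.
  have limj j : exists l, forall k, `|zs k t 0 j - l| <= 2 * D' / 2 ^+ k.
    apply: geometric_limit => k; apply: le_trans (inc' k t).
    by have := norm_rV_coord (zs k.+1 t - zs k t) j; rewrite !mxE.
  have [l hl] := choice limj.
  exists (\row_j l j) => k; apply: norm_rV_le => [|j]; last by rewrite !mxE.
  by rewrite divr_ge0 ?exprn_ge0// mulr_ge0.
have [z hz] := choice lim.
have vz : vmb z.
  split=> [j|].
    apply: (@measurable_fun_cvg _ _ _ _ (fun k t => zs k t 0 j)) => [k|t _].
      exact: (zs_vmb k).1.
    apply: (@geometric_cvg _ _ _ (2 * D')) => k; apply: le_trans (hz t k).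
    by have := norm_rV_coord (zs k t - z t) j; rewrite !mxE.
  exists (`|z0| + 2 * D') => t; have := hz t 0%N; rewrite expr0 divr1 /= => h.
  rewrite -[z t](subrK z0) addrC (le_trans (ler_normD _ _))// lerD// distrC.
  exact: h.
have zP t : z t = P z t.
  apply/eqP; rewrite -subr_eq0 -normr_le0.
  have D2 : 0 <= 2 * D' by rewrite mulr_ge0.
  apply: (@le0_geometric _ _ (2 * D' + L * (2 * D') * T)) => k.
  have h1 : `|z t - zs k.+1 t| <= 2 * D' / 2 ^+ k.
    rewrite distrC; apply: le_trans (hz t k.+1) _; rewrite ler_wpM2l//.
    by rewrite lef_pV2 ?posrE ?exprn_gt0// ler_eXn2l// ltr1n.
  have h2 : `|zs k.+1 t - P z t| <= L * (2 * D' / 2 ^+ k) * T.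
    have /andP[c0 ct] := cT t.
    have q0 : 0 <= L * (2 * D' / 2 ^+ k) by rewrite mulr_ge0 ?(ltW L0)// divr_ge0// exprn_ge0.
    apply: norm_rV_le => [|j]; first by rewrite mulr_ge0.
    rewrite /= {1}/P !mxE opprD addrACA subrr add0r.
    rewrite -RInt0B; [|exact: (Ybm _ (zs_vmb k))|exact: Ybm].
    apply: (@le_trans _ _ (L * (2 * D' / 2 ^+ k) * clip T t)); last by rewrite ler_wpM2l.
    apply: RInt0_bound0 => //.
      by apply: bmeasB; [exact: (Ybm _ (zs_vmb k))|exact: Ybm].
    move=> r _; have := norm_rV_coord (Y r (zs k r) - Y r (z r)) j; rewrite !mxE => h.
    by apply: le_trans h _; apply: le_trans (YL _ _ _) _; rewrite ler_pM2l.
  rewrite -[z t](subrK (zs k.+1 t)) -addrA (le_trans (ler_normD _ _))// mulrDl.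
  by rewrite lerD// (le_trans h2)//; lra.
exists z => //; rewrite (_ : z = P z); first exact: P_vblip.
exact/funext.
Qed.

End Picard.

(** * Controlled vector fields *)

Section DirectionalMVT.
Context {R : realType}.

Lemma is_derive_line (V : normedModType R) (h : V -> R) (x v : V) (t d : R) :
  is_derive (x + t *: v) v h d -> is_derive t (1 : R) (fun s => h (x + s *: v)) d.
Proof.
move=> [dh <-].
have E : (fun s : R => s^-1 *: (((fun s => h (x + s *: v)) \o shift t) (s *: (1 : R)) - h (x + t *: v)))
   = (fun s => s^-1 *: ((h \o shift (x + t *: v)) (s *: v) - h (x + t *: v))).
  apply/funext => s /=; congr (_ *: (h _ - _)).
  have -> : s *: (1 : R) = s by rewrite /GRing.scale /= mulr1.
  by rewrite scalerDl addrCA.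
apply: DeriveDef; first by rewrite /derivable E.
by rewrite /derive E.
Qed.

Lemma mvt_line (V : normedModType R) (h dh : V -> R) (x v : V) (c : R) :
  (forall y, is_derive y v h (dh y)) ->
  exists2 s, (0 <= s <= c) || (c <= s <= 0) & h (x + c *: v) - h x = dh (x + s *: v) * c.
Proof.
move=> hd.
pose g (s : R) := h (x + s *: v).
have dg s : is_derive s (1 : R) g (dh (x + s *: v)) by apply: is_derive_line; exact: hd.
have cg (a b : R) : {within `[a, b], continuous g}.
  apply: continuous_subspaceT => s.
  by apply: differentiable_continuous; apply/derivable1_diffP; case: (dg s).
have g0 : g 0 = h x by rewrite /g scale0r addr0.
have [c0|c0] := leP 0 c.
  have [s] := MVT_segment c0 (fun x _ => dg x) (cg 0 c).
  rewrite in_itv /= g0 subr0 => /andP[s0 sc] e; exists s => //.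
  by rewrite s0 sc.
have [s] := MVT_segment (ltW c0) (fun x _ => dg x) (cg c 0).
rewrite in_itv /= g0 sub0r => /andP[sc s0] e; exists s.
  by rewrite s0 sc orbT.
by rewrite -[LHS]opprB -/(g c) e mulrN opprK.
Qed.

End DirectionalMVT.

Section MeasurableComposition.
Context {R : realType}.

Lemma measurable_vnorm n (z : R -> 'rV[R]_n) :
  (forall j, measurable_fun setT (fun t => z t 0 j)) -> measurable_fun setT (fun t => `|z t|).
Proof.
move=> mz; rewrite (_ : (fun t => _) = fun t => \big[Order.max/0]_(ij : 'I_1 * 'I_n) `|z t ij.1 ij.2|).
  elim: (index_enum _) => [|[i j] s IH].
    rewrite (_ : (fun t => _) = fun=> 0); first exact: measurable_cst.
    by apply/funext => t; rewrite big_nil.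
  rewrite (_ : (fun t => _) = (fun t => `|z t i j|) \max
     (fun t => \big[Order.max/0]_(ij <- s) `|z t ij.1 ij.2|)).
    apply: measurable_maxr => //; apply: measurableT_comp => //.
    by rewrite ord1; exact: mz.
  by apply/funext => t; rewrite big_cons.
by apply/funext => t; rewrite [LHS]mx_normrE.
Qed.

Lemma rat_approx n (x : 'rV[R]_n) (e : R) : 0 < e ->
  exists q : 'rV[rat]_n, `|x - map_mx ratr q| < e.
Proof.
move=> e0; have e2 : 0 < e / 2 by rewrite divr_gt0.
have ex j : exists q : rat, `|x 0 j - ratr q| <= e / 2.
  have [|q] := @rat_in_itvoo R (x 0 j - e / 2) (x 0 j + e / 2); first lra.
  rewrite in_itv /= => /andP[h1 h2]; exists q.
  by rewrite ler_norml; apply/andP; split; lra.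
have [q hq] := choice ex.
exists (\row_j q j); apply: (@le_lt_trans _ _ (e / 2)); last lra.
by apply: norm_rV_le => [|j]; [exact: ltW|rewrite !mxE].
Qed.

(** Continuity holds only relative to [D], which is an arbitrary set, so the preimage of a half-line
    is written as a countable union of conditions of closeness to rational centres, each of them
    measurable in time. *)
Lemma measurable_cont_comp n k (D : set ('rV[R]_n * 'rV[R]_k)) (h : 'rV[R]_n * 'rV[R]_k -> R)
    (z : R -> 'rV[R]_n) (u : R -> 'rV[R]_k) :
  cont_on D h -> (forall t, D (z t, u t)) ->
  (forall j, measurable_fun setT (fun t => z t 0 j)) ->
  (forall j, measurable_fun setT (fun t => u t 0 j)) ->
  measurable_fun setT (fun t => h (z t, u t)).
Proof.
move=> ch Dzu mz mu mT; apply: (measurability _ (RGenOInfty.measurableE R)) => //=.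
move=> _ [_ [a ->] <-]; rewrite setTI.
pose B (p : 'rV[rat]_n * 'rV[rat]_k * nat) :=
  [set t | `|z t - map_mx ratr p.1.1| < p.2.+1%:R^-1 /\ `|u t - map_mx ratr p.1.2| < p.2.+1%:R^-1].
have mlt m (y : R -> 'rV[R]_m) (c : 'rV[R]_m) r :
    (forall j, measurable_fun setT (fun t => y t 0 j)) -> measurable [set t | `|y t - c| < r].
  move=> my.
  have : measurable_fun setT (fun t => `|y t - c|).
    apply: measurable_vnorm => j.
    rewrite (_ : (fun t => _) = fun t => y t 0 j - c 0 j); last by apply/funext => t; rewrite !mxE.
    by apply: measurable_funB => //; exact: measurable_cst.
  move=> /(_ measurableT) /(_ _ (measurable_itv `]-oo, r[)).
  rewrite setTI; congr measurable; apply/seteqP; split => t /=; rewrite in_itv //=.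
have mB p : measurable (B p).
  rewrite (_ : B p = [set t | `|z t - map_mx ratr p.1.1| < p.2.+1%:R^-1] `&`
     [set t | `|u t - map_mx ratr p.1.2| < p.2.+1%:R^-1])//.
  by apply: measurableI; exact: mlt.
(* A rational box is kept when [h] exceeds [a] at all its points in [D]. This is a property of the
   box alone, so the selection does not affect measurability. *)
pose good (p : 'rV[rat]_n * 'rV[rat]_k * nat) := forall x, D x ->
  `|x.1 - map_mx ratr p.1.1| < p.2.+1%:R^-1 -> `|x.2 - map_mx ratr p.1.2| < p.2.+1%:R^-1 -> a < h x.
pose F i := if choice.unpickle i is Some p then [set t | good p /\ B p t] else set0.
have mF i : measurable (F i).
  rewrite /F; case: choice.unpickle => // p.
  have [gp|gp] := pselect (good p).
    by rewrite (_ : [set t | _] = B p)//; apply/seteqP; split=> t //= [].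
  by rewrite (_ : [set t | _] = set0)//; apply/seteqP; split=> t //= [].
rewrite (_ : _ @^-1` _ = \bigcup_i F i); first exact: bigcupT_measurable.
apply/seteqP; split => [t|t [i _]] /=; rewrite in_itv /= andbT; last first.
  by rewrite /F; case: choice.unpickle => // p [gp [h1 h2]]; exact: gp.
move=> ah; have [d d0 hd] := ch _ (Dzu t) (h (z t, u t) - a) (ltac:(by rewrite subr_gt0)).
set m := Num.truncn (2 / d).
have m0 : 0 < m.+1%:R^-1 :> R by rewrite invr_gt0.
have md : 2 * m.+1%:R^-1 < d.
  have := real_truncnS_gt (num_real (2 / d)); rewrite -/m ltr_pdivrMr// => h1.
  by rewrite ltr_pdivrMr// mulrC.
have [c1 hc1] := rat_approx (z t) m0; have [c2 hc2] := rat_approx (u t) m0.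
exists (choice.pickle (c1, c2, m)) => //; rewrite /F choice.pickleK; split => //.
move=> [x1 x2] Dx /= h1 h2.
have hx : `|(x1, x2) - (z t, u t)| < d.
  rewrite prod_normE /= gt_max; apply/andP; split.
    rewrite -(subrKA (map_mx ratr c1)) (le_lt_trans (ler_normD _ _))// (lt_trans _ md)//.
    by rewrite mulr2n mulrDl mul1r ltrD// distrC.
  rewrite -(subrKA (map_mx ratr c2)) (le_lt_trans (ler_normD _ _))// (lt_trans _ md)//.
  by rewrite mulr2n mulrDl mul1r ltrD// distrC.
by have := hd _ Dx hx; rewrite ltr_norml => /andP[]; lra.
Qed.

End MeasurableComposition.

Section VectorField.
Context {R : realType}.
Variables (n k : nat) (U : set 'rV[R]_k) (X : 'rV[R]_n -> 'rV[R]_k -> 'rV[R]_n)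
  (DX : 'I_n -> 'rV[R]_n -> 'rV[R]_k -> 'rV[R]_n).

(** Only partial derivatives along the coordinate axes are given; their joint continuity over a
    compact control set yields a linearization in [z] that is uniform in the control. *)
Record smooth_field : Prop := SmoothField {
  sf_compact : compact U;
  sf_cont : cont_on [set zu : 'rV[R]_n * 'rV[R]_k | U zu.2] (fun zu => X zu.1 zu.2);
  sf_dcont : forall i, cont_on [set zu : 'rV[R]_n * 'rV[R]_k | U zu.2] (fun zu => DX i zu.1 zu.2);
  sf_der : forall i j u z, U u -> is_derive z (evec i) (fun x => X x u 0 j) (DX i z u 0 j) }.

(** Retraction onto the sup-norm box of radius [rho], Lipschitz with constant 1. Composition with it
    makes the field bounded and globally Lipschitz without changing it inside the box. *)
Definition clipv (rho : R) (z : 'rV[R]_n) : 'rV[R]_n :=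
  \row_i (clip (2 * rho) (z 0 i + rho) - rho).

Lemma clipv_box rho z : 0 <= rho -> `|clipv rho z| <= rho.
Proof.
move=> r0; apply: norm_rV_le => // i; rewrite mxE.
have := @clip_itv _ (2 * rho) (z 0 i + rho); rewrite mulr_ge0// => /(_ isT)/andP[h1 h2].
by rewrite ler_norml; apply/andP; split; lra.
Qed.

Lemma clipv_id rho z : `|z| <= rho -> clipv rho z = z.
Proof.
move=> zr; apply/rowP => i; rewrite mxE clip_id ?addrK//.
have := le_trans (norm_rV_coord z i) zr; rewrite ler_norml => /andP[h1 h2].
by apply/andP; split; lra.
Qed.

Lemma clipv_lip rho z z' : `|clipv rho z - clipv rho z'| <= `|z - z'|.
Proof.
apply: norm_rV_le => // i; rewrite !mxE opprB addrA subrK.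
apply: le_trans (clip_lip _ _ _) _; rewrite opprD addrACA subrr addr0.
by have := norm_rV_coord (z - z') i; rewrite !mxE.
Qed.

Hypothesis sf : smooth_field.

Lemma field_bounded rho : exists2 M, 0 <= M & forall z u, `|z| <= rho -> U u ->
  `|X z u| <= M /\ forall i, `|DX i z u| <= M.
Proof.
have key (W : normedModType R) (h : 'rV[R]_n -> 'rV[R]_k -> W) :
    cont_on [set zu : 'rV[R]_n * 'rV[R]_k | U zu.2] (fun zu => h zu.1 zu.2) ->
    exists2 M, 0 <= M & forall z u, `|z| <= rho -> U u -> `|h z u| <= M.
  move=> ch; apply: contrapT => hM.
  have ex (p : nat) : exists zu : 'rV[R]_n * 'rV[R]_k,
      ([set z | `|z| <= rho] `*` U) zu /\ p%:R < `|h zu.1 zu.2|.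
    apply: contrapT => hp; apply: hM; exists p%:R => // z u zr Uu.
    by rewrite leNgt; apply/negP => h1; apply: hp; exists (z, u).
  have [zu hzu] := choice ex.
  have [x [xr xU] xc] := compact_seq (compact_setX (@compact_box R n rho) (sf_compact sf)) (fun p => (hzu p).1).
  have [d d0 hd] := ch x xU 1 ltr01.
  have [p pn hp] := xc _ d0 (Num.truncn (`|h x.1 x.2| + 1)).+1.
  have [[_ Up] hp2] := hzu p.
  have h1 := hd _ Up hp.
  have h2 : `|h x.1 x.2| + 1 < p%:R.
    by apply: (lt_le_trans (real_truncnS_gt (num_real _))); rewrite ler_nat.
  have := ler_distD 0 (h (zu p).1 (zu p).2) (h x.1 x.2).
  have h3 := lerB_dist (h (zu p).1 (zu p).2) (h x.1 x.2).
  lra.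
have [M0 M00 hM0] := key _ X (sf_cont sf).
have /choice[M hM] i : exists M, 0 <= M /\ forall z u, `|z| <= rho -> U u -> `|DX i z u| <= M.
  by have [M ? ?] := key _ (DX i) (sf_dcont sf i); exists M.
have MS i : M i <= \sum_i M i.
  by rewrite (bigD1 i)//= lerDl sumr_ge0// => l _; exact: (hM l).1.
have S0 : 0 <= \sum_i M i by apply: sumr_ge0 => l _; exact: (hM l).1.
exists (M0 + \sum_i M i); first by rewrite addr_ge0.
move=> z u zr Uu; split; first by rewrite (le_trans (hM0 _ _ zr Uu))// lerDl.
by move=> i; rewrite (le_trans ((hM i).2 _ _ zr Uu))// (le_trans (MS i))// lerDr.
Qed.

Lemma field_uniform rho e : 0 < e -> exists2 d : R, 0 < d & forall z z' u i,
  `|z| <= rho -> `|z'| <= rho -> U u -> `|z' - z| <= d -> `|DX i z' u - DX i z u| <= e.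
Proof.
move=> e0.
have key i : exists d : R, 0 < d /\ forall z z' u,
  `|z| <= rho -> `|z'| <= rho -> U u -> `|z' - z| <= d -> `|DX i z' u - DX i z u| <= e.
  apply: contrapT => hd.
  have ex (p : nat) : exists w : ('rV[R]_n * 'rV[R]_k) * 'rV[R]_n,
     ([set z | `|z| <= rho] `*` U) w.1 /\
     [/\ `|w.2| <= rho, `|w.2 - w.1.1| <= p.+1%:R^-1 & e < `|DX i w.2 w.1.2 - DX i w.1.1 w.1.2|].
    apply: contrapT => hp; apply: hd; exists p.+1%:R^-1; split=> // z z' u zr zr' Uu zz.
    by rewrite leNgt; apply/negP => h1; apply: hp; exists ((z, u), z').
  have [w hw] := choice ex.
  have [x [xr xU] xc] := compact_seq (compact_setX (@compact_box R n rho) (sf_compact sf)) (fun p => (hw p).1).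
  have [d d0 hx] := sf_dcont sf i xU (divr_gt0 e0 (ltr0Sn R 1)).
  have [p pn hp] := xc _ (divr_gt0 d0 (ltr0Sn R 1)) (Num.truncn (2 / d)).
  have [[_ Up] [_ hp2 hp3]] := hw p.
  have md : p.+1%:R^-1 < d / 2.
    rewrite -[ltRHS]invrK ltf_pV2 ?posrE ?invr_gt0 ?divr_gt0// invf_div.
    by apply: (lt_le_trans (real_truncnS_gt (num_real _))); rewrite ler_nat ltnS.
  have dd : d / 2 < d by lra.
  have h1 := hx (w p).1 Up (lt_trans hp dd).
  have := hp; rewrite prod_normE /= gt_max => /andP[hpa hpb].
  have h2 : `|((w p).2, (w p).1.2) - x| < d.
    rewrite prod_normE /= gt_max; apply/andP; split; last by rewrite (lt_trans hpb)//; lra.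
    rewrite -(subrKA (w p).1.1) (le_lt_trans (ler_normD _ _))// [ltRHS]splitr ltrD//.
    exact: le_lt_trans md.
  have := hx ((w p).2, (w p).1.2) Up h2; move=> /= {}h2.
  have := ler_distD (DX i x.1 x.2) (DX i (w p).2 (w p).1.2) (DX i (w p).1.1 (w p).1.2).
  rewrite (distrC (DX i x.1 x.2)); lra.
have [d hd] := choice key.
have ds0 : 0 < \big[Order.min/1]_i d i.
  elim/big_rec : _ => // i x _ x0; rewrite lt_min x0 andbT; exact: (hd i).1.
exists (\big[Order.min/1]_i d i) => // z z' u i zr zr' Uu zz.
apply: (hd i).2 => //; apply: le_trans zz _.
by rewrite (bigD1 i)//= ge_min lexx.
Qed.

(** Way points of a path from [z] to [z'] that changes one coordinate at a time, so that each leg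
    involves a single partial derivative. *)
Definition hyb (z z' : 'rV[R]_n) (m : nat) : 'rV[R]_n := \row_i if (i < m)%N then z' 0 i else z 0 i.

Lemma hyb0 z z' : hyb z z' 0 = z. Proof. by apply/rowP => i; rewrite mxE. Qed.

Lemma hybn z z' : hyb z z' n = z'. Proof. by apply/rowP => i; rewrite mxE ltn_ord. Qed.

Lemma hybS z z' (m : 'I_n) : hyb z z' m.+1 = hyb z z' m + (z' 0 m - z 0 m) *: evec m.
Proof.
apply/rowP => i; rewrite !mxE eqxx /= ltnS leq_eqVlt -val_eqE /=.
case: eqP => [/val_inj ->|_] /=; first by rewrite ltnn mulr1 addrC subrK.
by rewrite mulr0 addr0.
Qed.

(** Each [xi i] lies on the leg of the path in direction [i], hence in the coordinate box spanned by
    [z] and [z']; both its distance to [z] and its bound by [rho] follow. *)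
Lemma field_mvt z z' u j : U u -> exists xi : 'I_n -> 'rV[R]_n,
  (forall i, `|xi i - z| <= `|z' - z| /\ forall rho, `|z| <= rho -> `|z'| <= rho -> `|xi i| <= rho) /\
  X z' u 0 j - X z u 0 j = \sum_i (z' 0 i - z 0 i) * DX i (xi i) u 0 j.
Proof.
move=> Uu.
have ex (i : 'I_n) : exists xi : 'rV[R]_n,
  (`|xi - z| <= `|z' - z| /\ forall rho, `|z| <= rho -> `|z'| <= rho -> `|xi| <= rho) /\
  X (hyb z z' i.+1) u 0 j - X (hyb z z' i) u 0 j = (z' 0 i - z 0 i) * DX i xi u 0 j.
  have [s sc e] := @mvt_line R _ (fun x => X x u 0 j) (fun x => DX i x u 0 j)
    (hyb z z' i) (evec i) (z' 0 i - z 0 i) (fun y => sf_der sf i j y Uu).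
  exists (hyb z z' i + s *: evec i); split; last by rewrite hybS e mulrC.
  split=> [|rho zr zr'].
    apply: norm_rV_le => // l; rewrite !mxE eqxx /= -val_eqE /=.
    have := norm_rV_coord (z' - z) l; rewrite !mxE; apply: le_trans.
    case: (ltngtP l i) => li; rewrite ?mulr0 ?addr0 ?subrr ?normr0//.
    rewrite (val_inj li) mulr1 addrAC subrr add0r.
    by case/orP: sc => /andP[s0 s1]; [rewrite !ger0_norm//; lra|rewrite !ler0_norm//; lra].
  apply: norm_rV_le => [|l]; first exact: le_trans zr.
  have h1 := le_trans (norm_rV_coord z l) zr; have h2 := le_trans (norm_rV_coord z' l) zr'.
  rewrite !mxE eqxx /= -val_eqE /=.
  case: (ltngtP l i) => li; rewrite ?mulr0 ?addr0 ?subrr ?normr0//.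
  move: h1 h2; rewrite (val_inj li) mulr1 !ler_norml => /andP[h1 h1'] /andP[h2 h2'].
  by case/orP: sc => /andP[s0 s1]; apply/andP; split; lra.
have [xi hxi] := choice ex.
exists xi; split=> [i|]; first exact: (hxi i).1.
under eq_bigr do rewrite -(hxi _).2.
by rewrite -(big_mkord xpredT (fun i => X (hyb z z' i.+1) u 0 j - X (hyb z z' i) u 0 j)) telescope_sumr// hybn hyb0.
Qed.

Lemma field_lipschitz rho : exists2 L, 0 < L & forall z z' u, `|z| <= rho -> `|z'| <= rho -> U u ->
  `|X z' u - X z u| <= L * `|z' - z|.
Proof.
have [M M0 hM] := field_bounded rho.
exists (n%:R * M + 1); first by rewrite ltr_wpDl// mulr_ge0.
move=> z z' u zr zr' Uu.
apply: (@le_trans _ _ (n%:R * M * `|z' - z|)); last by rewrite ler_wpM2r// lerDl.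
apply: norm_rV_le => [|j]; first by rewrite !mulr_ge0.
rewrite !mxE; have [xi [hxi ->]] := field_mvt z z' j Uu.
rewrite (le_trans (ler_norm_sum _ _ _))//.
rewrite (_ : n%:R * M * _ = \sum_(i < n) (M * `|z' - z|)); last first.
  by rewrite sumr_const card_ord -mulrA mulr_natl.
apply: ler_sum => i _; rewrite normrM mulrC ler_pM//.
  apply: le_trans (norm_rV_coord _ _) _.
  by apply: (hM _ _ _ Uu).2; exact: (hxi i).2.
by have := norm_rV_coord (z' - z) i; rewrite !mxE.
Qed.

Lemma field_linearize rho e : 0 < e -> exists2 d : R, 0 < d & forall z z' u,
  `|z| <= rho -> `|z'| <= rho -> U u -> `|z' - z| <= d ->
  `|X z' u - X z u - \sum_i (z' 0 i - z 0 i) *: DX i z u| <= e * `|z' - z|.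
Proof.
move=> e0; have e1 : 0 < e / (n%:R + 1) by rewrite divr_gt0// ltr_wpDl.
have [d d0 hd] := field_uniform rho e1.
exists d => // z z' u zr zr' Uu zz.
apply: norm_rV_le => [|j]; first by rewrite mulr_ge0// ltW.
rewrite !mxE; have [xi [hxi ->]] := field_mvt z z' j Uu.
rewrite summxE -sumrB.
apply: (@le_trans _ _ (\sum_(i < n) (e / (n%:R + 1) * `|z' - z|))).
  apply: le_trans (ler_norm_sum _ _ _) _; apply: ler_sum => i _.
  rewrite !mxE -mulrBr normrM mulrC ler_pM//.
    have := norm_rV_coord (DX i (xi i) u - DX i z u) j; rewrite !mxE => /le_trans; apply.
    apply: hd => //; first exact: (hxi i).2.
    exact: le_trans (hxi i).1 zz.
  by have := norm_rV_coord (z' - z) i; rewrite !mxE.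
rewrite sumr_const card_ord -[leLHS]mulr_natr mulrAC ler_wpM2r//.
rewrite -mulrA ler_piMr// ?(ltW e0)// mulrC ler_pdivrMr ?mul1r ?lerDl//.
Qed.

Definition fc rho (z : 'rV[R]_n) u := X (clipv rho z) u.

Lemma measurable_field j (z : R -> 'rV[R]_n) (u : R -> 'rV[R]_k) : (forall t, U (u t)) ->
  (forall j, measurable_fun setT (fun t => z t 0 j)) ->
  (forall j, measurable_fun setT (fun t => u t 0 j)) ->
  measurable_fun setT (fun t => X (z t) (u t) 0 j).
Proof.
move=> Uu mz mu.
apply: (@measurable_cont_comp _ _ _ [set zu | U zu.2] (fun zu => X zu.1 zu.2 0 j)) => //.
move=> x Ux e e0; have [d d0 hd] := sf_cont sf Ux e0; exists d => // y Uy yx.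
have := norm_rV_coord (X y.1 y.2 - X x.1 x.2) j; rewrite !mxE => /le_lt_trans; apply.
exact: hd.
Qed.

Lemma measurable_dfield i j (z : R -> 'rV[R]_n) (u : R -> 'rV[R]_k) : (forall t, U (u t)) ->
  (forall j, measurable_fun setT (fun t => z t 0 j)) ->
  (forall j, measurable_fun setT (fun t => u t 0 j)) ->
  measurable_fun setT (fun t => DX i (z t) (u t) 0 j).
Proof.
move=> Uu mz mu.
apply: (@measurable_cont_comp _ _ _ [set zu | U zu.2] (fun zu => DX i zu.1 zu.2 0 j)) => //.
move=> x Ux e e0; have [d d0 hd] := sf_dcont sf i Ux e0; exists d => // y Uy yx.
have := norm_rV_coord (DX i y.1 y.2 - DX i x.1 x.2) j; rewrite !mxE => /le_lt_trans; apply.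
exact: hd.
Qed.

End VectorField.

(** * Insertion of time intervals *)

Section Translation.
Context {R : realType}.
Notation mu := (@lebesgue_measure R).
Implicit Types (g h k : R -> R) (a b s t d : R).

Lemma bmeas_integrable_oc h a b : bmeas h -> mu.-integrable `]a, b] (EFin \o h).
Proof.
move=> bh; apply: integrableS (bmeas_integrable a b bh) => //.
by apply: subset_itvr; rewrite bnd_simp.
Qed.

Lemma RInt0_oc h s t : bmeas h -> 0 <= s -> s <= t ->
  RInt0 t h - RInt0 s h = Rintegral mu `]s, t] h.
Proof.
by move=> bh s0 st; rewrite /RInt0 Rintegral_itvB ?bnd_simp//; exact: bmeas_integrable.
Qed.

Lemma RInt0_eq_oc h k s t : bmeas h -> bmeas k -> 0 <= s -> s <= t ->
  (forall r, s < r <= t -> h r = k r) ->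
  RInt0 t h - RInt0 s h = RInt0 t k - RInt0 s k.
Proof.
move=> bh bk s0 st hk; rewrite !RInt0_oc//; apply: eq_Rintegral => r.
by rewrite inE /= in_itv /=; exact: hk.
Qed.

Lemma measurable_shift d : measurable_fun setT (fun x : R => (x - d : measurableTypeR R)).
Proof. by apply: measurable_funB. Qed.

(** Both measures agree on half-open intervals, which determine Lebesgue measure. *)
Lemma lebesgue_measure_shift d (A : set R) : measurable A ->
  pushforward mu (fun x => x - d : measurableTypeR R) A = mu A.
Proof.
move=> mA; apply/esym.
apply: (@lebesgue_measure_unique R
  (pushforward mu (fun x => x - d : measurableTypeR R))) => //=.
  exact: measurable_shift.
move=> _ _ [[a b]] _ <-.
rewrite /pushforward (_ : _ @^-1` _ = `]a + d, b + d]%classic); last first.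
  by apply/seteqP; split => x /=; rewrite !in_itv /= ltrBrDr lerBlDr.
rewrite !lebesgue_measure_itv/= !lte_fin ltrD2r -!EFinB.
by rewrite opprD addrACA subrr addr0.
Qed.

Lemma bmeas_comp h (s : R -> R) : bmeas h -> measurable_fun setT s -> bmeas (fun t => h (s t)).
Proof. by move=> [mh [M hM]] ms; split; [exact: measurableT_comp|exists M]. Qed.

Lemma RInt0_shift g d a b : bmeas g -> 0 <= d -> d <= a -> a <= b ->
  RInt0 b (fun x => g (x - d)) - RInt0 a (fun x => g (x - d)) = RInt0 (b - d) g - RInt0 (a - d) g.
Proof.
move=> bg d0 da ab.
have bgs : bmeas (fun x => g (x - d)) by apply: bmeas_comp => //; exact: measurable_shift.
rewrite !RInt0_oc//; [|lra..].
rewrite /Rintegral; congr fine.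
have E : (fun x : R => x - d : measurableTypeR R) @^-1` `]a - d, b - d]%classic = `]a, b]%classic.
  by apply/seteqP; split => x /=; rewrite !in_itv /= ltrD2r lerD2r.
rewrite -[in LHS]E.
rewrite -(@integral_pushforward _ _ (measurableTypeR R) (measurableTypeR R) R (fun x => x - d)
   (measurable_shift d) mu `]a - d, b - d]%classic (EFin \o g)) //.
- apply: eq_measure_integral => [|mf A mA _]; first exact: measurable_shift.
  exact: lebesgue_measure_shift.
- by case: bg => mg _; exact/(@measurable_EFinP _ (measurableTypeR R)).
- by rewrite E; exact: (bmeas_integrable_oc a b bgs).
Qed.

(* Freezing time on ]a, a + d]. *)
Definition ins a d t : R := if t <= a then t else if t <= a + d then a else t - d.
Definition inI a d t : R := if (a < t) && (t <= a + d) then 1 else 0.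

Lemma ins_id a d t : t <= a -> ins a d t = t.
Proof. by rewrite /ins => ->. Qed.

Lemma ins_mid a d t : a <= t -> t <= a + d -> ins a d t = a.
Proof. by rewrite /ins => h ->; case: ifP => // h2; apply/eqP; rewrite eq_le h2. Qed.

Lemma ins_end a d t : 0 <= d -> a + d <= t -> ins a d t = t - d.
Proof.
move=> d0 h; rewrite /ins; case: ifP => h1; first lra.
by case: ifP => // h2; lra.
Qed.

Lemma ins_lip a d s t : 0 <= d -> `|ins a d t - ins a d s| <= `|t - s|.
Proof.
move=> d0.
have a1 := ler_norm (t - s).
have a2 := ler_norm (s - t); rewrite distrC in a2.
have a3 := normr_ge0 (t - s).
rewrite /ins ler_norml; move: a1 a2 a3; set D := `|t - s| => a1 a2 a3.
by have [?|?] := leP t a; have [?|?] := leP s a; have [?|?] := leP t (a + d);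
  have [?|?] := leP s (a + d); apply/andP; split; lra.
Qed.

Lemma ins_close a d t : 0 <= d -> `|ins a d t - t| <= d.
Proof.
move=> d0; rewrite /ins ler_norml.
by have [?|?] := leP t a; have [?|?] := leP t (a + d); apply/andP; split; lra.
Qed.

Lemma lip_measurable (f : R -> R) : (forall s t, `|f t - f s| <= `|t - s|) -> measurable_fun setT f.
Proof.
move=> h; apply: continuous_measurable_fun => x; apply/cvgrPdist_lt => e e0.
apply/nbhs_ballP; exists e => //= t xt.
by have xt' : `|x - t| < e by []; rewrite distrC (le_lt_trans (h _ _))// distrC.
Qed.

Lemma bmeas_inI a d : bmeas (inI a d).
Proof.
split; last by exists 1 => x; rewrite /inI; case: ifP; rewrite ?normr1 ?normr0.
rewrite (_ : inI a d = \1_(`]a, a + d]%classic)); first exact: measurable_indic.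
apply/funext => t; rewrite /inI indicE.
by case: ifP => h; [rewrite mem_set//= in_itv|rewrite memNset//= in_itv /= h].
Qed.

(** Change of variable for a time that stops on []a, a + d]]: the factor [1 - inI a d] kills the
    stop, and after it [ins] is a translation. *)
Lemma RInt0_ins a d g t : 0 <= a -> 0 <= d -> bmeas g -> 0 <= t ->
  RInt0 t (fun r => (1 - inI a d r) * g (ins a d r)) = RInt0 (ins a d t) g.
Proof.
move=> a0 d0 bg t0.
have bF : bmeas (fun r => (1 - inI a d r) * g (ins a d r)).
  apply: bmeasM; first by apply: bmeasB; [exact: bmeas_cst|exact: bmeas_inI].
  by apply: bmeas_comp => //; apply: lip_measurable => s u; exact: ins_lip.
set F := fun r => _ in bF *.
have F1 s : 0 <= s -> s <= a -> RInt0 s F = RInt0 s g.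
  move=> s0 sa; apply: RInt0_eq => r /andP[r0 rs].
  by rewrite /F /inI ltNge (le_trans rs sa) /= subr0 mul1r ins_id// (le_trans rs).
have F2 s : a <= s -> s <= a + d -> RInt0 s F = RInt0 a g.
  move=> sa sad; rewrite -F1//; apply/eqP; rewrite -subr_eq0; apply/eqP.
  rewrite (@RInt0_eq_oc F (fun=> 0) a s bF (bmeas_cst _) a0 sa) ?RInt0_cst ?mul0r ?subrr//; first exact: le_trans sa.
  by move=> r /andP[ar rs]; rewrite /F /inI ar (le_trans rs sad) subrr mul0r.
have [ta|ta] := leP t a; first by rewrite ins_id// F1.
have [tad|tad] := leP t (a + d); first by rewrite ins_mid ?(ltW ta)// F2// ltW.
rewrite ins_end ?(ltW tad)//.
have ad : a <= a + d by rewrite lerDl.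
rewrite -(subrK (RInt0 (a + d) F) (RInt0 t F)) (F2 (a + d))//.
have bgs : bmeas (fun x => g (x - d)) by apply: bmeas_comp => //; exact: measurable_shift.
rewrite -[RInt0 a g](F2 (a + d))//.
rewrite (@RInt0_eq_oc F (fun x => g (x - d)) (a + d) t)//; [|lra|exact: ltW|].
  rewrite F2// RInt0_shift//; [|lra|exact: ltW].
  by rewrite addrK subrK.
move=> r /andP[ar rt]; rewrite /F /inI leNgt ar andbF subr0 mul1r ins_end//; exact: ltW.
Qed.

Lemma RInt0_inI a d t : 0 <= a -> 0 <= d -> a + d <= t -> RInt0 t (inI a d) = d.
Proof.
move=> a0 d0 adt.
have t0 : 0 <= t by lra.
have := @RInt0_ins a d (fun=> 1) t a0 d0 (bmeas_cst _) t0.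
rewrite ins_end// RInt0_cst ?mul1r; last lra.
rewrite [X in RInt0 _ X](_ : _ = fun r => 1 - inI a d r); last first.
  by apply/funext => r; rewrite mulr1.
rewrite RInt0B; [|exact: bmeas_cst|exact: bmeas_inI].
by rewrite RInt0_cst//; lra.
Qed.

End Translation.

Section Insertions.
Context {R : realType}.
Variables (K : nat) (U : set 'rV[R]_K) (S h : R) (ub : R -> 'rV[R]_K)
  (ti : nat -> R) (ui : nat -> 'rV[R]_K).
Hypothesis h0 : 0 <= h.
Hypothesis ubU : forall t, U (ub t).
Hypothesis ubm : forall j, measurable_fun setT (fun t => ub t 0 j).
Hypothesis tiS : forall i, 0 <= ti i <= S.
Hypothesis uiU : forall i, U (ui i).

(* The time change [s] stops at [ti i] during the i-th inserted interval, whose indicator is [phi i];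
   [vb] is the indicator of the times at which the reference control runs. *)
Record inserted (M : nat) (s vb : R -> R) (u : R -> 'rV[R]_K) (phi : nat -> R -> R) : Prop := Inserted {
  inserted_lip : forall r t, `|s t - s r| <= `|t - r|;
  inserted_vb : bmeas vb;
  inserted_phi : forall i, bmeas (phi i);
  inserted_U : forall t, U (u t);
  inserted_um : forall j, measurable_fun setT (fun t => u t 0 j);
  inserted_val : forall t, [/\ vb t = 1, u t = ub (s t) & forall i, phi i t = 0] \/
    (vb t = 0 /\ exists i, [/\ (i < M)%N, forall j, phi j t = (j == i)%:R, u t = ui i & s t = ti i]);
  inserted_int : forall i, (i < M)%N -> RInt0 (S + M%:R * h) (phi i) = h;
  inserted_0 : s 0 = 0;
  inserted_S : s (S + M%:R * h) = S;
  inserted_itv : forall t, 0 <= t <= S + M%:R * h -> 0 <= s t <= S;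
  inserted_close : forall t, 0 <= t <= S + M%:R * h -> `|s t - t| <= M%:R * h;
  inserted_surj : forall r, 0 <= r <= S -> exists2 t, 0 <= t <= S + M%:R * h & s t = r;
  inserted_cv : forall g t, bmeas g -> 0 <= t <= S + M%:R * h ->
    RInt0 t (fun r => vb r * g (s r)) = RInt0 (s t) g }.

(** Induction on the number of intervals: the next one opens at a time [a] of the already stretched
    scale that the time change sends to [ti M]. Prescribed times may coincide; a new interval may
    then split an older one, and only the total length [h] of each indicator is preserved. *)
Lemma insertions M : exists s vb u phi, inserted M s vb u phi.
Proof.
elim: M => [|M [s [vb [u [phi I]]]]].
  exists id, (fun=> 1), ub, (fun _ _ => 0); split => //=.
  - exact: bmeas_cst.
  - by move=> _; exact: bmeas_cst.
  - by move=> t; left.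
  - by rewrite mul0r addr0.
  - by move=> t; rewrite mul0r addr0.
  - by move=> t; rewrite mul0r subrr normr0.
  - by move=> r rS; exists r => //; rewrite mul0r addr0.
  - by move=> g t bg _; apply: RInt0_eq => r _; rewrite mul1r.
have [a aT sa] := inserted_surj I (tiS M).
have /andP[a0 aT'] := aT.
set T := S + M%:R * h in aT aT'.
have TE : S + M.+1%:R * h = T + h by rewrite /T -addn1 natrD; ring.
have insT t : 0 <= t <= T + h -> 0 <= ins a h t <= T.
  move=> /andP[t0 tT]; rewrite /ins; have [h1|h1] := leP t a; first by rewrite t0 /=; lra.
  by have [h2|h2] := leP t (a + h); apply/andP; split; lra.
have insm : measurable_fun setT (ins a h) by apply: lip_measurable => r t; exact: ins_lip.
exists (s \o ins a h), (fun t => (1 - inI a h t) * vb (ins a h t)),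
  (fun t => if (a < t) && (t <= a + h) then ui M else u (ins a h t)),
  (fun i t => if i == M then inI a h t else (1 - inI a h t) * phi i (ins a h t)).
have bI := bmeas_inI a h.
have b1I : bmeas (fun t => 1 - inI a h t) by apply: bmeasB => //; exact: bmeas_cst.
split; rewrite ?TE.
- by move=> r t /=; exact: le_trans (inserted_lip I _ _) (ins_lip _ _ _ h0).
- by apply: bmeasM => //; apply: bmeas_comp => //; exact: inserted_vb I.
- move=> i; case: eqP => // _; apply: bmeasM => //; apply: bmeas_comp => //; exact: inserted_phi I i.
- by move=> t; case: ifP => _; [exact: uiU|exact: inserted_U I _].
- move=> j.
  rewrite (_ : (fun t => _) = fun t => inI a h t * ui M 0 j + (1 - inI a h t) * u (ins a h t) 0 j).
    apply: measurable_funD; apply: measurable_funM.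
    + exact: bI.1.
    + exact: (bmeas_cst (ui M 0 j)).1.
    + exact: b1I.1.
    + exact: (measurableT_comp (inserted_um I j) insm).
  by apply/funext => t; rewrite /inI; case: ifP => _; ring.
- move=> t; rewrite /inI; case: ifP => ht.
    right; split; first by rewrite subrr mul0r.
    exists M; split => //.
    + by move=> j; case: eqP => //; rewrite subrr mul0r.
    + by case/andP: ht => h1 h2; rewrite /= ins_mid// ltW.
  have [[v1 u1 p1]|[v0 [i [iM p1 u1 s1]]]] := inserted_val I (ins a h t); [left|right].
    by split; rewrite ?subr0 ?mul1r// => i; case: ifP => //; rewrite mul1r p1.
  split; first by rewrite v0 mulr0.
  exists i; split => //; first exact: ltnW.
  move=> j; case: eqP => [->|_]; last by rewrite subr0 mul1r p1.
  by rewrite gtn_eqF.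
- move=> i; rewrite ltnS leq_eqVlt => /orP[/eqP ->|iM].
    by rewrite eqxx RInt0_inI// lerD2r.
  rewrite (ltn_eqF iM) RInt0_ins//; [|exact: inserted_phi I i|by rewrite addr_ge0// (le_trans a0)].
  rewrite ins_end ?lerD2r// addrK; exact: inserted_int I _ iM.
- by rewrite /= ins_id// (inserted_0 I).
- by rewrite /= ins_end ?lerD2r// addrK; exact: inserted_S I.
- by move=> t /insT /(inserted_itv I).
- move=> t /[dup] /insT /(inserted_close I) h1 /andP[t0 tT] /=.
  rewrite -(subrKA (ins a h t)) (le_trans (ler_normD _ _))//.
  by rewrite -addn1 natrD mulrDl mul1r lerD// ins_close.
- move=> r /(inserted_surj I)[t tT st].
  have /andP[t0 tT'] := tT.
  have [ta|ta] := leP t a.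
    by exists t; rewrite /= ?ins_id// t0 (le_trans tT')// lerDl.
  exists (t + h); first by rewrite addr_ge0// lerD2r.
  by rewrite /= ins_end ?addrK// lerD2r ltW.
- move=> g t bg tT; have /andP[t0 _] := tT.
  rewrite -(inserted_cv I bg (insT t tT)) -(@RInt0_ins _ a h)//.
    by apply: RInt0_eq => r _ /=; rewrite mulrA.
  apply: bmeasM; first exact: inserted_vb I.
  apply: bmeas_comp => //; apply: lip_measurable; exact: inserted_lip I.
Qed.

End Insertions.

(** * Adjoint equation and first variation of the end point *)

Section LinearODE.
Context {R : realType}.
Implicit Types (t T : R).

Lemma bmeas_dotv n (a b : R -> 'rV[R]_n) : (forall j, bmeas (fun t => a t 0 j)) ->
  (forall j, bmeas (fun t => b t 0 j)) -> bmeas (fun t => dotv (a t) (b t)).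
Proof. by move=> ba bb; apply: bmeas_sum => j; exact: bmeasM. Qed.

Lemma dot_product_rule n (a b da db : R -> 'rV[R]_n) T : vblip a -> vblip b ->
  (forall j, bmeas (fun t => da t 0 j)) -> (forall j, bmeas (fun t => db t 0 j)) ->
  (forall t j, 0 <= t <= T -> a t 0 j = a 0 0 j + RInt0 t (fun r => da r 0 j)) ->
  (forall t j, 0 <= t <= T -> b t 0 j = b 0 0 j + RInt0 t (fun r => db r 0 j)) ->
  forall t, 0 <= t <= T -> dotv (a t) (b t) =
    dotv (a 0) (b 0) + RInt0 t (fun r => dotv (da r) (b r) + dotv (a r) (db r)).
Proof.
move=> va vb bda bdb ha hb t tT.
have ba j := vblip_bmeas j va; have bb j := vblip_bmeas j vb.
rewrite (@RInt0_eq _ _ (fun r => \sum_i (da r 0 i * b r 0 i + a r 0 i * db r 0 i))); last first.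
  by move=> r _; rewrite big_split.
rewrite RInt0_sum; last by move=> i; apply: bmeasD; exact: bmeasM.
rewrite -big_split; apply: eq_bigr => i _ /=.
by apply: (@product_rule _ (fun r => a r 0 i) (fun r => b r 0 i) _ _ T) => //;
  [exact: vblip_coord..|move=> r; exact: ha|move=> r; exact: hb].
Qed.

Lemma linear_ode n T (A : R -> 'M[R]_n) (z0 : 'rV[R]_n) : 0 <= T ->
  (forall i j, bmeas (fun t => A t i j)) ->
  exists2 z : R -> 'rV[R]_n, vblip z &
    forall t, z t = z0 + \row_j RInt0 (clip T t) (fun r => (z r *m A r) 0 j).
Proof.
move=> T0 bA.
have /choice[M hM] (ij : 'I_n * 'I_n) : exists M, forall t, `|A t ij.1 ij.2| <= M.
  by have [_ [M ?]] := bA ij.1 ij.2; exists M.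
pose MA := \sum_ij M ij.
have M0 ij : 0 <= M ij by exact: le_trans (hM ij 0).
have hA t i j : `|A t i j| <= MA.
  apply: le_trans (hM (i, j) t) _.
  by rewrite /MA (bigD1 (i, j))//= lerDl sumr_ge0.
have MA0 : 0 <= MA by apply: sumr_ge0.
have L0 : 0 < n%:R * MA + 1 by rewrite ltr_wpDl// mulr_ge0.
apply: (@picard R n T (n%:R * MA + 1) 0 (fun t z => z *m A t) z0 T0 L0).
- move=> t z z'; rewrite -mulmxBl.
  apply: (@le_trans _ _ (n%:R * MA * `|z - z'|)); last by rewrite ler_wpM2r// lerDl.
  apply: norm_rV_le => [|j]; first by rewrite !mulr_ge0.
  rewrite mxE (le_trans (ler_norm_sum _ _ _))//.
  rewrite (_ : n%:R * MA * _ = \sum_(i < n) (`|z - z'| * MA)); last first.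
    by rewrite sumr_const card_ord -mulrA mulr_natl mulrC.
  by apply: ler_sum => i _; rewrite normrM ler_pM// norm_rV_coord.
- by move=> t; rewrite mul0mx normr0.
- move=> z mz j.
  rewrite (_ : (fun t => _) = fun t => \sum_(i < n) (z t 0 i * A t i j)); last first.
    by apply/funext => t; rewrite mxE.
  elim: (index_enum _) => [|i s IH].
    rewrite (_ : (fun t => _) = fun=> 0); first exact: (bmeas_cst 0).1.
    by apply/funext => t; rewrite big_nil.
  rewrite (_ : (fun t => _) = fun t => z t 0 i * A t i j + \sum_(i <- s) z t 0 i * A t i j).
    apply: measurable_funD => //; apply: measurable_funM; [exact: mz|exact: (bA i j).1].
  by apply/funext => t; rewrite big_cons.
Qed.

(* With Y' = Y A and Q' = - A Q, both starting at 1, the product Y Q is constant;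
   the adjoint solutions with prescribed terminal value are then combinations of columns of Q. *)
Lemma adjoint_basis n T (A : R -> 'M[R]_n) : 0 <= T ->
  (forall i j, bmeas (fun t => A t i j)) ->
  exists P : 'I_n -> R -> 'rV[R]_n, [/\ forall j, vblip (P j), forall j, P j T = evec j &
    forall j t i, 0 <= t <= T -> P j t 0 i = P j 0 0 i +
      RInt0 t (fun r => - \sum_l A r i l * P j r 0 l)].
Proof.
move=> T0 bA.
have /choice[y hy] (i : 'I_n) : exists y : R -> 'rV[R]_n, vblip y /\
    forall t, y t = evec i + \row_j RInt0 (clip T t) (fun r => (y r *m A r) 0 j).
  by have [y] := linear_ode (evec i) T0 bA; exists y.
have bAT i j : bmeas (fun t => (- (A t)^T) i j).
  rewrite (_ : (fun t => _) = fun t => - A t j i); first exact: bmeasN.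
  by apply/funext => t; rewrite !mxE.
have /choice[q hq] (i : 'I_n) : exists q : R -> 'rV[R]_n, vblip q /\
    forall t, q t = evec i + \row_j RInt0 (clip T t) (fun r => (q r *m (- (A r)^T)) 0 j).
  by have [q] := linear_ode (evec i) T0 bAT; exists q.
have qE r j l : (q j r *m (- (A r)^T)) 0 l = - \sum_i A r l i * q j r 0 i.
  by rewrite mxE -sumrN; apply: eq_bigr => i _; rewrite !mxE mulrN mulrC.
have c0 : clip T 0 = 0 by rewrite clip_id// lexx.
have y0 i : y i 0 = evec i.
  by rewrite (hy i).2 c0; apply/rowP => j; rewrite !mxE RInt0_at0 addr0.
have q0 i : q i 0 = evec i.
  by rewrite (hq i).2 c0; apply/rowP => j; rewrite !mxE RInt0_at0 addr0.
have by' i j : bmeas (fun t => y i t 0 j) by apply: vblip_bmeas; exact: (hy i).1.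
have bq i j : bmeas (fun t => q i t 0 j) by apply: vblip_bmeas; exact: (hq i).1.
have hyt i t j : 0 <= t <= T -> y i t 0 j = y i 0 0 j + RInt0 t (fun r => (y i r *m A r) 0 j).
  by move=> tT; rewrite (hy i).2 y0 clip_id// !mxE.
have hqt i t j : 0 <= t <= T -> q i t 0 j = q i 0 0 j + RInt0 t (fun r => (q i r *m (- (A r)^T)) 0 j).
  by move=> tT; rewrite (hq i).2 q0 clip_id// !mxE.
have bmul (z : R -> 'rV[R]_n) (B : R -> 'M[R]_n) : (forall j, bmeas (fun t => z t 0 j)) ->
    (forall i j, bmeas (fun t => B t i j)) -> forall j, bmeas (fun t => (z t *m B t) 0 j).
  move=> bz bB j; rewrite (_ : (fun t => _) = fun t => \sum_l z t 0 l * B t l j).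
    by apply: bmeas_sum => l; exact: bmeasM.
  by apply/funext => t; rewrite mxE.
have yq i j t : 0 <= t <= T -> dotv (y i t) (q j t) = (i == j)%:R.
  move=> tT; rewrite (@dot_product_rule _ (y i) (q j) (fun r => y i r *m A r)
     (fun r => q j r *m (- (A r)^T)) T (hy i).1 (hq j).1
     (bmul _ _ (by' i) bA) (bmul _ _ (bq j) bAT) (hyt i) (hqt j) t tT).
  rewrite y0 q0 dotv_evec mxE eqxx /= eq_sym (@RInt0_eq _ _ (fun=> 0)).
    by rewrite RInt0_cst ?mul0r ?addr0//; case/andP: tT.
  move=> r _; rewrite /dotv.
  under [X in _ + X]eq_bigr do rewrite qE mulrN mulr_sumr.
  rewrite sumrN; apply/eqP; rewrite subr_eq0; apply/eqP.
  under eq_bigr do rewrite mxE mulr_suml.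
  by rewrite exchange_big; apply: eq_bigr => l _; apply: eq_bigr => m _ /=; rewrite mulrA.
pose Ym : 'M[R]_n := \matrix_(i, j) y i T 0 j.
pose Qm : 'M[R]_n := \matrix_(i, j) q j T 0 i.
have TT : 0 <= T <= T by rewrite T0 lexx.
have YQ : Ym *m Qm = 1%:M.
  apply/matrixP => i j; rewrite !mxE -(yq i j T TT).
  by apply: eq_bigr => l _; rewrite !mxE.
(* A one-sided inverse of a square matrix is two-sided: the combinations below equal [evec j] at [T]
   through [Qm *m Ym = 1]. *)
have QY := mulmx1C YQ.
exists (fun j t => \sum_l y l T 0 j *: q l t); split.
- move=> j; apply: coord_vblip => i.
  rewrite (_ : (fun t => _) = fun t => \sum_l y l T 0 j * q l t 0 i); last first.
    by apply/funext => t; rewrite summxE; apply: eq_bigr => l _; rewrite mxE.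
  elim: (index_enum _) => [|l s IH].
    exists 0; split => [t|s t]; first by rewrite big_nil normr0.
    by rewrite !big_nil subrr normr0 mul0r.
  have [C [C1 C2]] := IH; have [D [D1 D2]] := vblip_coord i (hq l).1.
  exists (`|y l T 0 j| * D + C); split => [t|r t]; rewrite !big_cons.
    by rewrite (le_trans (ler_normD _ _))// lerD// normrM ler_wpM2l.
  rewrite opprD addrACA -mulrBr (le_trans (ler_normD _ _))// mulrDl lerD// normrM -mulrA.
  by rewrite ler_wpM2l.
- move=> j; apply/rowP => i; rewrite summxE.
  transitivity ((Qm *m Ym) i j); last by rewrite QY /evec !mxE eqxx.
  by rewrite mxE; apply: eq_bigr => l _; rewrite !mxE mulrC.
- move=> j t i tT; rewrite !summxE.
  transitivity (\sum_l (y l T 0 j * q l 0 0 i +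
     RInt0 t (fun r => y l T 0 j * (- \sum_m A r i m * q l r 0 m)))).
    apply: eq_bigr => l _; rewrite mxE (hqt l t i tT) [LHS]mulrDr; congr (_ + _).
    have bs : bmeas (fun r => - \sum_m A r i m * q l r 0 m).
      by apply: bmeasN; apply: bmeas_sum => m; exact: bmeasM.
    by rewrite RInt0Z//; congr (_ * _); apply: RInt0_eq => r _; rewrite qE.
  rewrite big_split /=; congr (_ + _); first by apply: eq_bigr => l _; rewrite mxE.
  rewrite -RInt0_sum; last first.
    by move=> l; apply: bmeasZ; apply: bmeasN; apply: bmeas_sum => m; exact: bmeasM.
  apply: RInt0_eq => r _; transitivity (\sum_l - \sum_m y l T 0 j * (A r i m * q l r 0 m)).
    by apply: eq_bigr => l _; rewrite mulrN mulr_sumr.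
  rewrite sumrN exchange_big; congr (- _); apply: eq_bigr => m _ /=.
  by rewrite summxE mulr_sumr; apply: eq_bigr => l _; rewrite mxE; ring.
Qed.

End LinearODE.

Section Endpoint.
Context {R : realType}.
Variables (n K m : nat) (U : set 'rV[R]_K) (X : 'rV[R]_n -> 'rV[R]_K -> 'rV[R]_n)
  (DX : 'I_n -> 'rV[R]_n -> 'rV[R]_K -> 'rV[R]_n).
Hypothesis sf : smooth_field U X DX.
Variables (T rho V : R) (vb : R -> R) (psi : 'I_m -> R -> R) (u : R -> 'rV[R]_K)
  (y0 : 'rV[R]_n).
Hypotheses (T0 : 0 <= T) (rho0 : 0 <= rho) (V0 : 0 <= V).
Hypotheses (bvb : bmeas vb) (bpsi : forall i, bmeas (psi i)).
Hypotheses (vbV : forall t, `|vb t| <= V) (psiV : forall i t, `|psi i t| <= V).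
Hypotheses (uU : forall t, U (u t)) (um : forall j, measurable_fun setT (fun t => u t 0 j)).

(** Speed along the perturbed process, affine in the parameter [e]; the control [u] does not depend
    on [e]. *)
Definition weight (e : 'rV[R]_m) t := vb t + \sum_i e 0 i * psi i t.

Definition is_traj (e : 'rV[R]_m) (z : R -> 'rV[R]_n) := vblip z /\
  forall t j, 0 <= t <= T ->
    z t 0 j = y0 0 j + RInt0 t (fun r => weight e r * fc X rho (z r) (u r) 0 j).

Lemma bmeas_weight e : bmeas (weight e).
Proof. by apply: bmeasD => //; apply: bmeas_sum => i; exact: bmeasZ. Qed.

Lemma weightB e e' t : `|weight e t - weight e' t| <= m%:R * V * `|e - e'|.
Proof.
rewrite /weight opprD addrACA subrr add0r -sumrB (le_trans (ler_norm_sum _ _ _))//.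
rewrite (_ : m%:R * V * _ = \sum_(i < m) (`|e - e'| * V)); last first.
  by rewrite sumr_const card_ord -mulrA mulr_natl mulrC.
apply: ler_sum => i _; rewrite -mulrBl normrM ler_pM//.
by have := norm_rV_coord (e - e') i; rewrite !mxE.
Qed.

Lemma weight_le e t : `|e| <= 1 -> `|weight e t| <= V + m%:R * V.
Proof.
move=> e1; have := weightB e 0 t; rewrite subr0.
have -> : weight 0 t = vb t.
  by rewrite /weight big1 ?addr0// => i _; rewrite mxE mul0r.
move=> h; rewrite -[weight e t](subrK (vb t)) addrC (le_trans (ler_normD _ _))// lerD//.
by rewrite (le_trans h)// ler_piMr// mulr_ge0.
Qed.

Lemma fc_lipschitz : exists2 L, 0 < L & forall z z' w, U w ->
  `|fc X rho z w - fc X rho z' w| <= L * `|z - z'|.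
Proof.
have [L L0 hL] := field_lipschitz sf rho; exists L => // z z' w Uw.
apply: le_trans (hL _ _ _ _ _ Uw) _; try exact: clipv_box.
by rewrite ler_pM2l// clipv_lip.
Qed.

Lemma fc_bounded : exists2 M, 0 <= M & forall z w, U w -> `|fc X rho z w| <= M.
Proof.
have [M M0 hM] := field_bounded sf rho; exists M => // z w Uw.
by apply: (hM _ _ _ Uw).1; exact: clipv_box.
Qed.

Lemma measurable_fc (z : R -> 'rV[R]_n) j : (forall j, measurable_fun setT (fun t => z t 0 j)) ->
  measurable_fun setT (fun t => fc X rho (z t) (u t) 0 j).
Proof.
move=> mz; apply: (measurable_field sf j uU) => // i.
rewrite (_ : (fun t => _) = fun t => clip (2 * rho) (z t 0 i + rho) - rho); last first.
  by apply/funext => t; rewrite mxE.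
apply: measurable_funB; last exact: (bmeas_cst rho).1.
apply: (@measurableT_comp _ _ _ _ _ _ (clip (2 * rho))).
  by apply: lip_measurable => s t; exact: clip_lip.
by apply: measurable_funD => //; exact: (bmeas_cst rho).1.
Qed.

Lemma bmeas_fc (z : R -> 'rV[R]_n) j : vblip z -> bmeas (fun t => fc X rho (z t) (u t) 0 j).
Proof.
move=> vz; split; first by apply: measurable_fc => i; exact: (vblip_bmeas i vz).1.
have [M M0 hM] := fc_bounded; exists M => t.
exact: le_trans (norm_rV_coord _ _) (hM _ _ (uU t)).
Qed.

Lemma traj_exists e : `|e| <= 1 -> exists z, is_traj e z.
Proof.
move=> e1; have [L L0 hL] := fc_lipschitz; have [M M0 hM] := fc_bounded.
have W0 : 0 <= V + m%:R * V by rewrite addr_ge0// mulr_ge0.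
have L1 : 0 < (V + m%:R * V) * L + 1 by rewrite ltr_wpDl// mulr_ge0// ltW.
have [|||z vz hz] := @picard R n T ((V + m%:R * V) * L + 1) ((V + m%:R * V) * M)
  (fun t z => weight e t *: fc X rho z (u t)) y0 T0 L1.
- move=> t z z'; rewrite -scalerBr normrZ.
  apply: (@le_trans _ _ ((V + m%:R * V) * L * `|z - z'|)).
    by rewrite -mulrA ler_pM// ?weight_le// hL.
  by rewrite ler_wpM2r// lerDl.
- by move=> t; rewrite normrZ ler_pM// ?weight_le// hM.
- move=> z mz j; rewrite (_ : (fun t => _) = fun t => weight e t * fc X rho (z t) (u t) 0 j).
    by apply: measurable_funM; [exact: (bmeas_weight e).1|exact: measurable_fc].
  by apply/funext => t; rewrite mxE.
exists z; split => // t j tT; rewrite {1}hz clip_id// !mxE.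
by congr (_ + _); apply: RInt0_eq => r _; rewrite mxE.
Qed.

(** Gronwall's lemma for the difference: the weights differ by [O(|e - e'|)], and the cut-off field
    is bounded and globally Lipschitz. *)
Lemma traj_stable : exists2 C, 0 <= C & forall e e' z z', `|e| <= 1 -> `|e'| <= 1 ->
  is_traj e z -> is_traj e' z' -> forall t, 0 <= t <= T -> `|z t - z' t| <= C * `|e - e'|.
Proof.
have [L L0 hL] := fc_lipschitz; have [M M0 hM] := fc_bounded.
have W0 : 0 <= V + m%:R * V by rewrite addr_ge0// mulr_ge0.
set L1 := (V + m%:R * V) * L + 1.
have L10 : 0 < L1 by rewrite ltr_wpDl// mulr_ge0// ltW.
have B0 : 0 <= m%:R * V * M * T by rewrite !mulr_ge0.
exists (2 * (m%:R * V * M * T) * expR (2 * L1 * T)).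
  by rewrite !mulr_ge0// expR_ge0.
move=> e e' z z' e1 e1' [vz hz] [vz' hz'] t tT.
have vd := vblipB vz vz'.
have -> : 2 * (m%:R * V * M * T) * expR (2 * L1 * T) * `|e - e'| =
  2 * (m%:R * V * M * T * `|e - e'|) * expR (2 * L1 * T) by ring.
apply: (@gronwall _ (fun r => `|z r - z' r|) _ L1 T (vblip_norm vd)) => //.
  by rewrite mulr_ge0.
move=> r rT; have /andP[r0 rT'] := rT.
have bn := vblip_norm vd.
have J0' : 0 <= RInt0 r (fun s => `|z s - z' s|).
  have := @RInt0_norm_le _ (fun=> 0) (fun s => `|z s - z' s|) r (bmeas_cst _) bn r0.
  by move=> /(_ (fun s _ => ltac:(by rewrite normr0)))/(le_trans (normr_ge0 _)).
apply: norm_rV_le => [|j].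
  by rewrite addr_ge0// ?mulr_ge0// ltW.
rewrite !mxE (hz r j rT) (hz' r j rT) opprD addrACA subrr add0r.
have bz := bmeas_fc j vz; have bz' := bmeas_fc j vz'.
rewrite -RInt0B; try by apply: bmeasM => //; exact: bmeas_weight.
apply: (@le_trans _ _ (RInt0 r (fun s => m%:R * V * M * `|e - e'| + L1 * `|z s - z' s|))).
  apply: RInt0_norm_le => //.
  - by apply: bmeasB; apply: bmeasM => //; exact: bmeas_weight.
  - by apply: bmeasD; [exact: bmeas_cst|exact: bmeasZ].
  move=> s _.
  set a := fc X rho (z s) (u s) 0 j; set a' := fc X rho (z' s) (u s) 0 j.
  have -> : weight e s * a - weight e' s * a' = (weight e s - weight e' s) * a' + weight e s * (a - a') by ring.
  rewrite (le_trans (ler_normD _ _))// lerD// normrM.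
    rewrite mulrAC ler_pM// ?weightB//.
    exact: le_trans (norm_rV_coord _ _) (hM _ _ (uU s)).
  apply: (@le_trans _ _ ((V + m%:R * V) * (L * `|z s - z' s|))).
    rewrite ler_pM// ?weight_le//.
    have := norm_rV_coord (fc X rho (z s) (u s) - fc X rho (z' s) (u s)) j; rewrite !mxE.
    by move=> /le_trans; apply; exact: hL.
  by rewrite mulrA ler_wpM2r// lerDl.
rewrite RInt0D; [|exact: bmeas_cst|exact: bmeasZ].
rewrite RInt0_cst// RInt0Z// lerD2r.
rewrite mulrAC ler_wpM2r// ler_wpM2l// !mulr_ge0//.
Qed.

Variable y : R -> 'rV[R]_n.
Hypotheses (yrho : forall t, `|y t| + 1 <= rho) (ytraj : is_traj 0 y).
Variable P : R -> 'rV[R]_n.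
Hypothesis vP : vblip P.
Hypothesis Pode : forall t i, 0 <= t <= T -> P t 0 i = P 0 0 i +
   RInt0 t (fun r => - (vb r * \sum_l DX i (y r) (u r) 0 l * P r 0 l)).

Let yr t : `|y t| <= rho. Proof. by apply: le_trans (yrho t); rewrite lerDl. Qed.

Lemma fc_y t : fc X rho (y t) (u t) = X (y t) (u t).
Proof. by rewrite /fc clipv_id. Qed.

Lemma bmeas_dfield i j : bmeas (fun t => DX i (y t) (u t) 0 j).
Proof.
split; first by apply: (measurable_dfield sf i j uU) => // l; exact: (vblip_bmeas l ytraj.1).1.
have [M M0 hM] := field_bounded sf rho; exists M => t.
apply: le_trans (norm_rV_coord _ _) _; exact: (hM _ _ (yr t) (uU t)).2.
Qed.

(** Differentiate [dotv (z - y) P] by the product rule. As [P] solves the adjoint equation, the part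
    linear in [z - y] cancels, and the only first-order term left is the one carried by the [psi i]
    along the reference. *)
Lemma endpoint_expansion eta : 0 < eta -> exists2 d, 0 < d & forall e z, `|e| <= d -> `|e| <= 1 ->
  is_traj e z ->
  `|dotv (z T - y T) (P T) - \sum_i e 0 i * RInt0 T (fun r => psi i r * dotv (X (y r) (u r)) (P r))|
   <= eta * `|e|.
Proof.
move=> eta0.
have [C C0 hC] := traj_stable; have [L L0 hL] := fc_lipschitz.
have [PM [hPM _]] := vP.
have PM0 : 0 <= PM by exact: le_trans (hPM 0).
pose B := n%:R * PM * T * V * (C + 1) + 1.
have B0 : 0 < B by rewrite ltr_wpDl// !mulr_ge0// addr_ge0.
have [d1 d10 hd1] := field_linearize sf rho (divr_gt0 eta0 (mulr_gt0 (ltr0Sn R 1) B0)).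
(* The first two bounds keep [z] within 1 of [y], where the cut-off is inactive, and within the
   radius [d1] of linearization; the third makes the quadratic remainder at most [eta / 2] times the
   norm of [e]. *)
pose d := Num.min (Num.min (1 / (C + 1)) (d1 / (C + 1))) (eta / (2 * (n%:R * PM * T * V * m%:R * L * C + 1))).
have C1 : 0 < C + 1 by rewrite ltr_wpDl.
have D1 : 0 < n%:R * PM * T * V * m%:R * L * C + 1.
  by rewrite ltr_wpDl// !mulr_ge0// ltW.
exists d; first by rewrite !lt_min !divr_gt0// mulr_gt0.
move=> e z; rewrite !le_min -andbA => /and3P[ed1 ed2 ed3] e1 ez.
have delta t : 0 <= t <= T -> `|z t - y t| <= C * `|e|.
  by move=> tT; have := hC e 0 z y e1 _ ez ytraj t tT; rewrite subr0 normr0; apply.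
have deltaC t : 0 <= t <= T -> `|z t - y t| <= (C + 1) * `|e|.
  by move=> /delta /le_trans; apply; rewrite ler_wpM2r// lerDl.
have delta1 t : 0 <= t <= T -> `|z t - y t| <= 1.
  by move=> /deltaC /le_trans; apply; rewrite mulrC -ler_pdivlMr.
have deltad t : 0 <= t <= T -> `|z t - y t| <= d1.
  by move=> /deltaC /le_trans; apply; rewrite mulrC -ler_pdivlMr.
have zrho t : 0 <= t <= T -> `|z t| <= rho.
  move=> /delta1 h; rewrite -[z t](subrK (y t)) addrC (le_trans (ler_normD _ _))//.
  by apply: le_trans (yrho t); rewrite lerD2l.
have [vz hz] := ez; have [vy hy] := ytraj.
have vd := vblipB vz vy.
have bz j := bmeas_fc j vz; have by' j := bmeas_fc j vy.
have w0 t : weight 0 t = vb t.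
  by rewrite /weight big1 ?addr0// => i _; rewrite mxE mul0r.
pose dd r : 'rV[R]_n := weight e r *: fc X rho (z r) (u r) - vb r *: fc X rho (y r) (u r).
pose dP r : 'rV[R]_n := \row_i - (vb r * \sum_l DX i (y r) (u r) 0 l * P r 0 l).
have bdd j : bmeas (fun r => dd r 0 j).
  rewrite (_ : (fun r => _) = fun r => weight e r * fc X rho (z r) (u r) 0 j - vb r * fc X rho (y r) (u r) 0 j).
    by apply: bmeasB; apply: bmeasM => //; exact: bmeas_weight.
  by apply/funext => r; rewrite !mxE.
have bP j := vblip_bmeas j vP.
have bdP j : bmeas (fun r => dP r 0 j).
  rewrite (_ : (fun r => _) = fun r => - (vb r * \sum_l DX j (y r) (u r) 0 l * P r 0 l)).
    apply: bmeasN; apply: bmeasM => //; apply: bmeas_sum => l.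
    by apply: bmeasM => //; exact: bmeas_dfield.
  by apply/funext => r; rewrite !mxE.
have TT : 0 <= T <= T by rewrite lexx T0.
have T00 : (0 : R) <= 0 <= T by apply/andP; split.
have delta0 : z 0 - y 0 = 0.
  by apply/rowP => j; rewrite !mxE (hz 0 j T00) (hy 0 j T00) !RInt0_at0 subrr.
rewrite (@dot_product_rule _ _ (fun r => z r - y r) P dd dP T vd vP bdd bdP _ _ T TT); first last.
- by move=> t i tT; rewrite Pode//; congr (_ + _); apply: RInt0_eq => r _; rewrite mxE.
- move=> t j tT; rewrite delta0 !mxE add0r (hz t j tT) (hy t j tT) opprD addrACA subrr add0r.
  rewrite -RInt0B; try by apply: bmeasM => //; exact: bmeas_weight.
  by apply: RInt0_eq => r _; rewrite !mxE w0.
rewrite delta0 dotv0l add0r.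
pose E r : 'rV[R]_n := X (z r) (u r) - X (y r) (u r) - \sum_i (z r 0 i - y r 0 i) *: DX i (y r) (u r).
pose F r := (\sum_i e 0 i * psi i r) * dotv (fc X rho (z r) (u r) - fc X rho (y r) (u r)) (P r).
have bX : bmeas (fun r => dotv (X (y r) (u r)) (P r)).
  apply: bmeas_dotv => // j; rewrite (_ : (fun r => _) = fun r => fc X rho (y r) (u r) 0 j)//.
  by apply/funext => r; rewrite fc_y.
have bpX i : bmeas (fun r => psi i r * dotv (X (y r) (u r)) (P r)) by exact: bmeasM.
have bI : bmeas (fun r => dotv (dd r) (P r) + dotv (z r - y r) (dP r)).
  apply: bmeasD; apply: bmeas_dotv => // j.
  rewrite (_ : (fun r => _) = fun r => z r 0 j - y r 0 j).
    by apply: bmeasB; exact: vblip_bmeas.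
  by apply/funext => r; rewrite !mxE.
have -> : \sum_i e 0 i * RInt0 T (fun r => psi i r * dotv (X (y r) (u r)) (P r)) =
   RInt0 T (fun r => \sum_i e 0 i * (psi i r * dotv (X (y r) (u r)) (P r))).
  by rewrite RInt0_sum => [|i]; [apply: eq_bigr => i _; rewrite RInt0Z|exact: bmeasZ].
rewrite -RInt0B//; last by apply: bmeas_sum => i; exact: bmeasZ.
pose K0 := (V * (n%:R * PM * (eta / (2 * B) * (C + 1))) + m%:R * V * `|e| * (n%:R * (L * C) * PM)) * `|e|.
apply: (@le_trans _ _ (K0 * T)); last first.
  rewrite /K0 mulrAC ler_wpM2r// mulrDl [leRHS]splitr lerD//.
    have -> : V * (n%:R * PM * (eta / (2 * B) * (C + 1))) * T =
      (eta / 2) * ((n%:R * PM * T * V * (C + 1)) / B) by field; rewrite gt_eqF.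
    by rewrite ler_piMr ?divr_ge0 ?(ltW eta0)// ler_pdivrMr// mul1r lerDl.
  have -> : m%:R * V * `|e| * (n%:R * (L * C) * PM) * T = n%:R * PM * T * V * m%:R * L * C * `|e| by ring.
  apply: (@le_trans _ _ ((n%:R * PM * T * V * m%:R * L * C + 1) * `|e|)).
    by rewrite ler_wpM2r// lerDl.
  rewrite -ler_pdivlMl//; apply: le_trans ed3 _.
  by rewrite le_eqVlt; apply/orP; left; apply/eqP; field; rewrite gt_eqF.
apply: RInt0_bound0 => //; first by apply: bmeasB => //; apply: bmeas_sum => i; exact: bmeasZ.
move=> r rT.
(* After cancellation against the adjoint equation there remain the linearization error [E] and a
   product of two quantities of order [e]. *)
have -> : dotv (dd r) (P r) + dotv (z r - y r) (dP r) -
    \sum_i e 0 i * (psi i r * dotv (X (y r) (u r)) (P r)) =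
    vb r * dotv (E r) (P r) +
    (\sum_i e 0 i * psi i r) * dotv (X (z r) (u r) - X (y r) (u r)) (P r).
  rewrite /dd /E fc_y (_ : fc X rho (z r) (u r) = X (z r) (u r)); last first.
    by rewrite /fc clipv_id// zrho.
  rewrite !dotvDl !dotvNl !dotvZl.
  have -> : dotv (z r) (dP r) - dotv (y r) (dP r) =
      - vb r * dotv (\sum_i (z r 0 i - y r 0 i) *: DX i (y r) (u r)) (P r).
    rewrite -dotvNl -dotvDl dotvC (dotvC (\sum_i _)) dotv_sumr mulr_sumr.
    apply: eq_bigr => i _; rewrite !mxE dotvZr dotvC /dotv; ring.
  have -> : \sum_i e 0 i * (psi i r * dotv (X (y r) (u r)) (P r)) =
      (\sum_i e 0 i * psi i r) * dotv (X (y r) (u r)) (P r).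
    by rewrite mulr_suml; apply: eq_bigr => i _; rewrite mulrA.
  by rewrite /weight; ring.
have Xzy : `|X (z r) (u r) - X (y r) (u r)| <= L * C * `|e|.
  have := hL (z r) (y r) (u r) (uU r); rewrite fc_y /fc clipv_id ?zrho// => /le_trans; apply.
  by rewrite -mulrA ler_pM2l// delta.
have sumV : `|\sum_i e 0 i * psi i r| <= m%:R * V * `|e|.
  by have := weightB e 0 r; rewrite subr0 w0 /weight addrAC subrr add0r.
rewrite (le_trans (ler_normD _ _))// /K0 mulrDl lerD// normrM.
  rewrite -[leRHS]mulrA ler_pM//; apply: le_trans (dotv_le _ _) _.
  apply: (@le_trans _ _ (n%:R * ((eta / (2 * B) * ((C + 1) * `|e|)) * PM))); last first.
    by rewrite le_eqVlt; apply/orP; left; apply/eqP; ring.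
  rewrite ler_wpM2l// ler_pM//.
  apply: (@le_trans _ _ (eta / (2 * B) * `|z r - y r|)).
    by apply: hd1 => //; [exact: zrho|exact: deltad].
  by rewrite ler_wpM2l ?deltaC// divr_ge0 ?mulr_ge0// ltW.
rewrite -[leRHS]mulrA ler_pM//; apply: le_trans (dotv_le _ _) _.
apply: (@le_trans _ _ (n%:R * ((L * C * `|e|) * PM))); last first.
  by rewrite le_eqVlt; apply/orP; left; apply/eqP; ring.
by rewrite ler_wpM2l// ler_pM.
Qed.

End Endpoint.

(** * Multiplier or perturbation *)

Section PositiveSpan.
Context {R : realType}.

(** The weights serve as speeds, so they must be positive, and they enter Brouwer's theorem, so they
    must be continuous in [x]. The positive and negative parts of the coordinates of [x] multiply
    representations of [evec j] and [- evec j]; a strictly positive representation of 0 is added. *)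
Lemma pos_comb_box D M (k : 'I_M -> 'rV[R]_D) :
  (forall mu, mu != 0 -> exists i, 0 < dotv mu (k i)) ->
  exists (c : 'rV[R]_D -> 'I_M -> R) (Cm : R), [/\ 0 <= Cm, forall x i, 0 < c x i,
    forall x i, `|x| <= 1 -> c x i <= Cm,
    forall x x' i, `|c x i - c x' i| <= Cm * `|x - x'| &
    forall x, \sum_i c x i *: k i = x].
Proof.
move=> hk; have pc := pos_comb hk.
have [c0 c00 c0E] := pc 0.
have /choice[cp hp] (j : 'I_D) : exists c : 'I_M -> R, (forall i, 0 < c i) /\ \sum_i c i *: k i = evec j.
  by have [c] := pc (evec j); exists c.
have /choice[cn hn] (j : 'I_D) : exists c : 'I_M -> R, (forall i, 0 < c i) /\ \sum_i c i *: k i = - evec j.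
  by have [c] := pc (- evec j); exists c.
pose pp (t : R) := Num.max t 0.
have pp0 t : 0 <= pp t by rewrite /pp le_max lexx orbT.
have pp1 t : pp t <= `|t| by rewrite /pp ge_max normr_ge0 ler_norm.
have ppB t : pp t - pp (- t) = t.
  by rewrite /pp; have [h1|h1] := leP t 0; have [h2|h2] := leP (- t) 0; lra.
have ppL s t : `|pp s - pp t| <= `|s - t|.
  have a1 := ler_norm (s - t).
  have a2 := ler_norm (t - s); rewrite distrC in a2.
  have a3 := normr_ge0 (s - t).
  rewrite /pp ler_norml; move: a1 a2 a3; set d := `|s - t| => a1 a2 a3.
  by have [h1|h1] := leP t 0; have [h2|h2] := leP s 0; apply/andP; split; lra.
pose c (x : 'rV[R]_D) (i : 'I_M) : R := c0 i + \sum_j (pp (x 0 j) * cp j i + pp (- x 0 j) * cn j i).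
pose Cm := \sum_i (c0 i + \sum_j (cp j i + cn j i)).
have h0 i : 0 <= \sum_j (cp j i + cn j i).
  by apply: sumr_ge0 => j _; rewrite addr_ge0// ltW// ?(hp j).1 ?(hn j).1.
have CmS i : c0 i + \sum_j (cp j i + cn j i) <= Cm.
  by rewrite /Cm (bigD1 i)//= lerDl sumr_ge0// => l _; rewrite addr_ge0// ltW.
exists c, Cm; split.
- by apply: sumr_ge0 => i _; rewrite addr_ge0// ltW.
- move=> x i; rewrite /c ltr_wpDr//; apply: sumr_ge0 => j _.
  by rewrite addr_ge0// mulr_ge0// ltW// ?(hp j).1 ?(hn j).1.
- move=> x i x1; apply: le_trans (CmS i); rewrite /c lerD2l; apply: ler_sum => j _.
  have xj : `|x 0 j| <= 1 by apply: le_trans (norm_rV_coord _ _) x1.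
  rewrite lerD//; apply: ler_piMl; [exact/ltW/(hp j).1| |exact/ltW/(hn j).1|].
    exact: le_trans (pp1 _) xj.
  by apply: le_trans (pp1 _) _; rewrite normrN.
- move=> x x' i; apply: le_trans (ler_wpM2r (normr_ge0 _) (_ : \sum_j (cp j i + cn j i) <= Cm)); last first.
    by apply: le_trans (CmS i); rewrite lerDr ltW.
  rewrite /c opprD addrACA subrr add0r -sumrB (le_trans (ler_norm_sum _ _ _))// mulr_suml.
  apply: ler_sum => j _.
  have xj : `|x 0 j - x' 0 j| <= `|x - x'| by have := norm_rV_coord (x - x') j; rewrite !mxE.
  have -> : pp (x 0 j) * cp j i + pp (- x 0 j) * cn j i - (pp (x' 0 j) * cp j i + pp (- x' 0 j) * cn j i)
    = (pp (x 0 j) - pp (x' 0 j)) * cp j i + (pp (- x 0 j) - pp (- x' 0 j)) * cn j i by ring.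
  rewrite (le_trans (ler_normD _ _))// [leRHS]mulrDl !normrM.
    rewrite (gtr0_norm ((hp j).1 i)) (gtr0_norm ((hn j).1 i)).
  rewrite ![_ * `|x - x'|]mulrC lerD//; apply: ler_wpM2r; try exact/ltW/(hp j).1; try exact/ltW/(hn j).1.
    exact: le_trans (ppL _ _) xj.
  by apply: le_trans (ppL _ _) _; rewrite opprK addrC distrC.
- move=> x; rewrite /c; under eq_bigr do rewrite scalerDl scaler_suml.
  rewrite big_split /= c0E add0r exchange_big /=.
  rewrite [RHS](row_sum_delta x); apply: eq_bigr => j _.
  under eq_bigr do rewrite scalerDl -!scalerA.
  rewrite big_split /= -!scaler_sumr (hp j).2 (hn j).2 scalerN -scalerBl ppB.
  by [].
Qed.

(** The finite family is sorted by kind and [g] is adjoined at index 0. An additional vector does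
    not hurt spanning, and in every positive combination [g] then has a strictly positive weight. *)
Lemma cone_alternative2 D (G1 G2 : set 'rV[R]_D) g : G2 g ->
  (exists2 mu, mu != 0 & forall k, G1 k \/ G2 k -> dotv mu k <= 0) \/
  exists (p q : nat) (k1 : 'I_p -> 'rV[R]_D) (k2 : 'I_q.+1 -> 'rV[R]_D),
    [/\ forall i, G1 (k1 i), forall j, G2 (k2 j), k2 ord0 = g &
    forall mu, mu != 0 -> (exists i, 0 < dotv mu (k1 i)) \/ (exists j, 0 < dotv mu (k2 j))].
Proof.
move=> Gg; have [h|[s sG hs]] := cone_alternative [set k | G1 k \/ G2 k]; [by left|right].
pose s1 := [seq k <- s | `[< G1 k >]]; pose s2 := g :: [seq k <- s | ~~ `[< G1 k >]].
exists (size s1), (size [seq k <- s | ~~ `[< G1 k >]]),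
  (fun i => nth 0 s1 i), (fun j => nth 0 s2 j); split => //.
- by move=> i; have := mem_nth 0 (ltn_ord i); rewrite mem_filter => /andP[/asboolP].
- move=> j; have : nth 0 s2 j \in s2 by apply: mem_nth.
  rewrite inE => /predU1P[->//|]; rewrite mem_filter => /andP[/asboolPn n1 /sG[]//].
- move=> mu /hs[k ks mk]; have [k1|k1] := boolP `[< G1 k >].
    have k1s : k \in s1 by rewrite mem_filter k1.
    by left; exists (Ordinal (ltac:(by rewrite index_mem) : (index k s1 < size s1)%N)); rewrite /= nth_index.
  have k2s : k \in s2 by rewrite inE mem_filter k1 ks orbT.
  right; exists (Ordinal (ltac:(by rewrite -index_mem in k2s) : (index k s2 < size s2)%N)).
  by rewrite /= -/s2 nth_index.
Qed.

End PositiveSpan.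

Section Auxiliary.
Context {R : realType}.

Lemma vblip_lincomb n (I : Type) (s : seq I) (c : I -> R) (q : I -> R -> 'rV[R]_n) :
  (forall l, vblip (q l)) -> vblip (fun t => \sum_(l <- s) c l *: q l t).
Proof.
move=> vq; elim: s => [|l s [C [C1 C2]]].
  by exists 0; split => [t|r t]; rewrite !big_nil ?subrr normr0 ?mul0r.
have [E [E1 E2]] := vq l.
exists (`|c l| * E + C); split => [t|r t]; rewrite !big_cons.
  by rewrite (le_trans (ler_normD _ _))// lerD// normrZ ler_wpM2l.
rewrite opprD addrACA -scalerBr (le_trans (ler_normD _ _))// mulrDl lerD// normrZ -mulrA.
by rewrite ler_wpM2l.
Qed.

Lemma vblip_comp n (z : R -> 'rV[R]_n) (s : R -> R) : vblip z ->
  (forall r t, `|s t - s r| <= `|t - r|) -> vblip (fun t => z (s t)).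
Proof.
move=> [C [C1 C2]] hs; have C0 : 0 <= C by exact: le_trans (C1 0).
by exists C; split => // r t; apply: le_trans (C2 _ _) _; rewrite ler_wpM2l.
Qed.

Lemma dotv_mulmx n D (mu : 'rV[R]_D) (w : 'rV[R]_n) (B : 'M[R]_(n, D)) :
  dotv mu (w *m B) = dotv (mu *m B^T) w.
Proof.
rewrite /dotv; under eq_bigr do rewrite mxE mulr_sumr.
rewrite exchange_big; apply: eq_bigr => i _ /=; rewrite mxE mulr_suml.
by apply: eq_bigr => j _; rewrite mxE; ring.
Qed.

Lemma mulmx_norm n D (B : 'M[R]_(n, D)) : exists2 N, 0 <= N &
  forall w : 'rV[R]_n, `|w *m B| <= N * `|w|.
Proof.
have S0 : 0 <= \sum_i \sum_j `|B i j| by apply: sumr_ge0 => i _; exact: sumr_ge0.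
exists (\sum_i \sum_j `|B i j|) => // w; apply: norm_rV_le => [|j]; first exact: mulr_ge0.
rewrite mxE (le_trans (ler_norm_sum _ _ _))// mulr_suml; apply: ler_sum => i _.
rewrite normrM mulrC ler_pM ?norm_rV_coord//.
by rewrite (bigD1 j)//= lerDl sumr_ge0.
Qed.

Lemma lincomb_bound n p (c : 'I_p -> R) (v : 'I_p -> 'rV[R]_n) b :
  (forall i, `|c i| <= b) -> `|\sum_i c i *: v i| <= b * \sum_i `|v i|.
Proof.
move=> h; rewrite (le_trans (ler_norm_sum _ _ _))// mulr_sumr; apply: ler_sum => i _.
by rewrite normrZ ler_wpM2r.
Qed.

End Auxiliary.

(** * The alternative for an abstract control system, end map and target chart *)

Section Alternative.
Context {R : realType}.
Variables (n K D M : nat) (U : set 'rV[R]_K) (X : 'rV[R]_n -> 'rV[R]_K -> 'rV[R]_n)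
  (DX : 'I_n -> 'rV[R]_n -> 'rV[R]_K -> 'rV[R]_n).
Hypothesis sf : smooth_field U X DX.
Variables (S rho : R) (ub : R -> 'rV[R]_K) (zb : R -> 'rV[R]_n).
Hypotheses (S0 : 0 < S).
Hypotheses (ubU : forall t, U (ub t)) (ubm : forall j, measurable_fun setT (fun t => ub t 0 j)).
Hypotheses (vzb : vblip zb) (zbrho : forall t, `|zb t| + 1 <= rho).
Hypothesis zbode : forall t j, 0 <= t <= S ->
  zb t 0 j = zb 0 0 j + RInt0 t (fun r => X (zb r) (ub r) 0 j).
Variables (Theta : 'rV[R]_n -> 'rV[R]_D) (B : 'M[R]_(n, D)).
Hypothesis Theta_cont : cont_on setT Theta.
Hypothesis Theta_diff : forall e, 0 < e -> exists2 d, 0 < d & forall z,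
  `|z - zb S| < d -> `|Theta z - Theta (zb S) - (z - zb S) *m B| <= e * `|z - zb S|.
Variables (C V : set 'rV[R]_M) (F L : 'rV[R]_M -> 'rV[R]_D) (vs : 'rV[R]_M).
Hypotheses (CD : forall x y, C x -> C y -> C (x + y))
  (CZ : forall a x, 0 < a -> C x -> C (a *: x)) (C0 : C 0) (Cvs : C vs).
Hypothesis Vn : exists2 d : R, 0 < d & forall v, `|v| < d -> V v.
Hypothesis Fcont : cont_on (V `&` C) F.
Hypothesis F0 : F 0 = Theta (zb S).
Hypothesis FL : forall e, 0 < e -> exists2 d, 0 < d & forall v, V v -> C v -> `|v| < d ->
  `|F v - F 0 - L v| <= e * `|v|.
Hypothesis Llin : forall a u v, L (a *: u + v) = a *: L u + L v.

Let L0 : L 0 = 0.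
Proof. by have := Llin (-1) 0 0; rewrite !scaler0 addr0 scaleN1r addNr. Qed.

Let L_sum (I : Type) (s : seq I) (c : I -> R) (v : I -> 'rV[R]_M) :
  L (\sum_(i <- s) c i *: v i) = \sum_(i <- s) c i *: L (v i).
Proof. by elim: s => [|i s IH]; rewrite ?big_nil// !big_cons Llin IH. Qed.

Let LZ a v : L (a *: v) = a *: L v.
Proof. by have := Llin a v 0; rewrite L0 !addr0. Qed.

Let C_sum (I : Type) (s : seq I) (P : pred I) (c : I -> R) (v : I -> 'rV[R]_M) :
  (forall i, 0 < c i) -> (forall i, C (v i)) -> C (\sum_(i <- s | P i) c i *: v i).
Proof.
move=> c0 vC; elim/big_rec : _ => // i x _ Cx; apply: CD => //; exact: CZ.
Qed.

Let zbr t : `|zb t| <= rho. Proof. by apply: le_trans (zbrho t); rewrite lerDl. Qed.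

Let rho0 : 0 <= rho. Proof. exact: le_trans (zbr 0). Qed.

(** [mu] acts on the end space; the derivative [B] of the end map pulls it back to the terminal
    value of [P]. The three inequalities come from insertions, from slowing down, and from the
    directions of the target. *)
Definition multiplier (P : R -> 'rV[R]_n) (mu : 'rV[R]_D) :=
  [/\ mu != 0, vblip P & P S = mu *m B^T] /\
  [/\ forall t i, 0 <= t <= S -> P t 0 i = P 0 0 i +
        RInt0 t (fun r => - \sum_l DX i (zb r) (ub r) 0 l * P r 0 l),
      forall t w, 0 <= t <= S -> U w -> dotv (X (zb t) w) (P t) <= 0,
      0 <= RInt0 S (fun r => dotv (X (zb r) (ub r)) (P r)) &
      forall v, C v -> 0 <= dotv mu (L v)].

(** The decomposition of [v] demands a strictly positive share of the distinguished direction [vs];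
    when [vs] is the cost slack, this is what makes the competitor strictly cheaper. [clip S t]
    serves to compare trajectories on intervals of different lengths. *)
Definition perturbed (delta : R) (T : R) (u : R -> 'rV[R]_K) (w : R -> R) (z : R -> 'rV[R]_n)
    (v v' : 'rV[R]_M) (kappa : R) :=
  [/\ S <= T, T - S <= delta, forall t, U (u t) & forall j, measurable_fun setT (fun t => u t 0 j)] /\
  [/\ bmeas w, exists2 c, 0 < c & forall t, c <= w t, vblip z &
    forall t j, 0 <= t <= T -> z t 0 j = zb 0 0 j + RInt0 t (fun r => w r * X (z r) (u r) 0 j)] /\
  (forall t, 0 <= t <= T -> `|z t - zb (clip S t)| <= delta) /\
  [/\ V v, C v & Theta (z T) = F v] /\
  [/\ v = kappa *: vs + v', 0 < kappa & C v'].

Let DXm i j : bmeas (fun t => DX i (zb t) (ub t) 0 j).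
Proof.
split; first by apply: (measurable_dfield sf i j ubU) => // l; exact: (vblip_bmeas l vzb).1.
have [N N0 hN] := field_bounded sf rho; exists N => t.
apply: le_trans (norm_rV_coord _ _) _; exact: (hN _ _ (zbr t) (ubU t)).2.
Qed.

Let Xm j : bmeas (fun t => X (zb t) (ub t) 0 j).
Proof.
split; first by apply: (measurable_field sf j ubU) => // l; exact: (vblip_bmeas l vzb).1.
have [N N0 hN] := field_bounded sf rho; exists N => t.
apply: le_trans (norm_rV_coord _ _) _; exact: (hN _ _ (zbr t) (ubU t)).1.
Qed.

Section Basis.
Variable Pb : 'I_n -> R -> 'rV[R]_n.
Hypotheses (vPb : forall j, vblip (Pb j)) (PbS : forall j, Pb j S = evec j).
Hypothesis Pb_ode : forall j t i, 0 <= t <= S -> Pb j t 0 i = Pb j 0 0 i +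
  RInt0 t (fun r => - \sum_l DX i (zb r) (ub r) 0 l * Pb j r 0 l).

(** Because [Pb j S = evec j], pairing with [Pb j] yields coordinate [j] of the first variation of
    the end point: [raw] for an insertion, [rs] for slowing down, whence its minus sign. *)
Let raw t w : 'rV[R]_n := \row_j dotv (X (zb t) w) (Pb j t).
Let rs : 'rV[R]_n := \row_j - RInt0 S (fun r => dotv (X (zb r) (ub r)) (Pb j r)).

(* [G1]: insertion of the control w at time t.  [G2]: slowing down, and opposites of target directions. *)
Let G1 k := exists t w, [/\ 0 <= t <= S, U w & k = raw t w *m B].
Let G2 k := k = rs *m B \/ exists2 v, C v & k = - L v.

Let bXP j : bmeas (fun r => dotv (X (zb r) (ub r)) (Pb j r)).
Proof. by apply: bmeas_dotv => // i; exact: vblip_bmeas. Qed.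

(** The combination of the [Pb j] with coefficients [nu] solves the adjoint equation with terminal
    value [nu], by linearity; the inequalities are [hmu] evaluated on the generators. *)
Lemma multiplier_of_polar mu : mu != 0 -> (forall k, G1 k \/ G2 k -> dotv mu k <= 0) ->
  exists P, multiplier P mu.
Proof.
move=> mu0 hmu; have [nu nuE] : exists nu, nu = mu *m B^T by exists (mu *m B^T).
pose P t := \sum_j nu 0 j *: Pb j t.
have dP (x : 'rV[R]_n) t : dotv x (P t) = \sum_j nu 0 j * dotv x (Pb j t).
  by rewrite dotv_sumr; apply: eq_bigr => j _; rewrite dotvZr.
exists P; split; split => //.
- exact: vblip_lincomb.
- rewrite /P; under eq_bigr do rewrite PbS.
  by rewrite -nuE -(row_sum_delta nu).
- move=> t i tS; rewrite /P !summxE.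
  transitivity (\sum_j (nu 0 j * Pb j 0 0 i +
     RInt0 t (fun r => nu 0 j * (- \sum_l DX i (zb r) (ub r) 0 l * Pb j r 0 l)))).
    apply: eq_bigr => j _; rewrite [LHS]mxE (Pb_ode j i tS) [LHS]mulrDr; congr (_ + _).
    rewrite RInt0Z//; apply: bmeasN; apply: bmeas_sum => l; apply: bmeasM => //; exact: vblip_bmeas.
  rewrite big_split /=; congr (_ + _); first by apply: eq_bigr => j _; rewrite [RHS]mxE.
  rewrite -RInt0_sum; last first.
    move=> j; apply: bmeasZ; apply: bmeasN; apply: bmeas_sum => l.
    by apply: bmeasM => //; exact: vblip_bmeas.
  apply: RInt0_eq => r _.
  transitivity (\sum_j - \sum_l nu 0 j * (DX i (zb r) (ub r) 0 l * Pb j r 0 l)).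
    by apply: eq_bigr => j _; rewrite mulrN mulr_sumr.
  rewrite sumrN exchange_big; congr (- _); apply: eq_bigr => l _ /=.
  by rewrite /P summxE mulr_sumr; apply: eq_bigr => j _; rewrite [in RHS]mxE; ring.
- move=> t w tS Uw.
  have := hmu (raw t w *m B) (or_introl (ex_intro _ t (ex_intro _ w (And3 tS Uw erefl)))).
  rewrite dotv_mulmx -nuE; congr (_ <= _).
  by rewrite dP; apply: eq_bigr => j _; rewrite mxE.
- have := hmu (rs *m B) (or_intror (or_introl erefl)).
  rewrite dotv_mulmx -nuE -oppr_ge0; congr (_ <= _).
  rewrite -sumrN (@RInt0_eq _ _ (fun r => \sum_j nu 0 j * dotv (X (zb r) (ub r)) (Pb j r))) => [|r _].
    rewrite RInt0_sum => [|j]; last exact: bmeasZ.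
    by apply: eq_bigr => j _; rewrite mxE mulrN opprK RInt0Z.
  exact: dP.
- move=> v Cv; have := hmu (- L v) (or_intror (or_intror (ex_intro2 _ _ v Cv erefl))).
  by rewrite dotvNr oppr_le0.
Qed.

(** To a displacement [x] in the unit box correspond strengths [E x] and a target vector [Q x] whose
    joint first-order effect is [x]. With everything scaled by a small [ep], the mismatch between
    end point and target chart, divided by [ep], stays within 1 of [x], so it vanishes for some
    [x]. *)
Lemma perturbation_of_span (p q : nat) (k1 : 'I_p -> 'rV[R]_D) (k2 : 'I_q.+1 -> 'rV[R]_D) :
  (forall i, G1 (k1 i)) -> (forall j, G2 (k2 j)) -> k2 ord0 = - L vs ->
  (forall mu, mu != 0 -> (exists i, 0 < dotv mu (k1 i)) \/ (exists j, 0 < dotv mu (k2 j))) ->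
  forall delta, 0 < delta -> exists T u w z v v' kappa, perturbed delta T u w z v v' kappa.
Proof.
move=> hk1 hk2 k20 hk delta delta0.
have /choice[tw htw] (i : 'I_p) : exists tw : R * 'rV[R]_K,
    [/\ 0 <= tw.1 <= S, U tw.2 & k1 i = raw tw.1 tw.2 *m B].
  by have [t [w h]] := hk1 i; exists (t, w).
(* Both kinds of generators in [G2] take the form [a *: (rs *m B) - L v], with [a] or [v] zero, so
   that their weights add up to one slowing-down rate and one vector of [C]. *)
have /choice[av hav] (j : 'I_q.+1) : exists av : R * 'rV[R]_M,
    [/\ 0 <= av.1, C av.2, k2 j = av.1 *: (rs *m B) - L av.2 & j = ord0 -> av.2 = vs].
  have [->|j0] := eqVneq j ord0.
    by exists (0, vs); split => //; rewrite /= scale0r sub0r.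
  have [h|[v Cv h]] := hk2 j.
    exists (1, 0); split => //=; first by rewrite scale1r L0 subr0.
    by move/eqP: j0.
  by exists (0, v); split => //=; [rewrite scale0r sub0r|move/eqP: j0].
pose kk (l : 'I_(p + q.+1)) := match fintype.split l with inl i => k1 i | inr j => k2 j end.
have kkl i : kk (lshift q.+1 i) = k1 i by rewrite /kk (unsplitK (inl i)).
have kkr j : kk (rshift p j) = k2 j by rewrite /kk (unsplitK (inr j)).
have [|c [Cm [Cm0 c0 cCm cL cE]]] := @pos_comb_box R D _ kk.
  move=> mu /hk[[i hi]|[j hj]]; first by exists (lshift q.+1 i); rewrite kkl.
  by exists (rshift p j); rewrite kkr.
(* Entry 0 is the slowing-down rate, entry [i + 1] the strength of the [i]-th insertion. *)
pose E x : 'rV[R]_p.+1 := \row_i if unlift ord0 i is Some i' then c x (lshift q.+1 i')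
   else \sum_j c x (rshift p j) * (av j).1.
pose Q x : 'rV[R]_M := \sum_j c x (rshift p j) *: (av j).2.
pose A := \sum_j (av j).1.
have A0 : 0 <= A by apply: sumr_ge0 => j _; case: (hav j).
have E0 x : E x 0 ord0 = \sum_j c x (rshift p j) * (av j).1 by rewrite mxE unlift_none.
have El x i : E x 0 (lift ord0 i) = c x (lshift q.+1 i) by rewrite mxE liftK.
pose Bd := Cm * (1 + A) + Cm * \sum_j `|(av j).2| + 1.
have Sv0 : 0 <= \sum_j `|(av j).2| by apply: sumr_ge0.
have Bd0 : 0 < Bd by rewrite ltr_wpDl// addr_ge0// mulr_ge0// addr_ge0.
have BdE : Cm * (1 + A) <= Bd by rewrite /Bd -addrA lerDl addr_ge0// mulr_ge0.
have BdQ : Cm * \sum_j `|(av j).2| <= Bd.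
  by rewrite /Bd -addrA addrCA lerDl addr_ge0// mulr_ge0// addr_ge0.
have cabs x l : `|x| <= 1 -> `|c x l| <= Cm by move=> x1; rewrite ger0_norm ?cCm// ltW.
have Ebd x : `|x| <= 1 -> `|E x| <= Bd.
  move=> x1; apply: le_trans BdE; apply: norm_rV_le => [|l]; first by rewrite mulr_ge0// addr_ge0.
  case: (unliftP ord0 l) => [i ->|->].
    by rewrite El (le_trans (cabs _ _ x1))// ler_peMr// lerDl.
  rewrite E0 (le_trans (ler_norm_sum _ _ _))// mulrDr mulr1 ler_wpDl// /A mulr_sumr.
  apply: ler_sum => j _; have [a0 _ _ _] := hav j.
  by rewrite normrM (ger0_norm a0) ler_wpM2r// cabs.
have Qbd x : `|x| <= 1 -> `|Q x| <= Bd.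
  by move=> x1; apply: le_trans BdQ; apply: lincomb_bound => j; exact: cabs.
have Elip x x' : `|E x - E x'| <= Bd * `|x - x'|.
  apply: le_trans (ler_wpM2r (normr_ge0 _) BdE).
  apply: norm_rV_le => [|l]; first by rewrite !mulr_ge0// addr_ge0.
  rewrite [X in `|X|]mxE [X in _ + X]mxE; case: (unliftP ord0 l) => [i ->|->].
    rewrite !El (le_trans (cL _ _ _))// ler_wpM2r// ler_peMr// lerDl//.
  rewrite !E0 -sumrB (le_trans (ler_norm_sum _ _ _))// mulrDr mulr1 mulrDl ler_wpDl ?mulr_ge0//.
  rewrite /A mulr_sumr mulr_suml; apply: ler_sum => j _; have [a0 _ _ _] := hav j.
  by rewrite -mulrBl normrM (ger0_norm a0) mulrAC ler_wpM2r.
have Qlip x x' : `|Q x - Q x'| <= Bd * `|x - x'|.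
  apply: le_trans (ler_wpM2r (normr_ge0 _) BdQ).
  rewrite /Q -sumrB; under eq_bigr do rewrite -scalerBl.
  by rewrite mulrAC; apply: lincomb_bound => j; exact: cL.
have [Cz [hCz hCzl]] := vzb.
have Cz0 : 0 <= Cz by exact: le_trans (hCz 0).
(* The first bound controls [T - S]; the second limits the displacement of [zb] under the time shift
   to [Cz * dh <= delta / 2], the other half being left to the variation of the trajectory. *)
pose dh := Num.min delta (delta / (2 * (Cz + 1))).
have Cz1 : 0 < 2 * (Cz + 1) by rewrite mulr_gt0// ltr_wpDl.
have dh0 : 0 < dh by rewrite lt_min delta0 divr_gt0.
pose h := dh / (p%:R + 1).
have p1 : 0 < p%:R + 1 :> R by rewrite ltr_wpDl.
have h0 : 0 < h by rewrite divr_gt0.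
have ph : p%:R * h <= dh.
  by rewrite /h mulrCA ler_piMr ?(ltW dh0)// ler_pdivrMr// mul1r lerDl.
pose ti (i : nat) := if insub i is Some i' then (tw i').1 else 0.
pose ui (i : nat) := if insub i is Some i' then (tw i').2 else ub 0.
have tiE (i : 'I_p) : ti i = (tw i).1 by rewrite /ti valK.
have uiE (i : 'I_p) : ui i = (tw i).2 by rewrite /ui valK.
have tiS i : 0 <= ti i <= S.
  by rewrite /ti; case: insub => [i'|]; [case: (htw i')|rewrite lexx ltW].
have uiU i : U (ui i) by rewrite /ui; case: insub => [i'|//]; case: (htw i').
have [s [vb [u [phi I]]]] := @insertions R K U S h ub ti ui (ltW h0) ubU ubm tiS uiU p.
set T := S + p%:R * h.
have ST : S <= T by rewrite lerDl mulr_ge0// ltW.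
have T0 : 0 <= T by rewrite (le_trans (ltW S0)).
have TT : 0 <= T <= T by rewrite lexx T0.
have sT : s T = S by exact: inserted_S I.
have s0 : s 0 = 0 by exact: inserted_0 I.
have ssS t : 0 <= t <= T -> 0 <= s t <= S by move=> tT; exact: (inserted_itv I tT).
have slip := inserted_lip I.
(* The factor [h^-1] gives each insertion total mass 1, so that its first variation does not depend
   on [h]. Entry 0 lowers the speed wherever the reference runs. *)
pose psi (i : 'I_p.+1) : R -> R := if unlift ord0 i is Some i' then (fun t => h^-1 * phi i' t)
   else (fun t => - vb t).
have psi0 t : psi ord0 t = - vb t by rewrite /psi unlift_none.
have psil i t : psi (lift ord0 i) t = h^-1 * phi i t by rewrite /psi liftK.
have hi0 : 0 < h^-1 by rewrite invr_gt0.
pose VV := 1 + h^-1.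
have VV0 : 0 <= VV by rewrite addr_ge0// ltW.
have vb1 t : `|vb t| <= 1.
  by have [[-> _ _]|[-> _]] := inserted_val I t; rewrite ?normr1 ?normr0.
have phi1 i t : `|phi i t| <= 1.
  have [[_ _ ->]|[_ [i' [_ -> _ _]]]] := inserted_val I t; first by rewrite normr0.
  by case: (_ == _); rewrite ?normr1 ?normr0.
have bvb := inserted_vb I.
have bpsi i : bmeas (psi i).
  case: (unliftP ord0 i) => [i' ->|->]; rewrite /psi ?liftK ?unlift_none; last exact: bmeasN.
  by apply: bmeasZ; exact: inserted_phi I _.
have vbV t : `|vb t| <= VV by rewrite (le_trans (vb1 t))// lerDl ltW.
have psiV i t : `|psi i t| <= VV.
  case: (unliftP ord0 i) => [i' ->|->]; rewrite ?psil ?psi0 ?normrN//.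
  by rewrite normrM gtr0_norm// (le_trans (ler_piMr (ltW hi0) (phi1 i' t)))// lerDr.
have uU := inserted_U I; have um := inserted_um I.
pose y t := zb (s t).
have vy : vblip y by exact: vblip_comp.
have yrho t : `|y t| + 1 <= rho by exact: zbrho.
have w0 t : weight vb psi 0 t = vb t.
  by rewrite /weight big1 ?addr0// => i _; rewrite mxE mul0r.
have vbu t (f : 'rV[R]_K -> R) : vb t * f (u t) = vb t * f (ub (s t)).
  by have [[_ -> _]|[-> _]] := inserted_val I t; rewrite ?mul0r.
have ytraj : is_traj X T rho vb psi u (zb 0) 0 y.
  split => // t j tT; rewrite /y zbode ?ssS//; congr (_ + _).
  rewrite -(inserted_cv I (Xm j) tT); apply: RInt0_eq => r _.
  by rewrite w0 /fc clipv_id// (vbu r (fun w => X (zb (s r)) w 0 j)).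
pose Pe j t := Pb j (s t).
have vPe j : vblip (Pe j) by exact: vblip_comp.
have Pe_ode j t i : 0 <= t <= T -> Pe j t 0 i = Pe j 0 0 i +
   RInt0 t (fun r => - (vb r * \sum_l DX i (y r) (u r) 0 l * Pe j r 0 l)).
  move=> tT; rewrite /Pe Pb_ode ?ssS// s0; congr (_ + _).
  rewrite -(inserted_cv I _ tT); last first.
    apply: bmeasN; apply: bmeas_sum => l; apply: bmeasM => //; exact: vblip_bmeas.
  apply: RInt0_eq => r _; rewrite mulrN; congr (- _).
  by rewrite (vbu r (fun w => \sum_l DX i (zb (s r)) w 0 l * Pb j (s r) 0 l)).
pose rawi (i : 'I_p.+1) : 'rV[R]_n := if unlift ord0 i is Some i' then raw (tw i').1 (tw i').2 else rs.
(* On an inserted interval the state and the adjoint vector are frozen, so the integrand is constant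
   there; for the slowing-down entry the time change brings the integral back to [[0, S]]. *)
have rawiE i j : RInt0 T (fun r => psi i r * dotv (X (y r) (u r)) (Pe j r)) = rawi i 0 j.
  case: (unliftP ord0 i) => [i' ->|->]; rewrite /rawi ?liftK ?unlift_none mxE.
    rewrite (@RInt0_eq _ _ (fun r => (h^-1 * dotv (X (zb (tw i').1) (tw i').2) (Pb j (tw i').1)) * phi i' r)).
      rewrite RInt0Z; last exact: inserted_phi I _.
      by rewrite (inserted_int I (ltn_ord i')) mulrAC mulVf ?mul1r// gt_eqF.
    move=> r _; rewrite psil.
    have [[_ _ ->]|[_ [m [_ -> -> sr]]]] := inserted_val I r; first by rewrite !mulr0 mul0r.
    case: eqP => [im|_]; last by rewrite !mulr0 mul0r.
    by rewrite /y /Pe sr -im mulrAC uiE tiE mulr1.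
  rewrite -[in RHS]sT -(inserted_cv I (bXP j) TT) -mulN1r -RInt0Z; last first.
    by apply: bmeasM => //; apply: (bmeas_comp (bXP j)); exact: lip_measurable.
  apply: RInt0_eq => r _; rewrite psi0 mulN1r mulNr; congr (- _).
  exact: (vbu r (fun w => dotv (X (zb (s r)) w) (Pb j (s r)))).
have /choice[Z hZ] e : exists z, `|e| <= 1 -> is_traj X T rho vb psi u (zb 0) e z.
  have [e1|e1] := leP `|e| 1; last by exists (fun=> 0).
  by have [z hz] := @traj_exists R n K p.+1 U X DX sf T rho VV vb psi u (zb 0) T0 rho0 VV0 bvb bpsi
     vbV psiV uU um e e1; exists z.
have [Ct Ct0 hCt] := @traj_stable R n K p.+1 U X DX sf T rho VV vb psi u (zb 0) T0 rho0 VV0 bvb bpsi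
     vbV psiV uU um.
have expan eta : 0 < eta -> exists2 d, 0 < d & forall e z, `|e| <= d -> `|e| <= 1 ->
    is_traj X T rho vb psi u (zb 0) e z -> `|z T - y T - \sum_i e 0 i *: rawi i| <= eta * `|e|.
  move=> eta0.
  have /choice[d hd] (j : 'I_n) : exists d, 0 < d /\ forall e z, `|e| <= d -> `|e| <= 1 ->
    is_traj X T rho vb psi u (zb 0) e z ->
    `|z T 0 j - y T 0 j - \sum_i e 0 i * rawi i 0 j| <= eta * `|e|.
    have [d d0 hd] := @endpoint_expansion R n K p.+1 U X DX sf T rho VV vb psi u (zb 0) T0 rho0 VV0
       bvb bpsi vbV psiV uU um y yrho ytraj (Pe j) (vPe j) (Pe_ode j) eta eta0.
    exists d; split => // e z ed e1 ez; have := hd e z ed e1 ez.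
    rewrite /Pe sT PbS dotv_evec [X in `|X - _|]mxE [X in _ + X - _]mxE.
    by under eq_bigr do rewrite rawiE.
  have ds0 : 0 < \big[Order.min/1]_j d j.
    elim/big_rec : _ => // j x _ x0; rewrite lt_min x0 andbT; exact: (hd j).1.
  exists (\big[Order.min/1]_j d j) => // e z ed e1 ez; apply: norm_rV_le => [|j].
    by rewrite mulr_ge0// ltW.
  have -> : (z T - y T - \sum_i e 0 i *: rawi i) 0 j = z T 0 j - y T 0 j - \sum_i e 0 i * rawi i 0 j.
    by rewrite !mxE summxE; congr (_ - _); apply: eq_bigr => i _; rewrite mxE.
  apply: (hd j).2 => //; apply: le_trans ed _.
  by rewrite (bigD1 j)//= ge_min lexx.
have [Bn Bn0 hB] := mulmx_norm B.
have yT : y T = zb S by rewrite /y sT.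
have Ct1 : 0 < Ct + 1 by rewrite ltr_wpDl.
(* The error budget is split in three: nonlinearity of [Theta], remainder of the trajectory,
   remainder of the chart [F]. *)
have eta3 (N : R) : 0 <= N -> 0 < 1 / (3 * (N + 1)) /\ 1 / (3 * (N + 1)) * N <= 1 / 3.
  move=> N0; have N1 : 0 < 3 * (N + 1) by rewrite mulr_gt0// ltr_wpDl.
  split; first by rewrite divr_gt0.
  by rewrite -mulrA mul1r mulrC ler_pdivrMr//; lra.
have [etaT0 etaT] := eta3 (Ct * Bd) (ltac:(by rewrite mulr_ge0// ltW)).
have [etaE0 etaE] := eta3 (Bn * Bd) (ltac:(by rewrite mulr_ge0// ltW)).
have [etaF0 etaF] := eta3 Bd (ltW Bd0).
have [dT dT0 hdT] := Theta_diff etaT0.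
have [dE dE0 hdE] := expan _ etaE0.
have [dF dF0 hdF] := FL etaF0.
have [dV dV0 hdV] := Vn.
pose dm := Num.min (Num.min (Num.min (1 / 2) (Num.min dE dV)) (Num.min dF (dT / (Ct + 1))))
  (Num.min (1 / (Ct + 1)) (delta / (2 * (Ct + 1)))).
have dm0 : 0 < dm by rewrite !lt_min !divr_gt0//= ?mulr_gt0// dE0 dV0 dF0.
(* Hence [ep * Bd = dm / 2]: both [ep *: E x] and [ep *: Q x] stay strictly below the smallest
   admissible radius on the unit box. *)
pose ep := dm / (2 * Bd).
have ep0 : 0 < ep by rewrite divr_gt0// mulr_gt0.
have epB : ep * Bd < dm by rewrite /ep invfM mulrA mulfVK ?gt_eqF//; lra.
have : ep * Bd < dm by [].
rewrite !lt_min -!andbA => /and5P[eh eE eV eF /and3P[eT e1' eD]].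
have small (k : R) : ep * Bd < k / (Ct + 1) -> Ct * (ep * Bd) < k.
  rewrite ltr_pdivlMr// => h1; apply: le_lt_trans h1.
  by rewrite mulrC ler_wpM2l ?lerDl// mulr_ge0// ltW.
have zeE x : `|x| <= 1 -> `|ep *: E x| <= ep * Bd.
  by move=> x1; rewrite normrZ gtr0_norm// ler_pM2l// Ebd.
have zeQ x : `|x| <= 1 -> `|ep *: Q x| <= ep * Bd.
  by move=> x1; rewrite normrZ gtr0_norm// ler_pM2l// Qbd.
have e11 x : `|x| <= 1 -> `|ep *: E x| <= 1.
  by move=> x1; apply: le_trans (zeE x x1) _; lra.
have trajx x : `|x| <= 1 -> is_traj X T rho vb psi u (zb 0) (ep *: E x) (Z (ep *: E x)).
  by move=> x1; apply: hZ; exact: e11.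
have nearx x : `|x| <= 1 -> forall t, 0 <= t <= T -> `|Z (ep *: E x) t - y t| <= Ct * (ep * Bd).
  move=> x1 t tT; have := hCt (ep *: E x) 0 _ y (e11 x x1) (ltac:(by rewrite normr0)) (trajx x x1) ytraj t tT.
  by rewrite subr0 => /le_trans; apply; rewrite ler_wpM2l// zeE.
have QC x : C (Q x) by apply: C_sum => // j; case: (hav j).
have QV x : `|x| <= 1 -> V (ep *: Q x).
  by move=> x1; apply: hdV; apply: le_lt_trans eV; exact: zeQ.
(* A zero of [G] is an exact hit of the target chart. Its first-order part is the identity by
   [linear_part]. *)
pose G x := ep^-1 *: (Theta (Z (ep *: E x) T) - F (ep *: Q x)).
have epi0 : 0 < ep^-1 by rewrite invr_gt0.
have linear_part x : (\sum_i (ep *: E x) 0 i *: rawi i) *m B - L (ep *: Q x) = ep *: x.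
  have -> : \sum_i (ep *: E x) 0 i *: rawi i = ep *: \sum_i E x 0 i *: rawi i.
    by rewrite scaler_sumr; apply: eq_bigr => i _; rewrite [(ep *: E x) 0 i]mxE scalerA.
  rewrite -scalemxAl LZ -scalerBr; congr (_ *: _).
  rewrite big_ord_recl E0 {1}/rawi unlift_none mulmxDl -scalemxAl /Q L_sum.
  rewrite -[RHS](cE x) big_split_ord /= addrAC [RHS]addrC; congr (_ + _).
    rewrite scaler_suml -sumrB; apply: eq_bigr => j _; rewrite kkr.
    by have [_ _ -> _] := hav j; rewrite scalerBr scalerA.
  rewrite mulmx_suml; apply: eq_bigr => i _.
  by rewrite El /rawi liftK kkl -scalemxAl; have [_ _ ->] := htw i.
have Gid x : `|x| <= 1 -> `|G x - x| <= 1.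
  move=> x1; set z := Z (ep *: E x); set v := ep *: Q x.
  have -> : G x - x = ep^-1 *: ((Theta (z T) - Theta (zb S) - (z T - zb S) *m B) +
     (z T - y T - \sum_i (ep *: E x) 0 i *: rawi i) *m B - (F v - F 0 - L v)).
    rewrite -[X in _ - X](scalerK (lt0r_neq0 ep0)) -linear_part -scalerBr /G -/z -/v F0 yT.
    congr (_ *: _); rewrite [(_ - \sum_i _) *m B]mulmxBl.
    move: (Theta (z T)) (Theta (zb S)) ((z T - zb S) *m B) ((\sum_i _) *m B) (F v) (L v) => a b w sB f l.
    by apply/rowP => j; rewrite !mxE; ring.
  rewrite normrZ gtr0_norm// -ler_pdivlMl// invrK mulr1.
  have nz : `|z T - zb S| <= Ct * (ep * Bd) by rewrite -yT; exact: nearx.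
  have h1 : `|Theta (z T) - Theta (zb S) - (z T - zb S) *m B| <= ep * (1 / 3).
    apply: le_trans (hdT _ _) _; first by apply: le_lt_trans nz (small _ eT).
    apply: le_trans (ler_wpM2l (ltW etaT0) nz) _.
    have -> : Ct * (ep * Bd) = ep * (Ct * Bd) by ring.
    by rewrite mulrCA ler_pM2l.
  have h2 : `|(z T - y T - \sum_i (ep *: E x) 0 i *: rawi i) *m B| <= ep * (1 / 3).
    apply: le_trans (hB _) _.
    have := hdE (ep *: E x) z (ltW (le_lt_trans (zeE x x1) eE)) (e11 x x1) (trajx x x1).
    move=> /(ler_wpM2l Bn0) /le_trans; apply.
    apply: (@le_trans _ _ (Bn * (1 / (3 * (Bn * Bd + 1)) * (ep * Bd)))).
      by rewrite ler_wpM2l// ler_wpM2l ?zeE// ltW.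
    rewrite (_ : Bn * _ = ep * (1 / (3 * (Bn * Bd + 1)) * (Bn * Bd))) ?ler_pM2l//.
    by move: (1 / _) => a; ring.
  have h3 : `|F v - F 0 - L v| <= ep * (1 / 3).
    apply: le_trans (hdF _ (QV _ x1) (CZ ep0 (QC x)) (le_lt_trans (zeQ x x1) eF)) _.
    apply: le_trans (ler_wpM2l (ltW etaF0) (zeQ x x1)) _.
    by rewrite mulrCA ler_pM2l.
  rewrite (le_trans (ler_normB _ _))//; apply: (@le_trans _ _ (ep * (1 / 3) + ep * (1 / 3) + ep * (1 / 3))).
    by rewrite lerD// (le_trans (ler_normD _ _))// lerD.
  by rewrite -!mulrDr ler_piMr ?(ltW ep0)//; lra.
have Gcont : cont_on [set x | `|x| <= 1] G.
  move=> x x1 e e0.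
  have e20 : 0 < ep * e / 2 by rewrite divr_gt0// mulr_gt0.
  have [d1 d10 hd1] := Theta_cont (x := Z (ep *: E x) T) Logic.I e20.
  have [d2 d20 hd2] := Fcont (conj (QV x x1) (CZ ep0 (QC x))) e20.
  have N1 : 0 < (Ct + 1) * (ep * Bd) := mulr_gt0 Ct1 (mulr_gt0 ep0 Bd0).
  have N2 : 0 < ep * Bd := mulr_gt0 ep0 Bd0.
  exists (Num.min (d1 / ((Ct + 1) * (ep * Bd))) (d2 / (ep * Bd))).
    by rewrite lt_min !divr_gt0.
  move=> x' x1'; rewrite lt_min !ltr_pdivlMr// => /andP[xx1 xx2].
  have h1 : `|Z (ep *: E x') T - Z (ep *: E x) T| < d1.
    apply: le_lt_trans (hCt _ _ _ _ (e11 _ x1') (e11 _ x1) (trajx _ x1') (trajx _ x1) _ TT) _.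
    apply: le_lt_trans xx1; rewrite -scalerBr normrZ gtr0_norm//.
    have := Elip x' x; rewrite -(ler_pM2l ep0) => /(ler_wpM2l Ct0) /le_trans; apply.
    rewrite (_ : _ * (_ * (Bd * _)) = `|x' - x| * (Ct * (ep * Bd))); last by ring.
    by rewrite ler_wpM2l// ler_wpM2r ?lerDl// ltW.
  have h2 : `|ep *: Q x' - ep *: Q x| < d2.
    apply: le_lt_trans xx2; rewrite -scalerBr normrZ gtr0_norm//.
    by have := Qlip x' x; rewrite -(ler_pM2l ep0) => /le_trans; apply; rewrite mulrA mulrC.
  have k1' := hd1 _ Logic.I h1; have k2' := hd2 _ (conj (QV x' x1') (CZ ep0 (QC x'))) h2.
  rewrite /G -scalerBr normrZ gtr0_norm// -ltr_pdivlMl// invrK.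
  rewrite (_ : _ - _ = (Theta (Z (ep *: E x') T) - Theta (Z (ep *: E x) T)) - (F (ep *: Q x') - F (ep *: Q x))).
    by rewrite (le_lt_trans (ler_normB _ _))//; lra.
  by apply/rowP => j; rewrite !mxE; ring.
have [x x1 Gx] := zero_of_near_id Gcont Gid.
have ThF : Theta (Z (ep *: E x) T) = F (ep *: Q x).
  apply/eqP; rewrite -subr_eq0; move/eqP: Gx; rewrite scaler_eq0 gt_eqF//.
set z := Z (ep *: E x); have [vz hz] := trajx x x1.
(* The weight of index 0 multiplies [vs] and provides [kappa]; the rest of the sum is [v']. *)
exists T, u, (weight vb psi (ep *: E x)), z, (ep *: Q x),
  (\sum_(j | j != ord0) (ep * c x (rshift p j)) *: (av j).2), (ep * c x (rshift p ord0)).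
have zrho t : 0 <= t <= T -> `|z t| <= rho.
  move=> tT; have h1 : `|z t - y t| <= 1.
    by apply: ltW; apply: le_lt_trans (nearx x x1 t tT) (small _ e1').
  rewrite -[z t](subrK (y t)) addrC (le_trans (ler_normD _ _))//.
  by apply: le_trans (yrho t); rewrite lerD2l.
split; first split => //.
  by rewrite /T addrAC subrr add0r (le_trans ph)// ge_min lexx.
split; first split => //.
- exact: (bmeas_weight bvb bpsi).
(* Lower bound for the speed: at least 1/2 where the reference runs, since the slowing-down rate is
   at most 1/2; on an inserted interval, exactly its strength divided by [h]. *)
- pose c0' := \big[Order.min/1 / 2]_i (ep * c x (lshift q.+1 i) * h^-1).
  exists c0'.
    by rewrite /c0'; elim/big_rec : _ => [|i r _ r0]; [lra|rewrite lt_min r0 andbT; apply: mulr_gt0 => //; exact: mulr_gt0].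
  have c0'h : c0' <= 1 / 2.
    by rewrite /c0'; elim/big_rec : _ => [//|i r _ r0]; rewrite ge_min r0 orbT.
  move=> t; rewrite /weight big_ord_recl psi0.
  have -> : \sum_(i < p) (ep *: E x) 0 (lift ord0 i) * psi (lift ord0 i) t =
     \sum_(i < p) ep * c x (lshift q.+1 i) * h^-1 * phi i t.
    by apply: eq_bigr => i _; rewrite psil [X in X * _]mxE El mulrA.
  have [[-> _ p0]|[-> [i [ip pe _ _]]]] := inserted_val I t.
    rewrite big1 ?addr0; last by move=> i _; rewrite p0 mulr0.
    have := le_trans (norm_rV_coord (ep *: E x) ord0) (zeE x x1).
    rewrite ler_norml => /andP[_ h1]; move: h1; set a := (ep *: E x) 0 ord0 => h1.
    by apply: le_trans c0'h _; lra.
  rewrite oppr0 mulr0 !add0r (bigD1 (Ordinal ip))//= pe eqxx mulr1 big1 ?addr0.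
    by rewrite /c0' (bigD1 (Ordinal ip))//= ge_min lexx.
  by move=> j ji; rewrite pe; case: eqP => [jE|_]; [case/eqP: ji; exact/val_inj|rewrite mulr0].
- move=> t j tT; rewrite hz//; congr (_ + _); apply: RInt0_eq => r /andP[r0 rt].
  have rT : 0 <= r <= T by rewrite r0; case/andP: tT => _; exact: le_trans.
  by rewrite /fc clipv_id// zrho.
split.
  move=> t tT; rewrite -(subrKA (y t)) (le_trans (ler_normD _ _))// [leRHS]splitr lerD//.
    apply: ltW; apply: le_lt_trans (nearx x x1 t tT) (small _ _).
    by move: eD; rewrite invfM mulrA.
  rewrite /y; apply: le_trans (_ : Cz * dh <= _).
    rewrite -{1}(clip_id (ssS t tT)) (le_trans (hCzl _ _))// ler_wpM2l//.
    apply: le_trans (clip_lip _ _ _) _; apply: le_trans ph; exact: (inserted_close I tT).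
  apply: (@le_trans _ _ ((Cz + 1) * (delta / (2 * (Cz + 1))))).
    by apply: ler_pM; rewrite ?(ltW dh0)// ?lerDl// /dh ge_min lexx orbT.
  by rewrite le_eqVlt; apply/orP; left; apply/eqP; field; rewrite gt_eqF// ltr_wpDl.
split; first by split; [exact: QV|apply: CZ => //; exact: QC|].
split.
- rewrite /Q scaler_sumr (bigD1 ord0)//= scalerA; have [_ _ _ ->] := hav ord0 => //.
  by congr (_ + _); apply: eq_bigr => j _; rewrite scalerA.
- by rewrite mulr_gt0.
- by apply: C_sum => [j|j]; [rewrite mulr_gt0|case: (hav j)].
Qed.

End Basis.

Theorem multiplier_or_perturbation : (exists P mu, multiplier P mu) \/
  forall delta, 0 < delta -> exists T u w z v v' kappa, perturbed delta T u w z v v' kappa.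
Proof.
have [Pb [vPb PbS Pb_ode]] := @adjoint_basis R n S (fun t => \matrix_(i, l) DX i (zb t) (ub t) 0 l)
  (ltW S0) (ltac:(move=> i j; rewrite (_ : (fun t => _) = fun t => DX i (zb t) (ub t) 0 j);
     [exact: DXm|by apply/funext => t; rewrite mxE])).
have Pb_ode' j t i : 0 <= t <= S -> Pb j t 0 i = Pb j 0 0 i +
  RInt0 t (fun r => - \sum_l DX i (zb r) (ub r) 0 l * Pb j r 0 l).
  move=> tS; rewrite Pb_ode//; congr (_ + _); apply: RInt0_eq => r _; congr (- _).
  by apply: eq_bigr => l _; rewrite mxE.
set raw := fun t w => \row_j dotv (X (zb t) w) (Pb j t) : 'rV[R]_n.
set rs : 'rV[R]_n := \row_j - RInt0 S (fun r => dotv (X (zb r) (ub r)) (Pb j r)).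
have := @cone_alternative2 R D (fun k => exists t w, [/\ 0 <= t <= S, U w & k = raw t w *m B])
  (fun k => k = rs *m B \/ exists2 v, C v & k = - L v) (- L vs) (or_intror (ex_intro2 _ _ vs Cvs erefl)).
case=> [[mu mu0 hmu]|[p [q [k1 [k2 [hk1 hk2 k20 hk]]]]]]; [left|right].
  by have [P hP] := multiplier_of_polar vPb PbS Pb_ode' mu0 hmu; exists P, mu.
exact: (perturbation_of_span vPb PbS Pb_ode' hk1 hk2 k20 hk).
Qed.

End Alternative.

(** * The augmented control system *)

Section ContOn.
Context {R : realType}.

Lemma within_cont_on (V W : normedModType R) (D : set V) (h : V -> W) :
  {within D, continuous h} -> cont_on D h.
Proof.
move=> ch x Dx e e0; have := ch x; move/cvgrPdist_lt => /(_ e e0).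
rewrite /nbhs /= -nbhs_subspace_in// => /nbhs_ballP[d d0 hd].
exists d => // y Dy yx; rewrite distrC; apply: hd => //.
by rewrite -ball_normE /= distrC.
Qed.

Lemma continuous_cont_on (V W : normedModType R) (D : set V) (h : V -> W) :
  continuous h -> cont_on D h.
Proof.
by move=> ch; apply: within_cont_on; exact: continuous_subspaceT.
Qed.

Lemma cont_on_cst (V : normedModType R) (D : set V) (c : R) : cont_on D (fun=> c).
Proof. by move=> x Dx e e0; exists 1 => // y _ _; rewrite subrr normr0. Qed.

Lemma cont_onD (V : normedModType R) (D : set V) (h k : V -> R) :
  cont_on D h -> cont_on D k -> cont_on D (fun x => h x + k x).
Proof.
move=> ch ck x Dx e e0; have e2 : 0 < e / 2 by rewrite divr_gt0.
have [d1 d10 h1] := ch x Dx _ e2; have [d2 d20 h2] := ck x Dx _ e2.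
exists (Num.min d1 d2); first by rewrite lt_min d10.
move=> y Dy; rewrite lt_min => /andP[/(h1 y Dy) k1 /(h2 y Dy) k2].
by rewrite opprD addrACA (le_lt_trans (ler_normD _ _))// [ltRHS]splitr ltrD.
Qed.

Lemma cont_onM (V : normedModType R) (D : set V) (h k : V -> R) :
  cont_on D h -> cont_on D k -> cont_on D (fun x => h x * k x).
Proof.
move=> ch ck x Dx e e0.
pose N := `|h x| + `|k x| + 1.
have N1 : 1 <= N by rewrite /N lerDr addr_ge0.
have N0 : 0 < N by exact: lt_le_trans N1.
pose e' := Num.min 1 (e / (3 * N)).
have e'0 : 0 < e' by rewrite lt_min ltr01 divr_gt0// mulr_gt0.
have e'1 : e' <= 1 by rewrite ge_min lexx.
have e'N : e' * N <= e / 3.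
  by rewrite -ler_pdivlMr// ge_min -mulrA -invfM lexx orbT.
have [d1 d10 h1] := ch x Dx _ e'0; have [d2 d20 h2] := ck x Dx _ e'0.
exists (Num.min d1 d2); first by rewrite lt_min d10.
move=> y Dy; rewrite lt_min => /andP[/(h1 y Dy) k1 /(h2 y Dy) k2].
have -> : h y * k y - h x * k x = (h y - h x) * (k y - k x) + (h y - h x) * k x + h x * (k y - k x) by ring.
have hx0 := normr_ge0 (h x); have kx0 := normr_ge0 (k x).
have b1 : `|(h y - h x) * (k y - k x)| <= e' * 1.
  by rewrite normrM ler_pM// ltW// (lt_le_trans k2).
have b2 : `|(h y - h x) * k x| <= e' * `|k x| by rewrite normrM ler_wpM2r// ltW.
have b3 : `|h x * (k y - k x)| <= e' * `|h x| by rewrite normrM mulrC ler_wpM2r// ltW.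
rewrite (le_lt_trans (ler_normD _ _))// (le_lt_trans (lerD (ler_normD _ _) (lexx _)))//.
apply: (@le_lt_trans _ _ (e' * N)); last by rewrite (le_lt_trans e'N)//; lra.
have -> : e' * N = e' * 1 + e' * `|k x| + e' * `|h x| by rewrite /N; ring.
by rewrite !lerD.
Qed.

Lemma cont_on_sum (V : normedModType R) (D : set V) (I : Type) (s : seq I) (h : I -> V -> R) :
  (forall i, cont_on D (h i)) -> cont_on D (fun x => \sum_(i <- s) h i x).
Proof.
move=> ch; elim: s => [|i s IH].
  rewrite (_ : (fun x => _) = fun=> 0); first exact: cont_on_cst.
  by apply/funext => x; rewrite big_nil.
rewrite (_ : (fun x => _) = fun x => h i x + \sum_(i <- s) h i x); first exact: cont_onD.
by apply/funext => x; rewrite big_cons.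
Qed.

Lemma cont_on_rV (V : normedModType R) (D : set V) n (h : V -> 'rV[R]_n) :
  (forall j, cont_on D (fun x => h x 0 j)) -> cont_on D h.
Proof.
move=> ch x Dx e e0; have e2 : 0 < e / 2 by rewrite divr_gt0.
have /choice[d hd] j : exists d : R, 0 < d /\ forall y, D y -> `|y - x| < d -> `|h y 0 j - h x 0 j| < e / 2.
  by have [d d0 hd] := ch j x Dx _ e2; exists d.
have ds0 : 0 < \big[Order.min/1]_j d j.
  elim/big_rec : _ => // j y _ y0; rewrite lt_min y0 andbT; exact: (hd j).1.
exists (\big[Order.min/1]_j d j) => // y Dy yx.
apply: (@le_lt_trans _ _ (e / 2)); last lra.
apply: norm_rV_le => [|j]; first exact: ltW.
rewrite !mxE; apply/ltW/(hd j).2 => //; apply: lt_le_trans yx _.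
by rewrite (bigD1 j)//= ge_min lexx.
Qed.

Lemma cont_on_coord (V : normedModType R) (D : set V) n (h : V -> 'rV[R]_n) j :
  cont_on D h -> cont_on D (fun x => h x 0 j).
Proof.
move=> ch x Dx e e0; have [d d0 hd] := ch x Dx e e0; exists d => // y Dy yx.
by have := norm_rV_coord (h y - h x) j; rewrite !mxE => /le_lt_trans; apply; exact: hd.
Qed.

Lemma cont_on_comp (V V' W : normedModType R) (D : set V) (D' : set V') (p : V -> V') (h : V' -> W) :
  (forall x, D x -> D' (p x)) -> (forall x y, `|p x - p y| <= `|x - y|) ->
  cont_on D' h -> cont_on D (fun x => h (p x)).
Proof.
move=> pD pl ch x Dx e e0; have [d d0 hd] := ch _ (pD x Dx) e e0; exists d => // y Dy yx.
by apply: hd; [exact: pD|exact: le_lt_trans (pl _ _) yx].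
Qed.

Lemma lip_continuous (V W : normedModType R) (p : V -> W) :
  (forall x y, `|p x - p y| <= `|x - y|) -> continuous p.
Proof.
move=> pl x; apply/cvgrPdist_lt => e e0; apply/nbhs_ballP; exists e => //= y.
by rewrite -ball_normE /=; exact: le_lt_trans.
Qed.

Lemma norm_lsubmx n1 n2 (z : 'rV[R]_(n1 + n2)) : `|lsubmx z| <= `|z|.
Proof. by apply: norm_rV_le => // i; rewrite mxE norm_rV_coord. Qed.

Lemma norm_rsubmx n1 n2 (z : 'rV[R]_(n1 + n2)) : `|rsubmx z| <= `|z|.
Proof. by apply: norm_rV_le => // i; rewrite mxE norm_rV_coord. Qed.

Lemma lsubmxB n1 n2 (z z' : 'rV[R]_(n1 + n2)) : lsubmx z - lsubmx z' = lsubmx (z - z').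
Proof. by apply/rowP => i; rewrite !mxE. Qed.

Lemma rsubmxB n1 n2 (z z' : 'rV[R]_(n1 + n2)) : rsubmx z - rsubmx z' = rsubmx (z - z').
Proof. by apply/rowP => i; rewrite !mxE. Qed.

Lemma enorm_ge0 n (w : 'rV[R]_n) : 0 <= enorm w.
Proof. exact: sqrtr_ge0. Qed.

Lemma continuous_enorm n : continuous (@enorm R n).
Proof.
move=> x; apply: continuous_comp; last exact: sqrt_continuous.
rewrite /dotv; apply: (@continuous_sumr R 'rV[R]_n _ _ (fun i (u : 'rV[R]_n) => u 0 i * u 0 i)) => i.
by move=> y; apply: (@continuousM R 'rV[R]_n (fun u => u 0 i) (fun u => u 0 i)); exact: coord_continuous.
Qed.

Lemma norm_le_enorm n (w : 'rV[R]_n) : `|w| <= enorm w.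
Proof.
apply: norm_rV_le => [|i]; first exact: enorm_ge0.
rewrite -sqrtr_sqr ler_wsqrtr// /dotv (bigD1 i)//= expr2 lerDl sumr_ge0// => j _.
by rewrite -expr2 sqr_ge0.
Qed.

Lemma enormZ n a (w : 'rV[R]_n) : 0 <= a -> enorm (a *: w) = a * enorm w.
Proof.
move=> a0; rewrite /enorm dotvZl dotvZr mulrA -expr2 sqrtrM ?sqr_ge0//.
by rewrite sqrtr_sqr ger0_norm.
Qed.

Lemma enorm_le n (w : 'rV[R]_n) : enorm w <= n%:R * `|w|.
Proof.
have h : enorm w <= Num.sqrt (n%:R * (`|w| * `|w|)).
  by rewrite ler_wsqrtr// (le_trans _ (dotv_le _ _))// ler_norm.
apply: le_trans h _.
rewrite -[leRHS]ger0_norm ?mulr_ge0// -sqrtr_sqr ler_wsqrtr//.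
have -> : (n%:R * `|w|) ^+ 2 = n%:R ^+ 2 * (`|w| * `|w|) by ring.
rewrite ler_wpM2r ?mulr_ge0//.
by case: n w => [|n] w; rewrite expr2 ?mulr0// ler_peMr// ler1n.
Qed.

End ContOn.

Section Encoding.
Context {R : realType}.

Definition row3 (a b c : R) : 'rV[R]_3 :=
  \row_i match nat_of_ord i with 0%N => a | 1%N => b | _ => c end.

(** In the augmented state these are the slots of time, of [beta] and of accumulated cost; in the
    chart of the target the same indices number the slack variables. *)
Definition j0 : 'I_3 := @Ordinal 3 0 isT.
Definition j1 : 'I_3 := @Ordinal 3 1 isT.
Definition j2 : 'I_3 := @Ordinal 3 2 isT.

Lemma ord3P (P : 'I_3 -> Prop) : P j0 -> P j1 -> P j2 -> forall j, P j.
Proof.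
move=> p0 p1 p2 [[|[|[|//]]] h].
- by rewrite (_ : Ordinal h = j0)//; exact: val_inj.
- by rewrite (_ : Ordinal h = j1)//; exact: val_inj.
- by rewrite (_ : Ordinal h = j2)//; exact: val_inj.
Qed.

Lemma dotv_row3 a b c (u : 'rV[R]_3) : dotv (row3 a b c) u = a * u 0 j0 + b * u 0 j1 + c * u 0 j2.
Proof.
rewrite /dotv !big_ord_recl big_ord0 addr0 !mxE /= addrA.
by congr (_ * u 0 _ + _ * u 0 _ + _ * u 0 _); exact: val_inj.
Qed.

Lemma dotv_row_mx n1 n2 (a : 'rV[R]_n1) (b : 'rV[R]_n2) (u : 'rV[R]_(n1 + n2)) :
  dotv (row_mx a b) u = dotv a (lsubmx u) + dotv b (rsubmx u).
Proof.
rewrite /dotv big_split_ord /=; congr (_ + _); apply: eq_bigr => i _.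
  by rewrite row_mxEl mxE.
by rewrite row_mxEr mxE.
Qed.

Lemma row3_inj a b c a' b' c' : row3 a b c = row3 a' b' c' -> [/\ a = a', b = b' & c = c'].
Proof.
move=> /rowP h; split; [have := h j0|have := h j1|have := h j2]; by rewrite !mxE.
Qed.

End Encoding.

Section Controls.
Context {R : realType}.
Variables (m q : nat).

Definition ctl (w0 : R) (w : 'rV[R]_m) (a : 'rV[R]_q) : 'rV[R]_(1 + (m + q)) :=
  row_mx (const_mx w0) (row_mx w a).
Definition ctl0 (u : 'rV[R]_(1 + (m + q))) : R := u 0 (lshift (m + q) ord0).
Definition ctlw (u : 'rV[R]_(1 + (m + q))) : 'rV[R]_m := lsubmx (rsubmx u).
Definition ctla (u : 'rV[R]_(1 + (m + q))) : 'rV[R]_q := rsubmx (rsubmx u).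

Lemma ctl0K w0 w a : ctl0 (ctl w0 w a) = w0.
Proof. by rewrite /ctl0 /ctl row_mxEl mxE. Qed.
Lemma ctlwK w0 w a : ctlw (ctl w0 w a) = w.
Proof. by rewrite /ctlw /ctl row_mxKr row_mxKl. Qed.
Lemma ctlaK w0 w a : ctla (ctl w0 w a) = a.
Proof. by rewrite /ctla /ctl row_mxKr row_mxKr. Qed.

Lemma ctl0_lip u v : `|ctl0 u - ctl0 v| <= `|u - v|.
Proof. by have := norm_rV_coord (u - v) (lshift (m + q) ord0); rewrite !mxE. Qed.
Lemma ctlw_lip u v : `|ctlw u - ctlw v| <= `|u - v|.
Proof. by rewrite /ctlw !lsubmxB rsubmxB (le_trans (norm_lsubmx _))// norm_rsubmx. Qed.
Lemma ctla_lip u v : `|ctla u - ctla v| <= `|u - v|.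
Proof. by rewrite /ctla !rsubmxB (le_trans (norm_rsubmx _))// norm_rsubmx. Qed.

Lemma norm_ctl (u : 'rV[R]_(1 + (m + q))) b : 0 <= b -> `|ctl0 u| <= b -> `|ctlw u| <= b -> `|ctla u| <= b ->
  `|u| <= b.
Proof.
move=> b0 h0 h1 h2; apply: norm_rV_le => // j.
case: (split_ordP j) => [k ->|k ->]; first by rewrite ord1.
case: (split_ordP k) => [l ->|l ->].
  by apply: le_trans h1; have := norm_rV_coord (ctlw u) l; rewrite !mxE.
by apply: le_trans h2; have := norm_rV_coord (ctla u) l; rewrite !mxE.
Qed.

(** The normalization in [Wset] restores compactness although the cone is unbounded; other
    magnitudes are recovered through the speed, by homogeneity. *)
Definition control_set (C : set 'rV[R]_m) (A : set 'rV[R]_q) : set 'rV[R]_(1 + (m + q)) :=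
  [set u | Wset C (ctl0 u, ctlw u) /\ A (ctla u)].

Lemma compact_control_set C A : closed C -> compact A -> compact (control_set C A).
Proof.
move=> clC cA; have [M [_ MA]] := compact_bounded cA.
apply: bounded_closed_compact.
  exists (`|M| + 1); split; first exact: num_real.
  move=> N MN u /= [[w0 [Cw w1]] Au].
  have N1 : 1 <= N by apply: ltW; apply: le_lt_trans MN; rewrite lerDr.
  apply: norm_ctl; [exact: le_trans N1| | |].
  - by rewrite ger0_norm// (le_trans _ N1)//= -w1 lerDl enorm_ge0.
  - by rewrite (le_trans (norm_le_enorm _))// (le_trans _ N1)//= -w1 lerDr.
  - by apply: MA => //; apply: le_lt_trans MN; rewrite (le_trans (ler_norm _))// lerDl.
have -> : control_set C A = ctl0 @^-1` [set x | 0 <= x] `&` (ctlw @^-1` C `&`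
    ((fun u => ctl0 u + enorm (ctlw u)) @^-1` [set x | x = 1] `&` ctla @^-1` A)).
  apply/seteqP; split => u /=; first by move=> [[? [? ?]] ?].
  by move=> [? [? [? ?]]].
have c0 : continuous ctl0 by apply: lip_continuous; exact: ctl0_lip.
have cw : continuous ctlw by apply: lip_continuous; exact: ctlw_lip.
have ca : continuous ctla by apply: lip_continuous; exact: ctla_lip.
apply: closedI; first by apply: preimage_closed; [move=> u _; exact: c0|exact: closed_ge].
apply: closedI; first by apply: preimage_closed => // u _; exact: cw.
apply: closedI; last by apply: preimage_closed; [move=> u _; exact: ca|exact: compact_closed].
apply: preimage_closed; last exact: closed_eq.
move=> u _; apply: (@continuousD R R _ ctl0 (fun u => enorm (ctlw u))); first exact: c0.
by apply: continuous_comp; [exact: cw|exact: continuous_enorm].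
Qed.

End Controls.

Section DeriveAux.
Context {R : realType}.

Lemma is_derive_lsubmx n k (h : 'rV[R]_n -> R) (z v : 'rV[R]_(n + k)) d :
  is_derive (lsubmx z) (lsubmx v) h d -> is_derive z v (fun z => h (lsubmx z)) d.
Proof.
move=> [dh <-].
have E : (fun s : R => s^-1 *: (((fun z => h (lsubmx z)) \o shift z) (s *: v) - h (lsubmx z)))
   = (fun s => s^-1 *: ((h \o shift (lsubmx z)) (s *: lsubmx v) - h (lsubmx z))).
  apply/funext => s /=; congr (_ *: (h _ - _)).
  by apply/rowP => i; rewrite !mxE.
by apply: DeriveDef; [rewrite /derivable E|rewrite /derive E].
Qed.

Lemma is_derive_dir0 (V : normedModType R) (h : V -> R) x : is_derive x 0 h 0.
Proof.
have E : (fun s : R => s^-1 *: ((h \o shift x) (s *: 0) - h x)) = fun=> 0.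
  by apply/funext => s /=; rewrite scaler0 add0r subrr scaler0.
apply: DeriveDef; first by rewrite /derivable E; exact: is_cvg_cst.
by rewrite /derive E; apply: cvg_lim => //; exact: cvg_cst.
Qed.

Lemma is_derive_coord (V : normedModType R) n (h : V -> 'rV[R]_n) x v j :
  derivable h x v -> is_derive x v (fun y => h y 0 j) (('D_v h x) 0 j).
Proof.
move=> dh; have := derive_mx dh => ->; rewrite mxE.
by apply: DeriveDef => //; exact: (derivable_mxP _ _ _).1.
Qed.

End DeriveAux.

Section Field.
Context {R : realType}.
Variables (n m q : nat).
Variables (C : set 'rV[R]_m) (A : set 'rV[R]_q)
  (f : 'rV[R]_n -> 'rV[R]_q -> 'rV[R]_n) (g : 'I_m -> 'rV[R]_n -> 'rV[R]_n)
  (l0 : 'rV[R]_n -> 'rV[R]_q -> R) (lhat1 : 'rV[R]_n -> R -> 'rV[R]_m -> R).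
Hypotheses (clC : closed C) (hA : compact A).
Hypothesis hf_cont : {within [set xa : 'rV[R]_n * 'rV[R]_q | A xa.2],
                continuous (fun xa => f xa.1 xa.2)}.
Hypothesis hf_der : forall (j : 'I_n) x a, A a -> derivable (fun x' => f x' a) x (evec j).
Hypothesis hf_der_cont : forall j : 'I_n, {within [set xa : 'rV[R]_n * 'rV[R]_q | A xa.2],
                continuous (fun xa => derive (fun x' => f x' xa.2) xa.1 (evec j))}.
Hypothesis hg_diff : forall i x, differentiable (g i) x.
Hypothesis hg_cont : forall i (v : 'rV[R]_n), continuous (fun x => 'd (g i) x v).
Hypothesis hl0_cont : {within [set xa : 'rV[R]_n * 'rV[R]_q | A xa.2],
                continuous (fun xa => l0 xa.1 xa.2)}.
Hypothesis hl0_der : forall (j : 'I_n) x a, A a -> derivable (fun x' => l0 x' a) x (evec j).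
Hypothesis hl0_der_cont : forall j : 'I_n, {within [set xa : 'rV[R]_n * 'rV[R]_q | A xa.2],
                continuous (fun xa => derive (fun x' => l0 x' xa.2) xa.1 (evec j))}.
Hypothesis hlhat1_cont : {within [set z : 'rV[R]_n * R * 'rV[R]_m | 0 <= z.1.2 /\ C z.2],
                continuous (fun z => lhat1 z.1.1 z.1.2 z.2)}.
Hypothesis hlhat1_der : forall (j : 'I_n) x (w0 : R) w, 0 <= w0 -> C w ->
                derivable (fun x' => lhat1 x' w0 w) x (evec j).
Hypothesis hlhat1_der_cont : forall j : 'I_n,
                {within [set z : 'rV[R]_n * R * 'rV[R]_m | 0 <= z.1.2 /\ C z.2],
                continuous (fun z => derive (fun x' => lhat1 x' z.1.2 z.2) z.1.1 (evec j))}.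

(* The state is z = (y, (y0, beta, c)) and the control u = (w0, (w, a)). *)
Definition augX (z : 'rV[R]_(n + 3)) (u : 'rV[R]_(1 + (m + q))) : 'rV[R]_(n + 3) :=
  row_mx (dyn f g (lsubmx z) (ctl0 u) (ctlw u) (ctla u))
    (row3 (ctl0 u) (enorm (ctlw u)) (lext l0 lhat1 (lsubmx z) (ctl0 u) (ctlw u) (ctla u))).

Definition dynD (i : 'I_n) (x : 'rV[R]_n) (u : 'rV[R]_(1 + (m + q))) : 'rV[R]_n :=
  ctl0 u *: derive (fun x' => f x' (ctla u)) x (evec i) + \sum_l ctlw u 0 l *: 'd (g l) x (evec i).

Definition lextD (i : 'I_n) (x : 'rV[R]_n) (u : 'rV[R]_(1 + (m + q))) : R :=
  derive (fun x' => l0 x' (ctla u)) x (evec i) * ctl0 u +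
  derive (fun x' => lhat1 x' (ctl0 u) (ctlw u)) x (evec i).

(** The field depends on [y] only, so the derivatives in the three scalar slots vanish; this is what
    makes the corresponding adjoint components constant. *)
Definition augD (k : 'I_(n + 3)) (z : 'rV[R]_(n + 3)) (u : 'rV[R]_(1 + (m + q))) : 'rV[R]_(n + 3) :=
  match fintype.split k with
  | inl i => row_mx (dynD i (lsubmx z) u) (row3 0 0 (lextD i (lsubmx z) u))
  | inr _ => 0
  end.

Lemma augD_l i z u : augD (lshift 3 i) z u = row_mx (dynD i (lsubmx z) u) (row3 0 0 (lextD i (lsubmx z) u)).
Proof. by rewrite /augD (unsplitK (inl i)). Qed.

Lemma augD_r i z u : augD (rshift n i) z u = 0.
Proof. by rewrite /augD (unsplitK (inr i)). Qed.

Lemma is_derive_dyn i j x u : control_set C A u ->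
  is_derive x (evec i) (fun x => dyn f g x (ctl0 u) (ctlw u) (ctla u) 0 j) (dynD i x u 0 j).
Proof.
move=> [[w0 [Cw w1]] Au].
have -> : (fun x => dyn f g x (ctl0 u) (ctlw u) (ctla u) 0 j) =
    (ctl0 u *: (fun x => f x (ctla u) 0 j) + \sum_(l < m) (ctlw u 0 l *: (fun x => g l x 0 j))).
  apply/funext => y; rewrite /dyn !mxE summxE fct_sumE; congr (_ + _).
  by apply: eq_bigr => l _; rewrite mxE.
have -> : dynD i x u 0 j = ctl0 u *: ('D_(evec i) (fun x' => f x' (ctla u)) x) 0 j +
   \sum_(l < m) ctlw u 0 l *: ('d (g l) x (evec i)) 0 j.
  by rewrite /dynD !mxE summxE; congr (_ + _); apply: eq_bigr => l _; rewrite mxE.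
apply: is_deriveD.
  by apply: is_deriveZ; apply: is_derive_coord; exact: hf_der.
apply: is_derive_sum => l; apply: is_deriveZ.
rewrite -deriveE//; apply: is_derive_coord; exact: diff_derivable.
Qed.

Lemma is_derive_lext i x u : control_set C A u ->
  is_derive x (evec i) (fun x => lext l0 lhat1 x (ctl0 u) (ctlw u) (ctla u)) (lextD i x u).
Proof.
move=> [[w0 [Cw w1]] Au].
have -> : (fun x => lext l0 lhat1 x (ctl0 u) (ctlw u) (ctla u)) =
   ctl0 u *: (fun x => l0 x (ctla u)) + (fun x => lhat1 x (ctl0 u) (ctlw u)).
  by apply/funext => y; rewrite /lext [in LHS]mulrC.
rewrite /lextD mulrC; apply: is_deriveD.
  by apply: is_deriveZ; apply: DeriveDef => //; exact: hl0_der.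
by apply: DeriveDef => //; exact: hlhat1_der.
Qed.

Let D := [set zu : 'rV[R]_(n + 3) * 'rV[R]_(1 + (m + q)) | control_set C A zu.2].

Let pxa (zu : 'rV[R]_(n + 3) * 'rV[R]_(1 + (m + q))) := (lsubmx zu.1, ctla zu.2).
Let pxw (zu : 'rV[R]_(n + 3) * 'rV[R]_(1 + (m + q))) := ((lsubmx zu.1, ctl0 zu.2), ctlw zu.2).

Let norm_fst (zu zu' : 'rV[R]_(n + 3) * 'rV[R]_(1 + (m + q))) : `|zu.1 - zu'.1| <= `|zu - zu'|.
Proof. by rewrite [leRHS]prod_normE le_max lexx. Qed.
Let norm_snd (zu zu' : 'rV[R]_(n + 3) * 'rV[R]_(1 + (m + q))) : `|zu.2 - zu'.2| <= `|zu - zu'|.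
Proof. by rewrite [leRHS]prod_normE le_max lexx orbT. Qed.

Let lsub_lip (zu zu' : 'rV[R]_(n + 3) * 'rV[R]_(1 + (m + q))) : `|lsubmx zu.1 - lsubmx zu'.1| <= `|zu - zu'|.
Proof. by rewrite lsubmxB (le_trans (norm_lsubmx _)). Qed.

Let cont_xa (W : normedModType R) (h : 'rV[R]_n -> 'rV[R]_q -> W) :
  {within [set xa : 'rV[R]_n * 'rV[R]_q | A xa.2], continuous (fun xa => h xa.1 xa.2)} ->
  cont_on D (fun zu => h (lsubmx zu.1) (ctla zu.2)).
Proof.
move=> /within_cont_on ch; apply: (cont_on_comp (p := pxa) _ _ ch); first by move=> x [].
move=> x y; rewrite [leLHS]prod_normE /= ge_max lsub_lip /=.
by apply: le_trans (ctla_lip _ _) _.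
Qed.

Let cont_xw (W : normedModType R) (h : 'rV[R]_n -> R -> 'rV[R]_m -> W) :
  {within [set z : 'rV[R]_n * R * 'rV[R]_m | 0 <= z.1.2 /\ C z.2], continuous (fun z => h z.1.1 z.1.2 z.2)} ->
  cont_on D (fun zu => h (lsubmx zu.1) (ctl0 zu.2) (ctlw zu.2)).
Proof.
move=> /within_cont_on ch; apply: (cont_on_comp (p := pxw) _ _ ch); first by move=> x [[? []]].
move=> x y; rewrite [leLHS]prod_normE /= ge_max [leLHS]prod_normE /= ge_max lsub_lip /=.
by rewrite (le_trans (ctl0_lip _ _))// (le_trans (ctlw_lip _ _)).
Qed.

Let cont_x (W : normedModType R) (h : 'rV[R]_n -> W) : continuous h ->
  cont_on D (fun zu => h (lsubmx zu.1)).
Proof.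
move=> ch; apply: (cont_on_comp (p := fun zu => lsubmx zu.1) (D' := setT)) => //.
exact: continuous_cont_on.
Qed.

Let cont_u (W : normedModType R) (h : 'rV[R]_(1 + (m + q)) -> W) : continuous h ->
  cont_on D (fun zu => h zu.2).
Proof.
move=> ch; apply: (cont_on_comp (p := snd) (D' := setT)) => //.
exact: continuous_cont_on.
Qed.

Let c0 : continuous (@ctl0 R m q). Proof. by apply: lip_continuous; exact: ctl0_lip. Qed.
Let cw : continuous (@ctlw R m q). Proof. by apply: lip_continuous; exact: ctlw_lip. Qed.

Lemma smooth_augX : smooth_field (control_set C A) augX augD.
Proof.
split.
- exact: compact_control_set.
- apply: cont_on_rV => j; case: (split_ordP j) => [i ->|i ->].
    rewrite (_ : (fun zu => _) = fun zu => ctl0 zu.2 * f (lsubmx zu.1) (ctla zu.2) 0 i +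
       \sum_l ctlw zu.2 0 l * g l (lsubmx zu.1) 0 i); last first.
      apply/funext => zu; rewrite row_mxEl /dyn !mxE summxE; congr (_ + _).
      by apply: eq_bigr => l _; rewrite mxE.
    apply: cont_onD; first by apply: cont_onM; [exact: (cont_u c0)|exact: cont_on_coord (cont_xa hf_cont)].
    apply: cont_on_sum => l; apply: cont_onM; first exact: (cont_on_coord l (cont_u cw)).
    apply: (cont_on_coord i); apply: cont_x => x.
    exact: differentiable_continuous.
  move: i; apply: ord3P.
  + rewrite (_ : (fun zu => _) = fun zu => ctl0 zu.2); first exact: (cont_u c0).
    by apply/funext => zu; rewrite row_mxEr mxE.
  + rewrite (_ : (fun zu => _) = fun zu => enorm (ctlw zu.2)).
      apply: (cont_u (h := fun u => enorm (ctlw u))) => u.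
      by apply: continuous_comp; [exact: cw|exact: continuous_enorm].
    by apply/funext => zu; rewrite row_mxEr mxE.
  + rewrite (_ : (fun zu => _) = fun zu => l0 (lsubmx zu.1) (ctla zu.2) * ctl0 zu.2 +
       lhat1 (lsubmx zu.1) (ctl0 zu.2) (ctlw zu.2)).
      apply: cont_onD; last exact: (cont_xw hlhat1_cont).
      by apply: cont_onM; [exact: (cont_xa hl0_cont)|exact: (cont_u c0)].
    by apply/funext => zu; rewrite row_mxEr mxE.
- move=> k; case: (split_ordP k) => [i ->|i ->]; last first.
    rewrite (_ : (fun zu => _) = fun=> 0); last by apply/funext => zu; rewrite augD_r.
    by apply: cont_on_rV => j; rewrite (_ : (fun x => _) = fun=> 0);
      [exact: cont_on_cst|apply/funext => x; rewrite mxE].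
  apply: cont_on_rV => j; case: (split_ordP j) => [i' ->|i' ->].
    rewrite (_ : (fun zu => _) = fun zu => ctl0 zu.2 * (derive (fun x' => f x' (ctla zu.2)) (lsubmx zu.1) (evec i)) 0 i' +
       \sum_l ctlw zu.2 0 l * ('d (g l) (lsubmx zu.1) (evec i) : 'rV[R]_n) 0 i'); last first.
      apply/funext => zu; rewrite augD_l row_mxEl /dynD !mxE summxE; congr (_ + _).
      by apply: eq_bigr => l _; rewrite mxE.
    apply: cont_onD.
      apply: cont_onM; first exact: (cont_u c0).
      apply: (@cont_on_coord R _ _ n (fun zu : 'rV[R]_(n + 3) * 'rV[R]_(1 + (m + q)) => derive (fun x' => f x' (ctla zu.2)) (lsubmx zu.1) (evec i))).
      exact: (cont_xa (h := fun x a => derive (fun x' => f x' a) x (evec i)) (@hf_der_cont i)).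
    apply: cont_on_sum => l; apply: cont_onM; first exact: (cont_on_coord l (cont_u cw)).
    exact: (cont_on_coord i' (cont_x (@hg_cont l (evec i)))).
  move: i'; apply: ord3P.
  + rewrite (_ : (fun zu => _) = fun=> 0); first exact: cont_on_cst.
    by apply/funext => zu; rewrite augD_l row_mxEr mxE.
  + rewrite (_ : (fun zu => _) = fun=> 0); first exact: cont_on_cst.
    by apply/funext => zu; rewrite augD_l row_mxEr mxE.
  + rewrite (_ : (fun zu => _) = fun zu => lextD i (lsubmx zu.1) zu.2); last first.
      by apply/funext => zu; rewrite augD_l row_mxEr mxE.
    apply: cont_onD; last exact: (cont_xw (h := fun x w0 w => derive (fun x' => lhat1 x' w0 w) x (evec i)) (@hlhat1_der_cont i)).
    apply: cont_onM; last exact: (cont_u c0).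
    exact: (cont_xa (h := fun x a => derive (fun x' => l0 x' a) x (evec i)) (@hl0_der_cont i)).
- move=> k j u z Uu.
  have lev i : lsubmx (evec (lshift 3 i)) = evec i :> 'rV[R]_n.
    by apply/rowP => l; rewrite !mxE eqxx /= (inj_eq (@lshift_inj _ _)).
  have rev i : lsubmx (evec (rshift n i)) = 0 :> 'rV[R]_n.
    by apply/rowP => l; rewrite !mxE eqxx /= eq_lrshift.
  case: (split_ordP j) => [i ->|i ->].
    rewrite (_ : (fun x => _) = fun x => dyn f g (lsubmx x) (ctl0 u) (ctlw u) (ctla u) 0 i); last first.
      by apply/funext => x; rewrite row_mxEl.
    apply: (@is_derive_lsubmx R n 3 (fun x => dyn f g x (ctl0 u) (ctlw u) (ctla u) 0 i)).
    case: (split_ordP k) => [l ->|l ->].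
      by rewrite augD_l row_mxEl lev; exact: is_derive_dyn.
    by rewrite augD_r mxE rev; exact: is_derive_dir0.
  move: i; apply: ord3P.
  + rewrite (_ : (fun x => _) = cst (ctl0 u)); last by apply/funext => x; rewrite row_mxEr mxE.
    case: (split_ordP k) => [l ->|l ->]; rewrite ?augD_l ?augD_r ?row_mxEr mxE /=; exact: is_derive_cst.
  + rewrite (_ : (fun x => _) = cst (enorm (ctlw u))); last by apply/funext => x; rewrite row_mxEr mxE.
    case: (split_ordP k) => [l ->|l ->]; rewrite ?augD_l ?augD_r ?row_mxEr mxE /=; exact: is_derive_cst.
  + rewrite (_ : (fun x => _) = fun x => lext l0 lhat1 (lsubmx x) (ctl0 u) (ctlw u) (ctla u)); last first.
      by apply/funext => x; rewrite row_mxEr mxE.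
    apply: (@is_derive_lsubmx R n 3 (fun x => lext l0 lhat1 x (ctl0 u) (ctlw u) (ctla u))).
    case: (split_ordP k) => [l ->|l ->].
      by rewrite augD_l row_mxEr mxE lev; exact: is_derive_lext.
    by rewrite augD_r mxE rev; exact: is_derive_dir0.
Qed.

End Field.

Import HBNNSimple.

(** * The reference process *)

Section NullSets.
Context {R : realType}.
Notation mu := (@lebesgue_measure R).

(* No measurability is needed on f and g because the integral is a lower integral. *)
Lemma ge0_le_integral_null d (T : measurableType d) (nu : {measure set T -> \bar R})
    (f g : T -> \bar R) (D N : set T) :
  measurable N -> nu N = 0%E -> (forall x, D x -> (0 <= f x)%E) -> (forall x, D x -> (0 <= g x)%E) ->
  (forall x, D x -> ~ N x -> f x = g x) ->
  (\int[nu]_(x in D) f x <= \int[nu]_(x in D) g x)%E.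
Proof.
move=> mN N0 f0 g0 fg.
rewrite (ge0_integralE _ f0) (ge0_integralE _ g0) /=.
apply: ge_ereal_sup => _ [h /= hf <-].
have mNC : measurable (~` N) by exact: measurableC.
pose k := mul_nnsfun h (indic_nnsfun R mNC).
suff -> : sintegral nu h = sintegral nu k.
  apply: ereal_sup_ubound; exists k => //= x.
  set kx := (X in (X%:E <= _)%E). have -> : kx = h x * (x \in ~` N)%:R by rewrite -indicE.
  have [Nx|Nx] := boolP (x \in ~` N); last first.
    rewrite mulr0 /patch; case: ifP => // xD; apply: g0; exact: set_mem.
  rewrite mulr1; apply: le_trans (hf x) _; rewrite /patch; case: ifP => // xD.
  by rewrite fg//; [exact: set_mem|move/set_mem: Nx].
rewrite -!integralT_nnsfun; apply: ae_eq_integral => //.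
- by apply/measurable_EFinP.
- by apply/measurable_EFinP.
exists N; split => //= x /= /not_implyP[_ hx]; apply: contrapT => Nx; apply: hx.
suff -> : mindic R mNC x = 1 by rewrite mulr1.
rewrite -[LHS]/(\1_(~` N) x) indicE.
by rewrite mem_set.
Qed.

(** Positive and negative parts are compared separately by [ge0_le_integral_null], in both
    directions. The lemma moves integrals from the given controls to their cleaned versions. *)
Lemma RInt0_null (h k : R -> R) (N : set R) (t : R) : measurable N -> mu N = 0%E ->
  (forall s, 0 <= s <= t -> ~ N s -> h s = k s) -> RInt0 t h = RInt0 t k.
Proof.
move=> mN N0 hk; rewrite /RInt0 /Rintegral; congr fine.
have key (f g : R -> \bar R) : (forall x : R, `[0, t]%classic x -> (0 <= f x)%E) ->
    (forall x : R, `[0, t]%classic x -> (0 <= g x)%E) ->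
    (forall x : R, `[0, t]%classic x -> ~ N x -> f x = g x) ->
    (\int[mu]_(x in `[0%R, t]%classic) f x = \int[mu]_(x in `[0%R, t]%classic) g x)%E.
  move=> f0 g0 fg; apply/eqP; rewrite eq_le; apply/andP; split.
    exact: (@ge0_le_integral_null _ (measurableTypeR R) mu f g _ N).
  by apply: (@ge0_le_integral_null _ (measurableTypeR R) mu g f _ N) => // x Dx Nx; rewrite fg.
rewrite integralE [RHS]integralE; congr (_ - _)%E; apply: key => // x;
  rewrite /= in_itv /= => xt Nx; by rewrite ?funeposE ?funenegE /= hk.
Qed.

Lemma null_setU (N1 N2 : set R) : measurable N1 -> mu N1 = 0%E -> measurable N2 -> mu N2 = 0%E ->
  measurable (N1 `|` N2) /\ mu (N1 `|` N2) = 0%E.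
Proof.
move=> m1 h1 m2 h2; split; first exact: measurableU.
have h : (mu (N1 `|` N2) <= mu N1 + mu N2)%E by exact: measureU2.
by move: h; rewrite h1 h2 adde0 measure_le0 => /eqP.
Qed.

Lemma null_set_witness a b (N : set R) : a < b -> measurable N -> mu N = 0%E ->
  exists2 t, a <= t <= b & ~ N t.
Proof.
move=> ab mN N0; apply: contrapT => h.
have sub : `[a, b]%classic `<=` N.
  move=> t; rewrite /= in_itv /= => tS; apply: contrapT => Nt; apply: h; by exists t.
have hm : (mu `[a, b]%classic <= mu N)%E by apply: le_measure; rewrite ?inE.
move: hm; rewrite N0 lebesgue_measure_itv /= lte_fin ab -EFinB lee_fin.
by rewrite subr_le0 leNgt ab.
Qed.

Lemma cont_on_measurable (h : R -> R) : cont_on setT h -> measurable_fun setT h.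
Proof.
move=> ch; apply: continuous_measurable_fun => x; apply/cvgrPdist_lt => e e0.
have [d d0 hd] := ch x Logic.I e e0.
apply/nbhs_ballP; exists d => //= y xy; rewrite distrC; apply: hd => //.
by have xy' : `|x - y| < d by []; rewrite distrC.
Qed.

(** For an integrand that is only integrable the primitive is continuous rather than Lipschitz; its
    boundedness comes from compactness of [[0, S]]. *)
Lemma integral_clip_bmeas (h : R -> R) S c : 0 < S -> integrable_on S h ->
  bmeas (fun t => c + RInt0 (clip S t) h).
Proof.
move=> S0 ih; have cJ := @parameterized_integral_continuous R 0 S h (ltW S0) ih.
apply: bmeasD; first exact: bmeas_cst.
split.
  apply: cont_on_measurable.
  apply: (@cont_on_comp R R R R setT `[0, S]%classic (clip S) (fun t => RInt0 t h)).
  - by move=> x _ /=; rewrite in_itv /=; exact: clip_itv (ltW S0).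
  - by move=> x y; exact: clip_lip.
  - exact: within_cont_on.
have [M [_ hM]] := compact_bounded (continuous_compact cJ (@segment_compact _ 0 S)).
exists (`|M| + 1) => t; apply: hM; first by rewrite (le_lt_trans (ler_norm _))// ltrDl.
by exists (clip S t) => //=; rewrite in_itv /=; exact: clip_itv (ltW S0).
Qed.

End NullSets.

Section CleanControl.
Context {R : realType}.
Notation mu := (@lebesgue_measure R).

Lemma ae_onP S (P : R -> Prop) : ae_on S P ->
  exists N : set R, [/\ measurable N, mu N = 0%E & forall t, 0 <= t <= S -> ~ N t -> P t].
Proof.
move=> [N [mN N0 sub]]; exists N; split => // t tS Nt; apply: contrapT => Pt; apply: Nt.
by apply: sub => /= h; apply: Pt; apply: h; rewrite /= in_itv.
Qed.

Lemma null_ae_on S (P : R -> Prop) (N : set R) : measurable N -> mu N = 0%E ->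
  (forall t, 0 <= t <= S -> ~ N t -> P t) -> ae_on S P.
Proof.
move=> mN N0 h; exists N; split => // t /= ht; apply: contrapT => Nt; apply: ht => tS.
by apply: h => //; move: tS; rewrite /= in_itv.
Qed.

(** The constraints hold almost everywhere on [[0, S]], while the perturbation argument asks for
    them at every real time: on the exceptional null set and outside [[0, S]] the control is
    replaced by its value at one good time. *)
Lemma clean_control m q (C : set 'rV[R]_m) (A : set 'rV[R]_q) (S : R) (w0 : R -> R) (w : R -> 'rV[R]_m)
    (al : R -> 'rV[R]_q) : 0 < S ->
  measurable_fun `[0, S]%classic w0 ->
  (forall i, measurable_fun `[0, S]%classic (fun s => w s 0 i)) ->
  (forall i, measurable_fun `[0, S]%classic (fun s => al s 0 i)) ->
  ae_on S (fun s => 0 <= w0 s /\ C (w s) /\ A (al s)) -> canonical_ctrl S w0 w ->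
  exists (N : set R) (u : R -> 'rV[R]_(1 + (m + q))),
    [/\ measurable N, mu N = 0%E, forall t, control_set C A (u t),
     forall j, measurable_fun setT (fun t => u t 0 j) &
     forall t, 0 <= t <= S -> ~ N t -> u t = ctl (w0 t) (w t) (al t)].
Proof.
move=> S0 mw0 mw mal /ae_onP[N1 [mN1 N10 h1]] /ae_onP[N2 [mN2 N20 h2]].
pose N := N1 `|` N2.
have [mN N0] : measurable N /\ mu N = 0%E := null_setU mN1 N10 mN2 N20.
have good t : 0 <= t <= S -> ~ N t -> control_set C A (ctl (w0 t) (w t) (al t)).
  move=> tS Nt; have [] := h1 t tS (fun h => Nt (or_introl h)); move=> w00 [Cw Aa].
  split; last by rewrite ctlaK.
  by rewrite ctl0K ctlwK; split => //; split => //; apply: h2 => // h; apply: Nt; right.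
have [ts tsS Nts] := null_set_witness S0 mN N0.
set us := ctl (w0 ts) (w ts) (al ts).
pose E := `[0, S]%classic `&` ~` N.
have mE : measurable E by apply: measurableI => //; exact: measurableC.
have ES : E `<=` `[0, S]%classic by move=> t [].
exists N, (fun t => if t \in E then ctl (w0 t) (w t) (al t) else us); split => //.
- move=> t; case: ifPn => [/set_mem[tS Nt]|_]; last exact: good.
  by apply: good => //; move: tS; rewrite /= in_itv.
- move=> j.
  have mc : measurable_fun E (fun t => ctl (w0 t) (w t) (al t) 0 j).
    case: (split_ordP j) => [k ->|k ->].
      rewrite (_ : (fun t => _) = w0); first exact: measurable_funS ES mw0.
      by apply/funext => t; rewrite row_mxEl mxE.
    case: (split_ordP k) => [l ->|l ->].
      rewrite (_ : (fun t => _) = fun t => w t 0 l); first exact: measurable_funS ES (mw l).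
      by apply/funext => t; rewrite row_mxEr row_mxEl.
    rewrite (_ : (fun t => _) = fun t => al t 0 l); first exact: measurable_funS ES (mal l).
    by apply/funext => t; rewrite row_mxEr row_mxEr.
  rewrite (_ : (fun t => _) = fun t => if t \in E then ctl (w0 t) (w t) (al t) 0 j else us 0 j); last first.
    by apply/funext => t; case: ifP.
  apply: measurable_fun_if => //.
  + apply: (measurable_fun_bool true).
    by rewrite setTI (_ : _ @^-1` _ = E)//; apply/seteqP; split => t /=; [move/set_mem|move/mem_set].
  + apply: measurable_funS mc => //.
    by move=> t /= [_ /set_mem].
- move=> t tS Nt; rewrite mem_set//; split => //=; by rewrite in_itv.
Qed.

End CleanControl.

Section Reference.
Context {R : realType}.
Notation mu := (@lebesgue_measure R).
Variables (n m q : nat).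
Variables (C : set 'rV[R]_m) (A : set 'rV[R]_q)
  (f : 'rV[R]_n -> 'rV[R]_q -> 'rV[R]_n) (g : 'I_m -> 'rV[R]_n -> 'rV[R]_n)
  (l0 : 'rV[R]_n -> 'rV[R]_q -> R) (lhat1 : 'rV[R]_n -> R -> 'rV[R]_m -> R)
  (DX : 'I_(n + 3) -> 'rV[R]_(n + 3) -> 'rV[R]_(1 + (m + q)) -> 'rV[R]_(n + 3)).
Hypothesis sf : smooth_field (control_set C A) (augX f g l0 lhat1) DX.

Lemma augX_lsubmx (z z' : 'rV[R]_(n + 3)) (u : 'rV[R]_(1 + (m + q))) : lsubmx z = lsubmx z' ->
  augX f g l0 lhat1 z u = augX f g l0 lhat1 z' u.
Proof. by rewrite /augX => ->. Qed.

Lemma augX_ctl (z : 'rV[R]_(n + 3)) w0 w (a : 'rV[R]_q) :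
  augX f g l0 lhat1 z (ctl w0 w a) = row_mx (dyn f g (lsubmx z) w0 w a)
    (row3 w0 (enorm w) (lext l0 lhat1 (lsubmx z) w0 w a)).
Proof. by rewrite /augX ctl0K ctlwK ctlaK. Qed.

Lemma bmeas_field (z : R -> 'rV[R]_(n + 3)) (u : R -> 'rV[R]_(1 + (m + q))) j :
  (forall t, control_set C A (u t)) -> (forall j, measurable_fun setT (fun t => u t 0 j)) ->
  (forall j, bmeas (fun t => z t 0 j)) -> bmeas (fun t => augX f g l0 lhat1 (z t) (u t) 0 j).
Proof.
move=> uU um zm; split; first by apply: (measurable_field sf j uU) => // l; exact: (zm l).1.
have /choice[M hM] l : exists M, forall t, `|z t 0 l| <= M by have [_ [M hM]] := zm l; exists M.
have zr t : `|z t| <= \sum_l `|M l|.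
  apply: norm_rV_le => [|l]; first exact: sumr_ge0.
  rewrite (le_trans (hM l t))// (bigD1 l)//= (le_trans (ler_norm _))// lerDl.
  exact: sumr_ge0.
have [N N0 hN] := field_bounded sf (\sum_l `|M l|); exists N => t.
apply: le_trans (norm_rV_coord _ _) _; exact: (hN _ _ (zr t) (uU t)).1.
Qed.

(** With the cleaned control the augmented integrand is bounded, so the state recomputed from it is
    Lipschitz on the whole line; on [[0, S]] it reproduces the given trajectory and its running
    cost. *)
Lemma reference_trajectory (xc : 'rV[R]_n) (S : R) (w0 : R -> R) (w : R -> 'rV[R]_m)
    (al : R -> 'rV[R]_q) (y0 : R -> R) (y : R -> 'rV[R]_n) (be : R -> R) :
  process f g C A xc S w0 w al y0 y be -> canonical_ctrl S w0 w ->
  exists (N : set R) (u : R -> 'rV[R]_(1 + (m + q))) (z : R -> 'rV[R]_(n + 3)),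
    [/\ measurable N, mu N = 0%E, forall t, control_set C A (u t),
     forall j, measurable_fun setT (fun t => u t 0 j) &
     forall t, 0 <= t <= S -> ~ N t -> u t = ctl (w0 t) (w t) (al t)] /\
    [/\ vblip z, z 0 = row_mx xc 0,
     forall t j, 0 <= t <= S ->
       z t 0 j = z 0 0 j + RInt0 t (fun r => augX f g l0 lhat1 (z r) (u r) 0 j) &
     forall t, 0 <= t <= S -> z t = row_mx (y t) (row3 (y0 t) (be t)
       (RInt0 t (fun s => lext l0 lhat1 (y s) (w0 s) (w s) (al s))))].
Proof.
move=> [S0 [mw0 [mw [mal [ae1 [_ [_ [iw0 [idyn [iw ode]]]]]]]]]] can.
have [N [u [mN N0 uU um uE]]] := clean_control S0 mw0 mw mal ae1 can.
exists N, u.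
have S0' := ltW S0.
(* The field reads only the [y] block, so the integrand can be formed, with zeros in the other
   slots, before the augmented state exists. *)
pose z1 t : 'rV[R]_(n + 3) := row_mx (y (clip S t)) 0.
have z1m j : bmeas (fun t => z1 t 0 j).
  case: (split_ordP j) => [i ->|i ->]; last first.
    rewrite (_ : (fun t => _) = fun=> 0); first exact: bmeas_cst.
    by apply/funext => t; rewrite row_mxEr mxE.
  rewrite (_ : (fun t => _) = fun t => xc 0 i + RInt0 (clip S t)
      (fun t => dyn f g (y t) (w0 t) (w t) (al t) 0 i)); first exact: integral_clip_bmeas.
  apply/funext => t; rewrite row_mxEl; have [_ [-> _]] := ode _ (clip_itv t S0').
  by rewrite !mxE.
have Xm j : bmeas (fun t => augX f g l0 lhat1 (z1 t) (u t) 0 j) by exact: bmeas_field.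
pose z t : 'rV[R]_(n + 3) := row_mx xc 0 + \row_j RInt0 (clip S t) (fun r => augX f g l0 lhat1 (z1 r) (u r) 0 j).
have zE t j : z t 0 j = (row_mx xc 0 : 'rV[R]_(n + 3)) 0 j + RInt0 (clip S t) (fun r => augX f g l0 lhat1 (z1 r) (u r) 0 j).
  by rewrite [LHS]mxE [X in _ + X]mxE.
have clip0 : clip S 0 = 0 by rewrite clip_id// lexx.
have z0 : z 0 = row_mx xc 0 by apply/rowP => j; rewrite zE clip0 RInt0_at0 addr0.
have swap (h : 'rV[R]_(n + 3) -> R) (k : R -> R) t : 0 <= t <= S ->
    (forall s, h (row_mx (dyn f g (y s) (w0 s) (w s) (al s))
      (row3 (w0 s) (enorm (w s)) (lext l0 lhat1 (y s) (w0 s) (w s) (al s)))) = k s) ->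
    RInt0 t (fun r => h (augX f g l0 lhat1 (z1 r) (u r))) = RInt0 t k.
  move=> /andP[t0 tS] hk; apply: (RInt0_null mN N0) => s /andP[s0 st] Ns.
  have sS : 0 <= s <= S by rewrite s0 (le_trans st).
  by rewrite (uE _ sS Ns) augX_ctl /z1 row_mxKl (clip_id sS).
have zT t : 0 <= t <= S -> z t = row_mx (y t) (row3 (y0 t) (be t)
       (RInt0 t (fun s => lext l0 lhat1 (y s) (w0 s) (w s) (al s)))).
  move=> tS; have [y0E [yE bE]] := ode t tS.
  apply/rowP => j; rewrite zE (clip_id tS); case: (split_ordP j) => [i ->|i ->].
    rewrite !row_mxEl yE !mxE; congr (_ + _).
    by apply: (swap (fun v => v 0 (lshift 3 i))) => // s; rewrite row_mxEl.
  rewrite !row_mxEr mxE add0r; move: i; apply: ord3P; rewrite mxE /=.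
  + by rewrite y0E; apply: (swap (fun v => v 0 (rshift n j0))) => // s; rewrite row_mxEr mxE.
  + by rewrite bE; apply: (swap (fun v => v 0 (rshift n j1))) => // s; rewrite row_mxEr mxE.
  + by apply: (swap (fun v => v 0 (rshift n j2))) => // s; rewrite row_mxEr mxE.
exists z; split; split => //.
- apply: coord_vblip => j; rewrite (_ : (fun t => _) = fun t => (row_mx xc 0 : 'rV[R]_(n + 3)) 0 j +
    RInt0 (clip S t) (fun r => augX f g l0 lhat1 (z1 r) (u r) 0 j)); last by apply/funext => t.
  exact: blip_RInt0.
- move=> t j tS; rewrite z0 zE (clip_id tS); congr (_ + _); apply: RInt0_eq => r /andP[r0 rt].
  have rS : 0 <= r <= S by rewrite r0 (le_trans rt)//; case/andP: tS.
  by congr (fun_of_matrix _ 0 j); apply: augX_lsubmx; rewrite zT// /z1 !row_mxKl clip_id.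
Qed.

End Reference.

(** * Perturbed processes and local minimality *)

Section Recession.
Context {R : realType}.

(** In the limit defining [lh], replacing [r] by [c * r] and [w] by [c *: w] multiplies the
    expression by [c]. *)
Lemma recession_homogeneous (m : nat) (l : 'rV[R]_m -> R) (lh : R -> 'rV[R]_m -> R)
    (C : set 'rV[R]_m) (c w0 : R) w : is_cone C ->
  (forall (w0 : R) w, 0 <= w0 -> C w ->
    (fun r : R => r * l (r^-1 *: w)) @ within (fun r : R => 0 < r) w0^' --> lh w0 w) ->
  0 < c -> 0 <= w0 -> C w -> lh (c * w0) (c *: w) = c * lh w0 w.
Proof.
move=> coneC hl c0 w00 Cw.
have lim w0' w' e : 0 <= w0' -> C w' -> 0 < e -> exists2 d : R, 0 < d &
    forall r, w0' < r -> r < w0' + d -> `|lh w0' w' - r * l (r^-1 *: w')| < e.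
  move=> w0'0 Cw' e0; have := hl w0' w' w0'0 Cw'; move=> /cvgrPdist_lt /(_ e e0).
  move=> /nbhs_ballP[d d0 hd]; exists d => // r r1 r2; apply: (hd r) => //.
  - by rewrite /ball /= ltr_distlC; apply/andP; split; [rewrite ltrBlDr (lt_trans r1)// ltrDl|].
  - by rewrite gt_eqF.
  - exact: le_lt_trans r1.
apply/eqP; rewrite -subr_eq0 -normr_le0; apply/ler_addgt0Pr => e e0; rewrite add0r.
have e'0 : 0 < e / (1 + c) by rewrite divr_gt0// ltr_wpDr// ltW.
have [d1 d10 h1] := lim _ _ _ w00 Cw e'0.
have [d2 d20 h2] := lim (c * w0) (c *: w) _ (mulr_ge0 (ltW c0) w00) (coneC _ _ c0 Cw) e'0.
(* Half of the minimum of both radii: [w0 + d] and [c * (w0 + d)] are then admissible in their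
   respective limits, and [0 < d] keeps them off the punctured base points. *)
pose d := Num.min d1 (d2 / c) / 2.
have m0 : 0 < Num.min d1 (d2 / c) by rewrite lt_min d10 divr_gt0.
have dm : d < Num.min d1 (d2 / c) by rewrite /d ltr_pdivrMr// ltr_pMr// ltr1n.
have d0 : 0 < d by rewrite /d divr_gt0.
have [dd1 dd2] : d < d1 /\ d < d2 / c by move: dm; rewrite lt_min => /andP.
have k1 := h1 (w0 + d) (ltac:(by rewrite ltrDl)) (ltac:(by rewrite ltrD2l)).
have k2 := h2 (c * (w0 + d)) (ltac:(by rewrite ltr_pM2l// ltrDl))
  (ltac:(by rewrite mulrDr ltrD2l mulrC -ltr_pdivlMr)).
have wd0 : 0 < w0 + d by rewrite ltr_wpDl.
have E : (c * (w0 + d))^-1 *: (c *: w) = (w0 + d)^-1 *: w.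
  by rewrite scalerA; congr (_ *: _); field; rewrite !gt_eqF.
move: k2; rewrite E => k2.
set F := l _ in k1 k2.
have -> : lh (c * w0) (c *: w) - c * lh w0 w = (lh (c * w0) (c *: w) - c * (w0 + d) * F) -
  c * (lh w0 w - (w0 + d) * F) by ring.
rewrite (le_trans (ler_normB _ _))//.
have -> : e = e / (1 + c) + c * (e / (1 + c)) by field; rewrite gt_eqF// ltr_wpDr// ltW.
by rewrite lerD ?(ltW k2)// normrM (gtr0_norm c0) ler_pM2l// ltW.
Qed.

End Recession.

Section WeightedProcess.
Context {R : realType}.
Variables (n m q : nat).
Variables (C : set 'rV[R]_m) (A : set 'rV[R]_q)
  (f : 'rV[R]_n -> 'rV[R]_q -> 'rV[R]_n) (g : 'I_m -> 'rV[R]_n -> 'rV[R]_n)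
  (l0 : 'rV[R]_n -> 'rV[R]_q -> R) (lhat1 : 'rV[R]_n -> R -> 'rV[R]_m -> R)
  (DX : 'I_(n + 3) -> 'rV[R]_(n + 3) -> 'rV[R]_(1 + (m + q)) -> 'rV[R]_(n + 3)).
Hypothesis sf : smooth_field (control_set C A) (augX f g l0 lhat1) DX.
Hypotheses (hA : compact A) (coneC : is_cone C).
Hypothesis hom : forall x c w0 w, 0 < c -> 0 <= w0 -> C w ->
  lhat1 x (c * w0) (c *: w) = c * lhat1 x w0 w.

Lemma dyn_scale x c w0 w a : dyn f g x (c * w0) (c *: w) a = c *: dyn f g x w0 w a.
Proof.
rewrite /dyn scalerDr scalerA scaler_sumr; congr (_ + _).
by apply: eq_bigr => i _; rewrite mxE scalerA.
Qed.

Lemma lext_scale x c w0 w a : 0 < c -> 0 <= w0 -> C w ->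
  lext l0 lhat1 x (c * w0) (c *: w) a = c * lext l0 lhat1 x w0 w a.
Proof. by move=> c0 h0 hw; rewrite /lext hom//; ring. Qed.

(** A normalized control multiplied by the speed is an admissible space-time control because [C] is
    a cone, and homogeneity turns the weighted augmented equation into the dynamics and the cost.
    Its magnitude is the speed itself, so [c] is the lower bound required of a process. *)
Lemma weighted_process (xc : 'rV[R]_n) (Psi : R * 'rV[R]_n -> R) (T : R) (u : R -> 'rV[R]_(1 + (m + q))) (w : R -> R) (z : R -> 'rV[R]_(n + 3)) : 0 < T ->
  (forall t, control_set C A (u t)) -> (forall j, measurable_fun setT (fun t => u t 0 j)) ->
  bmeas w -> (exists2 c, 0 < c & forall t, c <= w t) -> vblip z ->
  (forall t j, 0 <= t <= T -> z t 0 j = (row_mx xc 0 : 'rV[R]_(n + 3)) 0 j +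
     RInt0 t (fun r => w r * augX f g l0 lhat1 (z r) (u r) 0 j)) ->
  process f g C A xc T (fun t => w t * ctl0 (u t)) (fun t => w t *: ctlw (u t)) (fun t => ctla (u t))
    (fun t => z t 0 (rshift n j0)) (fun t => lsubmx (z t)) (fun t => z t 0 (rshift n j1)) /\
  cost l0 lhat1 Psi T (fun t => w t * ctl0 (u t)) (fun t => w t *: ctlw (u t)) (fun t => ctla (u t))
    (fun t => z t 0 (rshift n j0)) (fun t => lsubmx (z t)) =
  Psi (z T 0 (rshift n j0), lsubmx (z T)) + z T 0 (rshift n j2).
Proof.
move=> T0 uU um bw [c c0 cw] vz ode.
have w_gt0 t : 0 < w t by exact: lt_le_trans (cw t).
have Xm j : bmeas (fun r => w r * augX f g l0 lhat1 (z r) (u r) 0 j).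
  by apply: bmeasM => //; apply: (bmeas_field sf) => // l; exact: vblip_bmeas.
have E0 : (fun t => w t * ctl0 (u t)) = fun t => w t * augX f g l0 lhat1 (z t) (u t) 0 (rshift n j0).
  by apply/funext => t; rewrite row_mxEr mxE.
have E1 : (fun t => enorm (w t *: ctlw (u t))) = fun t => w t * augX f g l0 lhat1 (z t) (u t) 0 (rshift n j1).
  by apply/funext => t; rewrite row_mxEr mxE enormZ// ltW.
have E2 : (fun t => lext l0 lhat1 (lsubmx (z t)) (w t * ctl0 (u t)) (w t *: ctlw (u t)) (ctla (u t))) =
    fun t => w t * augX f g l0 lhat1 (z t) (u t) 0 (rshift n j2).
  apply/funext => t; rewrite row_mxEr mxE lext_scale//; first exact: (uU t).1.1.
  exact: (uU t).1.2.1.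
have E3 i : (fun t => dyn f g (lsubmx (z t)) (w t * ctl0 (u t)) (w t *: ctlw (u t)) (ctla (u t)) 0 i) =
    fun t => w t * augX f g l0 lhat1 (z t) (u t) 0 (lshift 3 i).
  by apply/funext => t; rewrite row_mxEl dyn_scale mxE.
have ae (P : R -> Prop) : (forall t, P t) -> ae_on T P.
  by move=> h; apply: (null_ae_on measurable0) => //; exact: measure0.
have mS (h : R -> R) : measurable_fun setT h -> measurable_fun `[0, T]%classic h.
  exact: measurable_funS.
split; last first.
  by rewrite /cost E2 (ode T (rshift n j2)) ?(ltW T0) ?lexx// row_mxEr mxE add0r.
split => //; split.
  by rewrite E0; exact: mS (Xm _).1.
split.
  move=> i; apply: mS.
  rewrite (_ : (fun s => _) = fun s => w s * u s 0 (rshift 1 (lshift q i))); last first.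
    by apply/funext => t; rewrite !mxE.
  by apply: measurable_funM => //; exact: bw.1.
split.
  move=> i; apply: mS.
  rewrite (_ : (fun s => _) = fun s => u s 0 (rshift 1 (rshift m i)))//.
  by apply/funext => t; rewrite !mxE.
split.
  apply: ae => t; have [[/= u0 [uC _]] uA] := uU t; split; first by rewrite mulr_ge0// ltW.
  by split => //; exact: coneC.
split.
  have [W hW] := bw.2; have [MA [_ hMA]] := compact_bounded hA.
  exists (W + q%:R * (`|MA| + 1)); apply: ae => t; have [[/= u0 [uC u1]] uA] := uU t.
  rewrite lerD//.
    rewrite (enormZ _ (ltW (w_gt0 t))) (ger0_norm (mulr_ge0 (ltW (w_gt0 t)) u0)).
    rewrite -[leLHS]mulrDr u1 mulr1.
    exact: le_trans (ler_norm _) (hW t).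
  rewrite (le_trans (enorm_le _))// ler_wpM2l//; apply: hMA => //.
  by rewrite (le_lt_trans (ler_norm _))// ltrDl.
split.
  exists c => //; apply: ae => t; have [[/= u0 [uC u1]] uA] := uU t.
  by rewrite enormZ ?(ltW (w_gt0 t))// -[leRHS]mulrDr u1 mulr1.
split; first by rewrite E0; exact: bmeas_integrable.
split; first by move=> j; rewrite E3; exact: bmeas_integrable.
split; first by rewrite E1; exact: bmeas_integrable.
move=> s sT; split; last split.
- by rewrite ode// E0 row_mxEr mxE add0r.
- by apply/rowP => i; rewrite !mxE ode// row_mxEl E3.
- by rewrite ode// E1 row_mxEr mxE add0r.
Qed.

End WeightedProcess.

Section LinearMatrix.
Context {R : realType}.

Lemma linear_mulmx n k (D : 'rV[R]_n -> 'rV[R]_k) (h : 'rV[R]_n) :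
  (forall a u v, D (a *: u + v) = a *: D u + D v) -> h *m (\matrix_i D (evec i)) = D h.
Proof.
move=> Dlin; have D0 : D 0 = 0 by have := Dlin (-1) 0 0; rewrite !scaler0 addr0 scaleN1r addNr.
rewrite [in RHS](row_sum_delta h) mulmx_sum_row.
have Ds (s : seq 'I_n) (a : 'I_n -> R) (v : 'I_n -> 'rV[R]_n) :
    D (\sum_(i <- s) a i *: v i) = \sum_(i <- s) a i *: D (v i).
  by elim: s => [|i s IH]; rewrite ?big_nil// !big_cons Dlin IH.
by rewrite Ds; apply: eq_bigr => i _; rewrite rowK.
Qed.

Lemma diff_near (V : normedModType R) (h : V -> R) (x : V) e : differentiable h x -> 0 < e ->
  exists2 d : R, 0 < d & forall y, `|y - x| < d -> `|h y - h x - 'd h x (y - x)| <= e * `|y - x|.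
Proof.
move=> /diff_locallyP[_ /eqaddoP dh] e0; have := dh e e0.
move=> /nbhs_ballP[d d0 hd]; exists d => // y yx.
have := hd (y - x); rewrite -ball_normE /= sub0r normrN => /(_ yx).
by rewrite /= !fctE /= subrK opprD addrA.
Qed.

Lemma cont_on_post (V W W' : normedModType R) (D : set V) (h : V -> W) (p : W -> W') :
  (forall x y, `|p x - p y| <= `|x - y|) -> cont_on D h -> cont_on D (fun x => p (h x)).
Proof.
move=> pl ch x Dx e e0; have [d d0 hd] := ch x Dx e e0; exists d => // y Dy yx.
by apply: le_lt_trans (pl _ _) _; exact: hd.
Qed.

End LinearMatrix.

(** * End map, chart of the target and slack variables *)

Section Chart.
Context {R : realType}.
Variables (n M : nat).
Variables (C V : set 'rV[R]_M) (F L : 'rV[R]_M -> R * 'rV[R]_n).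
Hypothesis Llin : forall (a : R) u v, L (a *: u + v) = a *: L u + L v.
Variables (b c : R) (K : \bar R) (Psi : R * 'rV[R]_n -> R) (p : R * 'rV[R]_n).

(* The coordinates of the slack r absorb the inequalities beta(S) <= K and cost < reference cost;
   beta may increase only if the constraint beta(S) <= K is inactive. *)
Definition chart_cone : set 'rV[R]_(M + 3) := [set v | C (lsubmx v) /\
  [/\ 0 <= v 0 (rshift M j0), 0 <= v 0 (rshift M j1), 0 <= v 0 (rshift M j2) &
      v 0 (rshift M j1) = 0 \/ (b%:E < K)%E]].
Definition chart_dom : set 'rV[R]_(M + 3) := [set v | V (lsubmx v)].
Definition chart (v : 'rV[R]_(M + 3)) : 'rV[R]_(n + 3) := row_mx (F (lsubmx v)).2
  (row3 (F (lsubmx v)).1 (b - v 0 (rshift M j0) + v 0 (rshift M j1)) (c - v 0 (rshift M j2))).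
Definition chart_lin (v : 'rV[R]_(M + 3)) : 'rV[R]_(n + 3) := row_mx (L (lsubmx v)).2
  (row3 (L (lsubmx v)).1 (- v 0 (rshift M j0) + v 0 (rshift M j1)) (- v 0 (rshift M j2))).
(** The distinguished direction of the alternative: a unit of cost slack and nothing else. *)
Definition descent : 'rV[R]_(M + 3) := row_mx 0 (row3 0 0 1).

Definition endmap (z : 'rV[R]_(n + 3)) : 'rV[R]_(n + 3) := row_mx (lsubmx z)
  (row3 (z 0 (rshift n j0)) (z 0 (rshift n j1)) (Psi (z 0 (rshift n j0), lsubmx z) + z 0 (rshift n j2))).
Definition endmap_lin (h : 'rV[R]_(n + 3)) : 'rV[R]_(n + 3) := row_mx (lsubmx h)
  (row3 (h 0 (rshift n j0)) (h 0 (rshift n j1)) ('d Psi p (h 0 (rshift n j0), lsubmx h) + h 0 (rshift n j2))).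

Let coordB k (x y : 'rV[R]_k) j : (x - y) 0 j = x 0 j - y 0 j.
Proof. by rewrite !mxE. Qed.

Let coordP k a (x y : 'rV[R]_k) j : (a *: x + y) 0 j = a * x 0 j + y 0 j.
Proof. by rewrite !mxE. Qed.

Lemma row_mx3P (x : 'rV[R]_(n + 3)) y0 y1 y2 y : lsubmx x = y -> x 0 (rshift n j0) = y0 ->
  x 0 (rshift n j1) = y1 -> x 0 (rshift n j2) = y2 -> x = row_mx y (row3 y0 y1 y2).
Proof.
move=> <- <- <- <-; apply/rowP => j; case: (split_ordP j) => [i ->|i ->].
  by rewrite row_mxEl mxE.
by rewrite row_mxEr; move: i; apply: ord3P; rewrite mxE.
Qed.

Lemma norm_row_mx3 (y : 'rV[R]_n) a0 a1 a2 e : 0 <= e -> `|y| <= e -> `|a0| <= e -> `|a1| <= e ->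
  `|a2| <= e -> `|row_mx y (row3 a0 a1 a2)| <= e.
Proof.
move=> e0 hy h0 h1 h2; apply: norm_rV_le => // j; case: (split_ordP j) => [i ->|i ->].
  by rewrite row_mxEl (le_trans (norm_rV_coord _ _)).
by rewrite row_mxEr; move: i; apply: ord3P; rewrite mxE.
Qed.

Lemma chart_coneD x y : convex_cone C -> chart_cone x -> chart_cone y -> chart_cone (x + y).
Proof.
move=> [Cc Cx] [x1 [x2 x3 x4 x5]] [y1 [y2 y3 y4 y5]]; split.
  (* A sum is twice a midpoint, hence lies in [C] by convexity and homogeneity. *)
  have -> : lsubmx (x + y) = 2 *: (2^-1 *: lsubmx x + (1 - 2^-1) *: lsubmx y).
    have -> : 1 - 2^-1 = 2^-1 :> R by lra.
    by rewrite scalerDr !scalerA divff// !scale1r; apply/rowP => i; rewrite !mxE.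
  by apply: Cc => //; apply: Cx => //; apply/andP; split; lra.
rewrite !mxE; split; try exact: addr_ge0.
by case: x5 => [->|]; case: y5 => [->|]; rewrite ?addr0; auto.
Qed.

Lemma chart_coneZ a x : convex_cone C -> 0 < a -> chart_cone x -> chart_cone (a *: x).
Proof.
move=> [Cc Cx] a0 [x1 [x2 x3 x4 x5]]; split.
  rewrite (_ : lsubmx (a *: x) = a *: lsubmx x); first exact: Cc.
  by apply/rowP => i; rewrite !mxE.
rewrite !mxE; split; try by apply: mulr_ge0 => //; exact: ltW.
by case: x5 => [->|]; rewrite ?mulr0; auto.
Qed.

Lemma chart_cone_ge0 (x1 : 'rV[R]_M) r0 r1 r2 : C x1 -> 0 <= r0 -> 0 <= r1 -> 0 <= r2 ->
  r1 = 0 \/ (b%:E < K)%E -> chart_cone (row_mx x1 (row3 r0 r1 r2)).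
Proof.
by move=> Cx h0 h1 h2 h; split; rewrite ?row_mxKl// !row_mxEr !mxE.
Qed.

Lemma chart_cont : cont_on (V `&` C) F -> cont_on (chart_dom `&` chart_cone) chart.
Proof.
move=> cF; have cF' : cont_on (chart_dom `&` chart_cone) (fun v => F (lsubmx v)).
  apply: (cont_on_comp (p := fun v : 'rV[R]_(M + 3) => lsubmx v) _ _ cF).
    by move=> v [Vv [Cv _]].
  by move=> x y; rewrite lsubmxB norm_lsubmx.
have cc j : cont_on (chart_dom `&` chart_cone) (fun v => v 0 j).
  by apply: continuous_cont_on; exact: coord_continuous.
have cN h : cont_on (chart_dom `&` chart_cone) h -> cont_on (chart_dom `&` chart_cone) (fun v => - h v : R).
  by apply: (@cont_on_post _ _ R R) => x y; rewrite -opprD normrN.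
apply: cont_on_rV => j; case: (split_ordP j) => [i ->|i ->].
  rewrite (_ : (fun v => _) = fun v => (F (lsubmx v)).2 0 i); last by apply/funext => v; rewrite row_mxEl.
  apply: cont_on_coord; apply: (cont_on_post (p := snd)) cF' => x y.
  by rewrite [leRHS]prod_normE le_max lexx orbT.
move: i; apply: ord3P.
- rewrite (_ : (fun v => _) = fun v => (F (lsubmx v)).1); last by apply/funext => v; rewrite row_mxEr mxE.
  by apply: (cont_on_post (p := fst)) cF' => x y; rewrite [leRHS]prod_normE le_max lexx.
- rewrite (_ : (fun v => _) = fun v : 'rV[R]_(M + 3) => b + - v 0 (rshift M j0) + v 0 (rshift M j1)); last first.
    by apply/funext => v; rewrite row_mxEr mxE.
  by apply: cont_onD => //; apply: cont_onD; [exact: cont_on_cst|exact: cN].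
- rewrite (_ : (fun v => _) = fun v : 'rV[R]_(M + 3) => c + - v 0 (rshift M j2)); last first.
    by apply/funext => v; rewrite row_mxEr mxE.
  by apply: cont_onD; [exact: cont_on_cst|exact: cN].
Qed.

(** The slacks enter affinely, so the whole error is that of [F]. *)
Lemma chart_approx e : 0 < e ->
  (forall eps : R, 0 < eps -> exists2 d : R, 0 < d &
       forall v, (V `&` C) v -> `|v| < d -> `|F v - F 0 - L v| <= eps * `|v|) ->
  exists2 d, 0 < d & forall v, chart_dom v -> chart_cone v -> `|v| < d ->
    `|chart v - chart 0 - chart_lin v| <= e * `|v|.
Proof.
move=> e0 /(_ e e0)[d d0 hd]; exists d => // v Vv [Cv _] vd.
have vl : `|lsubmx v| <= `|v| := norm_lsubmx v.
have h : `|F (lsubmx v) - F 0 - L (lsubmx v)| <= e * `|v|.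
  by apply: le_trans (hd _ (conj Vv Cv) (le_lt_trans vl vd)) _; rewrite ler_pM2l.
have ev : 0 <= e * `|v| by rewrite mulr_ge0// ltW.
have l0 : lsubmx (0 : 'rV[R]_(M + 3)) = 0 by apply/rowP => i; rewrite !mxE.
move: h; rewrite [leLHS]prod_normE /= ge_max => /andP[h1 h2].
rewrite (@row_mx3P (_ - _ - _) ((F (lsubmx v)).1 - (F 0).1 - (L (lsubmx v)).1) 0 0
   ((F (lsubmx v)).2 - (F 0).2 - (L (lsubmx v)).2)).
- by apply: norm_row_mx3 => //; rewrite normr0.
- by rewrite -!lsubmxB !row_mxKl l0.
- by rewrite !coordB !row_mxEr !mxE l0.
- by rewrite !coordB !row_mxEr !mxE /=; ring.
- by rewrite !coordB !row_mxEr !mxE /=; ring.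
Qed.

Lemma chart_lin_linear a u v : chart_lin (a *: u + v) = a *: chart_lin u + chart_lin v.
Proof.
have E : lsubmx (a *: u + v) = a *: lsubmx u + lsubmx v by apply/rowP => i; rewrite !mxE.
apply: esym; apply: row_mx3P; rewrite /chart_lin ?E ?Llin /=.
- by rewrite (_ : lsubmx (a *: row_mx _ _ + _) = a *: (L (lsubmx u)).2 + (L (lsubmx v)).2)//;
    apply/rowP => i; rewrite mxE [LHS]mxE [X in X + _ = _]mxE !row_mxEl !mxE.
- by rewrite coordP !row_mxEr !mxE.
- by rewrite coordP !row_mxEr !mxE /=; ring.
- by rewrite coordP !row_mxEr !mxE /=; ring.
Qed.

Hypothesis dPsi : forall z, differentiable Psi z.

Lemma endmap_lin_linear a u v : endmap_lin (a *: u + v) = a *: endmap_lin u + endmap_lin v.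
Proof.
have E : lsubmx (a *: u + v) = a *: lsubmx u + lsubmx v by apply/rowP => i; rewrite !mxE.
apply: esym; apply: row_mx3P; rewrite /endmap_lin ?E /=.
- by rewrite (_ : lsubmx (a *: row_mx _ _ + _) = a *: lsubmx u + lsubmx v)//;
    apply/rowP => i; rewrite mxE [LHS]mxE [X in X + _ = _]mxE !row_mxEl !mxE.
- by rewrite coordP !row_mxEr !mxE.
- by rewrite coordP !row_mxEr !mxE.
- rewrite coordP !row_mxEr !mxE.
  have -> : (a * u 0 (rshift n j0) + v 0 (rshift n j0), a *: lsubmx u + lsubmx v) =
    a *: (u 0 (rshift n j0), lsubmx u) + (v 0 (rshift n j0), lsubmx v) by [].
  by rewrite linearP /= -[_ *: _]/(_ * _); ring.
Qed.

Lemma endpair_lip (x y : 'rV[R]_(n + 3)) :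
  `|(x 0 (rshift n j0), lsubmx x) - (y 0 (rshift n j0), lsubmx y)| <= `|x - y|.
Proof.
rewrite [leLHS]prod_normE /= ge_max lsubmxB norm_lsubmx andbT.
by have := norm_rV_coord (x - y) (rshift n j0); rewrite !mxE.
Qed.

Lemma endmap_cont : cont_on setT endmap.
Proof.
have cc j : cont_on setT (fun v : 'rV[R]_(n + 3) => v 0 j).
  by apply: continuous_cont_on; exact: coord_continuous.
apply: cont_on_rV => j; case: (split_ordP j) => [i ->|i ->].
  rewrite (_ : (fun v => _) = fun v : 'rV[R]_(n + 3) => v 0 (lshift 3 i))//.
  by apply/funext => v; rewrite row_mxEl mxE.
move: i; apply: ord3P.
- by rewrite (_ : (fun v => _) = fun v : 'rV[R]_(n + 3) => v 0 (rshift n j0))//; apply/funext => v; rewrite row_mxEr mxE.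
- by rewrite (_ : (fun v => _) = fun v : 'rV[R]_(n + 3) => v 0 (rshift n j1))//; apply/funext => v; rewrite row_mxEr mxE.
- rewrite (_ : (fun v => _) = fun v : 'rV[R]_(n + 3) => Psi (v 0 (rshift n j0), lsubmx v) + v 0 (rshift n j2)).
    apply: cont_onD => //.
    apply: (cont_on_comp (p := fun v : 'rV[R]_(n + 3) => (v 0 (rshift n j0), lsubmx v)) (D' := setT)) => //.
      exact: endpair_lip.
    by apply: continuous_cont_on => x; exact: differentiable_continuous.
  by apply/funext => v; rewrite row_mxEr mxE.
Qed.

(** Only the cost slot is nonlinear, and its error is that of [Psi]. *)
Lemma endmap_approx (zs : 'rV[R]_(n + 3)) e : p = (zs 0 (rshift n j0), lsubmx zs) -> 0 < e ->
  exists2 d : R, 0 < d & forall z, `|z - zs| < d ->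
  `|endmap z - endmap zs - (z - zs) *m (\matrix_i endmap_lin (evec i))| <= e * `|z - zs|.
Proof.
move=> pE e0; have [d d0 hd] := diff_near (@dPsi p) e0; exists d => // z zd.
rewrite linear_mulmx; last exact: endmap_lin_linear.
have le := endpair_lip z zs; rewrite -pE in le.
have h := hd _ (le_lt_trans le zd).
have ez : 0 <= e * `|z - zs| by rewrite mulr_ge0// ltW.
rewrite (@row_mx3P (_ - _ - _) 0 0 (Psi (z 0 (rshift n j0), lsubmx z) - Psi p -
   'd Psi p ((z 0 (rshift n j0), lsubmx z) - p)) 0).
- apply: norm_row_mx3; rewrite ?normr0// (le_trans h)//.
  by rewrite ler_pM2l.
- by rewrite -!lsubmxB !row_mxKl -lsubmxB subrr.
- by rewrite !coordB !row_mxEr !mxE subrr.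
- by rewrite !coordB !row_mxEr !mxE subrr.
- rewrite !coordB !row_mxEr !mxE /= -pE.
  have -> : ((z 0 (rshift n j0), lsubmx z) - p) = (z 0 (rshift n j0) - zs 0 (rshift n j0), lsubmx (z - zs)).
    by rewrite pE -lsubmxB.
  by ring.
Qed.

End Chart.

(** * Local minimality excludes perturbations *)

Section Minimizer.
Context {R : realType}.
Variables (n m q : nat).
Variables (C : set 'rV[R]_m) (A : set 'rV[R]_q)
  (f : 'rV[R]_n -> 'rV[R]_q -> 'rV[R]_n) (g : 'I_m -> 'rV[R]_n -> 'rV[R]_n)
  (l0 : 'rV[R]_n -> 'rV[R]_q -> R) (lhat1 : 'rV[R]_n -> R -> 'rV[R]_m -> R)
  (DX : 'I_(n + 3) -> 'rV[R]_(n + 3) -> 'rV[R]_(1 + (m + q)) -> 'rV[R]_(n + 3)).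
Hypothesis sf : smooth_field (control_set C A) (augX f g l0 lhat1) DX.
Hypotheses (hA : compact A) (coneC : is_cone C).
Hypothesis hom : forall x c w0 w, 0 < c -> 0 <= w0 -> C w ->
  lhat1 x (c * w0) (c *: w) = c * lhat1 x w0 w.
Variable (Psi : R * 'rV[R]_n -> R).
Hypothesis dPsi : forall z, differentiable Psi z.
Variables (T : set (R * 'rV[R]_n)) (K : \bar R) (xc : 'rV[R]_n).
Variables (Sb : R) (w0b : R -> R) (wb : R -> 'rV[R]_m) (alb : R -> 'rV[R]_q)
  (y0b : R -> R) (yb : R -> 'rV[R]_n) (beb : R -> R).
Hypothesis hmin : local_minimizer f g l0 lhat1 Psi C A xc T K Sb w0b wb alb y0b yb beb.
Variables (ub : R -> 'rV[R]_(1 + (m + q))) (zb : R -> 'rV[R]_(n + 3)).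
Hypotheses (ubU : forall t, control_set C A (ub t))
  (ubm : forall j, measurable_fun setT (fun t => ub t 0 j))
  (vzb : vblip zb) (zb0 : zb 0 = row_mx xc 0)
  (zbode : forall t j, 0 <= t <= Sb ->
     zb t 0 j = zb 0 0 j + RInt0 t (fun r => augX f g l0 lhat1 (zb r) (ub r) 0 j))
  (zbE : forall t, 0 <= t <= Sb -> zb t = row_mx (yb t) (row3 (y0b t) (beb t)
       (RInt0 t (fun s => lext l0 lhat1 (yb s) (w0b s) (wb s) (alb s))))).
Variables (M : nat) (B V : set 'rV[R]_M) (F L : 'rV[R]_M -> R * 'rV[R]_n).
Hypotheses (FT : forall v, (V `&` B) v -> T (F v)).

Let costb := cost l0 lhat1 Psi Sb w0b wb alb y0b yb.

Let S0 : 0 < Sb. Proof. by case: hmin => [[[]]]. Qed.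

Let zcoord t : 0 <= t <= Sb -> [/\ lsubmx (zb t) = yb t, zb t 0 (rshift n j0) = y0b t &
  zb t 0 (rshift n j1) = beb t].
Proof. by move=> tS; rewrite zbE// row_mxKl !row_mxEr !mxE. Qed.

(** A Euclidean norm of [n + 2] coordinates bounded by [d] is at most [(n + 2) * d]. As [Sb <= S],
    the times at which the two extensions are read are related by [clip Sb]. *)
Lemma zdist_le S (z : R -> 'rV[R]_(n + 3)) d s : Sb <= S -> 0 <= s ->
  (forall t, 0 <= t <= S -> `|z t - zb (clip Sb t)| <= d) ->
  zdist S (fun t => z t 0 (rshift n j0)) (fun t => lsubmx (z t)) (fun t => z t 0 (rshift n j1))
    Sb y0b yb beb s <= n.+2%:R * d.
Proof.
move=> SS s0 hd; rewrite /zdist /=.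
set t := Num.min s S; set tb := Num.min s Sb.
have tS : 0 <= t <= S by rewrite /t le_min s0 ge_min lexx orbT (le_trans (ltW S0) SS).
have tbS : 0 <= tb <= Sb by rewrite /tb le_min s0 ge_min lexx orbT (ltW S0).
have ctb : clip Sb t = tb.
  rewrite /clip /t -minA (min_r SS); apply: max_r; by case/andP: tbS.
have [<- <- <-] := zcoord tbS.
have := hd t tS; rewrite ctb => h; have d0 : 0 <= d by exact: le_trans h.
have hj j : (z t 0 j - zb tb 0 j) ^+ 2 <= d ^+ 2.
  rewrite -real_normK ?num_real// lerXn2r ?nnegrE// (le_trans _ h)//.
  by have := norm_rV_coord (z t - zb tb) j; rewrite !mxE.
have nd : 0 <= n.+2%:R * d by exact: mulr_ge0.
rewrite -[leRHS]ger0_norm// -sqrtr_sqr ler_wsqrtr//.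
have -> : (n.+2%:R * d) ^+ 2 = n.+2%:R * (n.+2%:R * d ^+ 2) by ring.
have h1 : dotv (lsubmx (z t) - lsubmx (zb tb)) (lsubmx (z t) - lsubmx (zb tb)) <= n%:R * d ^+ 2.
  rewrite /dotv (_ : n%:R * _ = \sum_(i < n) d ^+ 2); last by rewrite sumr_const card_ord mulr_natl.
  by apply: ler_sum => i _; rewrite -expr2 !mxE; exact: hj.
have h0 := hj (rshift n j0); have h2 := hj (rshift n j1).
have e0 : 0 <= n.+2%:R * d ^+ 2 by rewrite mulr_ge0// sqr_ge0.
apply: (@le_trans _ _ (n.+2%:R * d ^+ 2)).
  have -> : n.+2%:R * d ^+ 2 = d ^+ 2 + n%:R * d ^+ 2 + d ^+ 2 by rewrite -addn2 natrD; ring.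
  by rewrite !lerD.
by rewrite ler_peMl// ler1n.
Qed.

(** The competitor is feasible, and its cost is the reference cost minus the cost slack of [v],
    which is at least [kappa], hence positive. *)
Lemma not_perturbed : ~ (forall delta, 0 < delta -> exists S u w z v v' kappa,
  perturbed (control_set C A) (augX f g l0 lhat1) Sb zb (endmap Psi) (chart_cone B (beb Sb) K)
    (chart_dom V) (chart F (beb Sb) costb) (descent M) delta S u w z v v' kappa).
Proof.
move=> hpert; have [[_ [_ bK]] [delta delta0 opt]] := hmin.
have [d1 d10 hd1] : exists2 d1 : R, 0 < d1 & ((beb Sb)%:E < K)%E -> ((beb Sb + d1)%:E <= K)%E.
  have [h|h] := pselect ((beb Sb)%:E < K)%E; last by exists 1.
  case: K h => [k| |] //; last by exists 1 => // _; exact: leey.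
  by rewrite lte_fin => h; exists (k - beb Sb); rewrite ?subr_gt0// lee_fin addrC subrK.
(* [d1] protects an inactive bound on [beta]. The factor [n + 3] adds 1 for the difference of the
   final times to the [n + 2] of [zdist_le]. *)
pose d := Num.min d1 (delta / (n.+3%:R + 1)).
have N0 : 0 < n.+3%:R + 1 :> R by rewrite ltr_wpDl.
have d0 : 0 < d by rewrite lt_min d10 divr_gt0.
have dd1 : d <= d1 by rewrite ge_min lexx.
have dn : n.+3%:R * d < delta.
  have : d * (n.+3%:R + 1) <= delta by rewrite -ler_pdivlMr// ge_min lexx orbT.
  by apply: lt_le_trans; rewrite [ltRHS]mulrDr mulr1 mulrC ltrDl.
have [S [u [w [z [v [v' [kappa [[SS Sd uU um] [[bw cw vz ode] [zz [[Vv Cv eE] [vE k0 Cv']]]]]]]]]]]] :=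
  hpert d d0.
have Spos : 0 < S := lt_le_trans S0 SS.
have ode' t j : 0 <= t <= S -> z t 0 j = (row_mx xc 0 : 'rV[R]_(n + 3)) 0 j +
     RInt0 t (fun r => w r * augX f g l0 lhat1 (z r) (u r) 0 j).
  by move=> tS; rewrite ode// zb0.
have [proc costE] := weighted_process sf hA coneC hom Psi Spos uU um bw cw vz ode'.
have [/eqP eq1 eq2] := eq_row_mx eE.
have /row3_inj[eq3 eq4 eq5] := eq2.
have [_ SbSb] : 0 <= Sb /\ 0 <= Sb <= Sb by rewrite lexx (ltW S0).
have SE : clip Sb S = Sb by rewrite /clip min_r// max_r// ltW.
have [_ _ zbb] := zcoord SbSb.
have TzS : T (z S 0 (rshift n j0), lsubmx (z S)).
  rewrite (eqP eq1) eq3 -surjective_pairing; apply: FT; split; first exact: Vv.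
  by case: Cv.
(* Either the increasing slack is 0 and [beta] does not exceed its reference value, or the
   constraint is inactive and closeness within [d1] is enough. *)
have bS : ((z S 0 (rshift n j1))%:E <= K)%E.
  case: Cv => _ [r0 r1 r2 [r10|bltK]].
    apply: le_trans bK; rewrite lee_fin eq4 r10 addr0 lerBlDr lerDl; exact: r0.
  apply: le_trans (hd1 bltK); rewrite lee_fin.
  have SSS : 0 <= S <= S by rewrite (ltW Spos) lexx.
  have := zz S SSS; rewrite SE => h; have := norm_rV_coord (z S - zb Sb) (rshift n j1).
  rewrite !mxE zbb => /(le_trans (ler_norm _)) h'.
  by rewrite -lerBlDl (le_trans h')// (le_trans h).
have := opt _ _ _ _ _ _ _ (conj proc (conj TzS bS)).
have H : exists eta : R, `|S - Sb| + eta < delta /\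
   forall s, 0 <= s -> zdist S (fun t => z t 0 (rshift n j0)) (fun t => lsubmx (z t)) (fun t => z t 0 (rshift n j1))
    Sb y0b yb beb s <= eta.
  exists (n.+2%:R * d); split; last by move=> s s0; apply: zdist_le.
  apply: le_lt_trans dn; have -> : n.+3%:R * d = d + n.+2%:R * d by rewrite -[in LHS]addn1 natrD; ring.
  by rewrite ger0_norm ?subr_ge0// lerD2r.
move=> /(_ H); rewrite costE eq5 -/costb leNgt.
rewrite ltrBlDr ltrDl; case: Cv' => _ [_ _ r2 _].
have -> : v 0 (rshift M j2) = kappa + v' 0 (rshift M j2).
  by rewrite vE mxE [X in X + _]mxE /descent row_mxEr mxE /= mulr1.
by rewrite ltr_wpDr.
Qed.

Hypotheses (cB : convex_cone B) (B0 : B 0) (Vn : nbhs (0 : 'rV[R]_M) V).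
Hypotheses (Fc : {within V `&` B, continuous F}) (F0 : F 0 = (y0b Sb, yb Sb)).
Hypothesis Llin : forall (a : R) u v, L (a *: u + v) = a *: L u + L v.
Hypothesis FL : forall eps : R, 0 < eps -> exists2 d : R, 0 < d &
       forall v, (V `&` B) v -> `|v| < d -> `|F v - F 0 - L v| <= eps * `|v|.

Lemma exists_multiplier : exists P mu,
  multiplier (control_set C A) (augX f g l0 lhat1) DX Sb ub zb
    (\matrix_i endmap_lin Psi (y0b Sb, yb Sb) (evec i))
    (chart_cone B (beb Sb) K) (chart_lin L) P mu.
Proof.
have [_ SbSb] : 0 <= Sb /\ 0 <= Sb <= Sb by rewrite lexx (ltW S0).
have [zy zy0 zbe] := zcoord SbSb.
have [rho hrho] : exists rho, forall t, `|zb t| + 1 <= rho.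
  by have [N [hN _]] := vzb; exists (N + 1) => t; rewrite lerD2r.
have l00 : lsubmx (0 : 'rV[R]_(M + 3)) = 0 by apply/rowP => i; rewrite !mxE.
refine (or_ind id (fun h => False_ind _ (not_perturbed h)) (multiplier_or_perturbation (vs := descent M) (F := chart F (beb Sb) costb)
  (C := chart_cone B (beb Sb) K) (V := chart_dom V) (L := chart_lin L) (Theta := endmap Psi)
  (B := \matrix_i endmap_lin Psi (y0b Sb, yb Sb) (evec i)) sf S0 ubU ubm vzb hrho zbode
  (endmap_cont dPsi) _ _ _ _ _ _ _ _ _ (chart_lin_linear Llin))).
- by move=> e e0; apply: endmap_approx => //; rewrite zy zy0.
- by move=> x y; exact: chart_coneD.
- by move=> a x; exact: chart_coneZ.
- by split; rewrite ?l00// !mxE; split => //; left.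
- by apply: chart_cone_ge0 => //; left.
- have /nbhs_ballP[e e0 he] := Vn; exists e => // v ve; apply: he.
  by rewrite -ball_normE /= sub0r normrN (le_lt_trans (norm_lsubmx _)).
- by apply: chart_cont; exact: within_cont_on.
- rewrite /endmap /chart l00 F0 zy zy0 zbe !mxE subr0 subr0 addr0; congr (row_mx _ (row3 _ _ _)).
  by rewrite /costb /cost zbE// row_mxEr mxE.
- by move=> e e0; exact: chart_approx.
Qed.

End Minimizer.

(** * Properties of the multiplier *)

Section AlmostEverywhere.
Context {R : realType}.
Notation mu := (@lebesgue_measure R).

Lemma null_set_bigcup n (Q : 'I_n -> R -> Prop) :
  (forall i, exists N : set R, [/\ measurable N, mu N = 0%E & forall t, ~ N t -> Q i t]) ->
  exists N : set R, [/\ measurable N, mu N = 0%E & forall t i, ~ N t -> Q i t].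
Proof.
move=> h; suff : forall k, (k <= n)%N -> exists N : set R, [/\ measurable N, mu N = 0%E &
    forall t (i : 'I_n), (i < k)%N -> ~ N t -> Q i t].
  by move=> /(_ n (leqnn n))[N [mN N0 hN]]; exists N; split => // t i; exact: hN.
elim=> [|k IH] kn; first by exists set0; split => //; rewrite measure0.
have [N1 [m1 h1 hN1]] := IH (ltnW kn); have [N2 [m2 h2 hN2]] := h (Ordinal kn).
have [mN N0] := null_setU m1 h1 m2 h2.
exists (N1 `|` N2); split => // t i; rewrite ltnS leq_eqVlt => /orP[/eqP ik|ik] Nt.
  by rewrite (_ : i = Ordinal kn); [apply: hN2 => ?; apply: Nt; right|exact: val_inj].
by apply: hN1 => // ?; apply: Nt; left.
Qed.

(** The integral of the absolute value, which is that of [- h], is both nonnegative and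
    nonpositive. *)
Lemma nonpos_RInt0_null (h : R -> R) S : bmeas h -> (forall t, 0 <= t <= S -> h t <= 0) ->
  0 <= RInt0 S h -> exists N : set R, [/\ measurable N, mu N = 0%E &
    forall t, 0 <= t <= S -> ~ N t -> h t = 0].
Proof.
move=> bh h0 Jh.
have ih := bmeas_integrable 0 S bh.
have mh : measurable_fun `[0%R, S]%classic (EFin \o h) by case/integrableP : ih.
have E : (\int[mu]_(x in `[0%R, S]%classic) `|(EFin \o h) x| = 0)%E.
  have -> : (\int[mu]_(x in `[0%R, S]%classic) `|(EFin \o h) x| =
      \int[mu]_(x in `[0%R, S]%classic) (- (EFin \o h) x))%E.
    apply: eq_integral => x; rewrite inE /= in_itv /= => xS.
    by rewrite /= ler0_norm// h0.
  have fin : (\int[mu]_(x in `[0%R, S]%classic) (EFin \o h) x)%E \is a fin_num.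
    exact: integrable_fin_num ih.
  rewrite integralN; last exact: integrable_add_def ih.
  apply/eqP; rewrite eq_le; apply/andP; split.
    rewrite oppe_le0 -(fineK fin) lee_fin; exact: Jh.
  rewrite -integralN; last exact: integrable_add_def ih.
  apply: integral_ge0 => x; rewrite /= in_itv /= => xS.
  by rewrite lee_fin oppr_ge0 h0.
have [N [mN N0 sub]] := (ae_eq_integral_abs mu (measurable_itv _) mh).1 E.
exists N; split => // t tS Nt; apply: contrapT => ht; apply: Nt; apply: sub => /= hn.
by apply: ht; have := hn; rewrite /= in_itv /= => /(_ tS) [].
Qed.

(** Lebesgue differentiation; the primitive starts at 0, hence the restriction to positive times. *)
Lemma ae_is_derive_RInt0 (h : R -> R) : bmeas h -> exists N : set R, [/\ measurable N, mu N = 0%E &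
    forall t, ~ N t -> 0 < t -> is_derive t (1 : R) (fun s => RInt0 s h) (h t)].
Proof.
move=> bh.
have lh : locally_integrable [set: R] h.
  split; [exact: bh.1|exact: openT|move=> K _ cK].
  have mK : measurable K by apply: closed_measurable; exact: compact_closed.
  have /integrableP[_] : mu.-integrable K (EFin \o h).
    apply: measurable_bounded_integrable => //.
    - exact: compact_finite_measure.
    - exact: measurable_funS bh.1.
    - have [M hM] := bh.2; exists M; split; first exact: num_real.
      by move=> x Mx y _ /=; rewrite (le_trans (hM y))// ltW.
  by [].
have ih y : mu.-integrable [set` Interval (BLeft (0 : R)) (BRight y)] (EFin \o h).
  exact: bmeas_integrable.
have [N [mN N0 sub]] := FTC1 ih lh.
exists N; split => // t Nt t0; apply: contrapT => hd; apply: Nt; apply: sub => /= hn; apply: hd.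
have [|dh hE] := hn; first by rewrite /= lte_fin.
apply: DeriveDef; first exact: dh.
by rewrite -derive1E.
Qed.

End AlmostEverywhere.

Section Conclusion.
Context {R : realType}.
Notation mu := (@lebesgue_measure R).

Lemma closed_cone_0 m (C : set 'rV[R]_m) w : closed C -> is_cone C -> C w -> C 0.
Proof.
move=> clC coneC Cw; apply: clC => U /nbhs_ballP[e e0 he].
have w1 : 0 < `|w| + 1 by rewrite ltr_wpDl.
exists ((e / (`|w| + 1)) *: w); split; first by apply: coneC => //; rewrite divr_gt0.
apply: he; rewrite -ball_normE /= sub0r normrN normrZ gtr0_norm ?divr_gt0//.
by rewrite mulrAC ltr_pdivrMr// ltr_pM2l// ltrDl.
Qed.

Lemma vblip_abs_cont n (p : R -> 'rV[R]_n) S : vblip p -> abs_cont_on S p.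
Proof.
move=> [c [c1 c2]] e e0.
have c0 : 0 <= c by exact: le_trans (c1 0).
have N0 : 0 < n%:R * c + 1 by rewrite ltr_wpDl// mulr_ge0.
exists (e / (n%:R * c + 1)); first by rewrite divr_gt0.
move=> N a b hab _; rewrite ltr_pdivlMr// => h; apply: le_lt_trans h.
rewrite mulr_suml; apply: ler_sum => k _.
have [_ [ab _]] := hab k (ltn_ord k).
rewrite (le_trans (enorm_le _))//.
have h := c2 (a k) (b k); rewrite ger0_norm ?subr_ge0// in h.
apply: (@le_trans _ _ (n%:R * (c * (b k - a k)))); first by rewrite ler_wpM2l.
have -> : n%:R * (c * (b k - a k)) = (b k - a k) * (n%:R * c) by ring.
by rewrite ler_wpM2l ?subr_ge0// lerDl.
Qed.

Lemma is_derive_row_mx n1 n2 (h : 'rV[R]_(n1 + n2) -> R) (r : 'rV[R]_n2) x i d :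
  is_derive (row_mx x r) (evec (lshift n2 i)) h d ->
  is_derive (x : 'rV[R]_n1) (evec i) (fun y => h (row_mx y r)) d.
Proof.
move=> [dh <-].
have E : (fun s : R => s^-1 *: (((fun y => h (row_mx y r)) \o shift x) (s *: evec i) - h (row_mx x r)))
   = (fun s => s^-1 *: ((h \o shift (row_mx x r)) (s *: evec (lshift n2 i)) - h (row_mx x r))).
  apply/funext => s /=; congr (_ *: (h _ - _)).
  apply/rowP => j; case: (split_ordP j) => [l ->|l ->].
    by rewrite row_mxEl [RHS]mxE row_mxEl !mxE eqxx /= (inj_eq (@lshift_inj _ _)).
  by rewrite row_mxEr [RHS]mxE row_mxEr !mxE eqxx /= eq_rlshift mulr0 add0r.
by apply: DeriveDef; [rewrite /derivable E|rewrite /derive E].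
Qed.

Variables (n m q : nat).
Variables (C : set 'rV[R]_m) (A : set 'rV[R]_q)
  (f : 'rV[R]_n -> 'rV[R]_q -> 'rV[R]_n) (g : 'I_m -> 'rV[R]_n -> 'rV[R]_n)
  (l0 : 'rV[R]_n -> 'rV[R]_q -> R) (lhat1 : 'rV[R]_n -> R -> 'rV[R]_m -> R)
  (DX : 'I_(n + 3) -> 'rV[R]_(n + 3) -> 'rV[R]_(1 + (m + q)) -> 'rV[R]_(n + 3)).
Hypothesis sf : smooth_field (control_set C A) (augX f g l0 lhat1) DX.
Hypothesis DX_r : forall k z u, DX (rshift n k) z u = 0.
Hypotheses (coneC : is_cone C) (clC : closed C).
Variable (Psi : R * 'rV[R]_n -> R).
Hypothesis dPsi : forall z, differentiable Psi z.
Variables (K : \bar R) (hK : (0 < K)%E).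
Variables (Sb : R) (y0b : R -> R) (yb : R -> 'rV[R]_n) (beb : R -> R).
Hypothesis S0 : 0 < Sb.
Variables (ub : R -> 'rV[R]_(1 + (m + q))) (zb : R -> 'rV[R]_(n + 3)).
Hypotheses (ubU : forall t, control_set C A (ub t))
  (ubm : forall j, measurable_fun setT (fun t => ub t 0 j))
  (vzb : vblip zb) (zb0r : rsubmx (zb 0) = 0)
  (zbode : forall t j, 0 <= t <= Sb ->
     zb t 0 j = zb 0 0 j + RInt0 t (fun r => augX f g l0 lhat1 (zb r) (ub r) 0 j))
  (zbE : forall t, 0 <= t <= Sb -> [/\ lsubmx (zb t) = yb t, zb t 0 (rshift n j0) = y0b t &
     zb t 0 (rshift n j1) = beb t]).
Variables (M : nat) (B : set 'rV[R]_M) (L : 'rV[R]_M -> R * 'rV[R]_n).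
Hypothesis Llin : forall (a : R) u v, L (a *: u + v) = a *: L u + L v.
Hypothesis B0 : B 0.
Variables (P : R -> 'rV[R]_(n + 3)) (nu : 'rV[R]_(n + 3)).
Hypothesis mult : multiplier (control_set C A) (augX f g l0 lhat1) DX Sb ub zb
    (\matrix_i endmap_lin Psi (y0b Sb, yb Sb) (evec i))
    (chart_cone B (beb Sb) K) (chart_lin L) P nu.

Let vP : vblip P. Proof. by case: mult => [[]]. Qed.

Let SS : 0 <= Sb <= Sb. Proof. by rewrite lexx ltW. Qed.

(** [P] splits into [p] and three constants. The end map leaves the [beta] slot untouched, so [pi]
    is read on [nu]; in the cost slot the sign is reversed because the Hamiltonian carries [- lam].
    Only [p0] and [p] feel the differential of [Psi]. *)
Definition mult_p (t : R) := lsubmx (P t).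
Definition mult_p0 := P Sb 0 (rshift n j0).
Definition mult_pi := nu 0 (rshift n j1).
Definition mult_lam := - nu 0 (rshift n j2).
Local Notation p := mult_p.
Local Notation p0 := mult_p0.
Local Notation pi := mult_pi.
Local Notation lam := mult_lam.

Let dPsib := 'd Psi (y0b Sb, yb Sb).

Let PS k : P Sb 0 k = dotv nu (endmap_lin Psi (y0b Sb, yb Sb) (evec k)).
Proof.
case: mult => [[_ _ ->] _]; rewrite mxE; apply: eq_bigr => j _.
by congr (_ * _); rewrite !mxE.
Qed.

Let dnu y a b c : dotv nu (row_mx y (row3 a b c)) = dotv (lsubmx nu) y +
  (nu 0 (rshift n j0) * a + nu 0 (rshift n j1) * b + nu 0 (rshift n j2) * c).
Proof. by rewrite dotvC dotv_row_mx dotv_row3 dotvC !mxE; congr (_ + _); ring. Qed.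

(** By [DX_r] the right-hand side of the adjoint equation vanishes in the scalar slots. *)
Lemma P_const k t : 0 <= t <= Sb -> P t 0 (rshift n k) = P Sb 0 (rshift n k).
Proof.
have h s : 0 <= s <= Sb -> P s 0 (rshift n k) = P 0 0 (rshift n k).
  move=> sS; case: mult => _ [ode _ _ _]; rewrite ode// (@RInt0_eq _ _ (fun=> 0)) => [|r _].
    by rewrite RInt0_cst ?mul0r ?addr0//; case/andP: sS.
  by rewrite big1 ?oppr0// => l _; rewrite DX_r mxE mul0r.
by move=> tS; rewrite h// [RHS]h.
Qed.

Let ev_l i : endmap_lin Psi (y0b Sb, yb Sb) (evec (lshift 3 i)) =
  row_mx (evec i) (row3 0 0 (dPsib (0, evec i))).
Proof.
have -> : evec (lshift 3 i) = row_mx (evec i) 0 :> 'rV[R]_(n + 3).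
  by apply/rowP => j; case: (split_ordP j) => [l ->|l ->];
    rewrite ?row_mxEl ?row_mxEr !mxE ?eqxx ?eq_rlshift ?(inj_eq (@lshift_inj _ _)).
by rewrite /endmap_lin row_mxKl !row_mxEr !mxE addr0.
Qed.

Let ev_r k : endmap_lin Psi (y0b Sb, yb Sb) (evec (rshift n k)) =
  row_mx 0 (row3 (k == j0)%:R (k == j1)%:R (dPsib ((k == j0)%:R, 0) + (k == j2)%:R)).
Proof.
have -> : evec (rshift n k) = row_mx 0 (evec k) :> 'rV[R]_(n + 3).
  by apply/rowP => j; case: (split_ordP j) => [l ->|l ->];
    rewrite ?row_mxEl ?row_mxEr !mxE ?eqxx ?eq_lrshift ?(inj_eq (@rshift_inj _ _)).
by rewrite /endmap_lin row_mxKl !row_mxEr !mxE !eqxx /= ![_ == k]eq_sym.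
Qed.

Let dPsi0 : dPsib (0, 0) = 0.
Proof. exact: linear0. Qed.

Lemma mult_row t : 0 <= t <= Sb -> P t = row_mx (p t) (row3 p0 pi (- lam)).
Proof.
move=> tS; apply: row_mx3P => //; rewrite P_const// PS ev_r dnu dotv0r /= dPsi0.
  by rewrite /mult_pi; ring.
by rewrite /mult_lam; ring.
Qed.

Lemma mult_pE : p Sb = - lam *: (\row_j dPsib (0, evec j)) + lsubmx nu.
Proof.
apply/rowP => j; rewrite !mxE PS ev_l dnu /mult_lam opprK !mulr0 !add0r addrC; congr (_ + _).
rewrite /dotv (bigD1 j)//= !mxE !eqxx mulr1 big1 ?addr0// => i ij.
by rewrite !mxE eqxx /= (negbTE ij) mulr0.
Qed.

Lemma mult_p0E : p0 = - lam * dPsib (1, 0) + nu 0 (rshift n j0).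
Proof. by rewrite /mult_p0 PS ev_r dnu dotv0r /mult_lam /= opprK; ring. Qed.

Let L0 : L 0 = 0.
Proof. by have := Llin (-1) 0 0; rewrite !scaler0 addr0 scaleN1r addNr. Qed.

(** The multiplier inequality on a general vector of [chart_cone]; the sign conditions on [lam] and
    [pi] and the polarity relation are its instances at particular vectors. *)
Let cone_ge x r0 r1 r2 : B x -> 0 <= r0 -> 0 <= r1 -> 0 <= r2 -> r1 = 0 \/ ((beb Sb)%:E < K)%E ->
  0 <= dotv (lsubmx nu) (L x).2 + (nu 0 (rshift n j0) * (L x).1 + pi * (r1 - r0) + lam * r2).
Proof.
move=> Bx h0 h1 h2 h; case: mult => _ [_ _ _ /(_ _ (chart_cone_ge0 Bx h0 h1 h2 h))].
by rewrite /chart_lin row_mxKl !row_mxEr !mxE /= dnu /mult_lam /mult_pi; congr (_ <= _); ring.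
Qed.

Lemma mult_lam_ge0 : 0 <= lam.
Proof.
have := @cone_ge 0 0 0 1 B0 (lexx _) (lexx _) ler01 (or_introl erefl).
by rewrite L0 dotv0r !(subr0, mulr0, addr0, add0r, mulr1).
Qed.

Lemma mult_pi_le0 : pi <= 0.
Proof.
have := @cone_ge 0 1 0 0 B0 ler01 (lexx _) (lexx _) (or_introl erefl).
by rewrite L0 dotv0r !(mulr0, addr0, add0r) mulrN1 oppr_ge0.
Qed.

Lemma mult_pi_eq0 : ((beb Sb)%:E < K)%E -> pi = 0.
Proof.
move=> bK; apply/eqP; rewrite eq_le mult_pi_le0 /=.
have := @cone_ge 0 0 1 0 B0 (lexx _) ler01 (lexx _) (or_intror bK).
by rewrite L0 dotv0r !(subr0, mulr0, addr0, add0r) mulr1.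
Qed.

Lemma mult_polar : polar (L @` B) (- nu 0 (rshift n j0), - lsubmx nu).
Proof.
move=> _ [x Bx <-]; rewrite /dotp /= dotvNl mulNr -opprD oppr_le0.
have := @cone_ge x 0 0 0 Bx (lexx _) (lexx _) (lexx _) (or_introl erefl).
by rewrite subrr !mulr0 !addr0 addrC.
Qed.

Definition mult_ham t u := Ham f g l0 lhat1 (yb t) p0 (p t) pi lam (ctl0 u) (ctlw u) (ctla u).

(** The constants [p0], [pi] and [- lam] weight the slots of time, [beta] and cost, so the
    Hamiltonian is the quantity controlled by [multiplier]. *)
Lemma mult_hamE t u : 0 <= t <= Sb -> mult_ham t u = dotv (augX f g l0 lhat1 (zb t) u) (P t).
Proof.
move=> tS; have [zy _ _] := zbE tS; rewrite /mult_ham /Ham (mult_row tS) /augX dotv_row_mx dotv_row3.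
by rewrite zy row_mxKl row_mxKr !mxE /= dotvC; ring.
Qed.

Lemma mult_ham_le0 t u : 0 <= t <= Sb -> control_set C A u -> mult_ham t u <= 0.
Proof. by move=> tS Uu; rewrite mult_hamE//; case: mult => _ [_ h _ _]; exact: h. Qed.

Let bX j : bmeas (fun t => augX f g l0 lhat1 (zb t) (ub t) 0 j).
Proof. by apply: (bmeas_field sf) => // l; exact: vblip_bmeas. Qed.

Lemma mult_ham_null : exists N : set R, [/\ measurable N, mu N = 0%E &
  forall t, 0 <= t <= Sb -> ~ N t -> mult_ham t (ub t) = 0].
Proof.
have bh : bmeas (fun t => dotv (augX f g l0 lhat1 (zb t) (ub t)) (P t)).
  by apply: bmeas_dotv => // j; exact: vblip_bmeas.
have [||N [mN N0 hN]] := nonpos_RInt0_null bh (S := Sb).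
- by move=> t tS; rewrite -mult_hamE// mult_ham_le0.
- by case: mult => _ [].
by exists N; split => // t tS Nt; rewrite mult_hamE// hN.
Qed.

Let hset t := [set r | exists w0 w a, Wset C (w0, w) /\ A a /\
                 r = Ham f g l0 lhat1 (yb t) p0 (p t) pi lam w0 w a].

Let hset_mem t u : control_set C A u -> hset t (mult_ham t u).
Proof. by move=> [Wu Au]; exists (ctl0 u), (ctlw u), (ctla u). Qed.

Let hset_ub t : 0 <= t <= Sb -> ubound (hset t) 0.
Proof.
move=> tS _ [w0 [w [a [W [Aa ->]]]]].
have := @mult_ham_le0 t (ctl w0 w a) tS; rewrite /mult_ham ctl0K ctlwK ctlaK; apply.
by split; rewrite ?ctl0K ?ctlwK ?ctlaK.
Qed.

Lemma hammax_le0 t : 0 <= t <= Sb -> HamMax f g l0 lhat1 C A (yb t) p0 (p t) pi lam <= 0.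
Proof.
by move=> tS; apply: ge_sup; [exists (mult_ham t (ub t)); exact: hset_mem|exact: hset_ub].
Qed.

Lemma hammax_ge t u : 0 <= t <= Sb -> control_set C A u ->
  mult_ham t u <= HamMax f g l0 lhat1 C A (yb t) p0 (p t) pi lam.
Proof.
by move=> tS Uu; apply: ub_le_sup; [exists 0; exact: hset_ub|exact: hset_mem].
Qed.

(* Off a null set the reference control attains 0; the Hamiltonians of all admissible controls are
   Lipschitz in time with a common constant, which gives every s. *)
Lemma hammax_eq0 s : 0 <= s <= Sb -> HamMax f g l0 lhat1 C A (yb s) p0 (p s) pi lam = 0.
Proof.
move=> sS; apply/eqP; rewrite eq_le hammax_le0//=.
apply/ler_addgt0Pr => e e0; rewrite -lerBlDr sub0r.
have [N [mN N0 hN]] := mult_ham_null.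
have [cz [cz1 cz2]] := vzb; have [cp [cp1 cp2]] := vP.
have cz0 : 0 <= cz by exact: le_trans (cz1 0).
have cp0 : 0 <= cp by exact: le_trans (cp1 0).
have [Lx L0' hLx] := field_lipschitz sf cz.
have [Mx Mx0 hMx] := field_bounded sf cz.
(* Lipschitz constant in time, common to all admissible controls, of the pairing of field and
   adjoint vector; the factor [n + 3] comes from estimating [dotv] by sup norms. *)
pose k := (n + 3)%:R * (Lx * cz * cp + Mx * cp).
have k0 : 0 <= k by rewrite /k mulr_ge0// addr_ge0// !mulr_ge0// ltW.
pose d := e / (k + 1).
have d0 : 0 < d by rewrite divr_gt0// ltr_wpDl.
case/andP: sS => s0 sS.
have [|t /andP[t1 t2] Nt] := @null_set_witness R (Num.max 0 (s - d)) (Num.min Sb (s + d)) N _ mN N0.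
  by rewrite lt_min !gt_max S0 /=; apply/and3P; split; lra.
have tS : 0 <= t <= Sb by move: t1 t2; rewrite ge_max le_min => /andP[-> _] /andP[-> _].
have st : `|s - t| <= d.
  by move: t1 t2; rewrite ge_max le_min => /andP[_ h1] /andP[_ h2]; rewrite ler_distlC; apply/andP; split; lra.
have sS' : 0 <= s <= Sb by rewrite s0.
have /(le_trans _) := hammax_ge sS' (ubU t); apply.
have := hN t tS Nt; rewrite !mult_hamE// => h0.
set u := ub t in h0 *.
have Uu : control_set C A u := ubU t.
have E : dotv (augX f g l0 lhat1 (zb s) u) (P s) =
  dotv (augX f g l0 lhat1 (zb s) u - augX f g l0 lhat1 (zb t) u) (P s) +
  dotv (augX f g l0 lhat1 (zb t) u) (P s - P t).
  by rewrite dotvDl dotvDr dotvNl dotvNr h0; ring.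
have b1 : `|dotv (augX f g l0 lhat1 (zb s) u - augX f g l0 lhat1 (zb t) u) (P s)| <=
   (n + 3)%:R * (Lx * cz * d * cp).
  rewrite (le_trans (dotv_le _ _))// ler_wpM2l// ler_pM//.
  rewrite (le_trans (hLx _ _ _ (cz1 t) (cz1 s) Uu))// -mulrA ler_pM2l//.
  by rewrite (le_trans (cz2 _ _))// ler_wpM2l.
have b2 : `|dotv (augX f g l0 lhat1 (zb t) u) (P s - P t)| <= (n + 3)%:R * (Mx * (cp * d)).
  rewrite (le_trans (dotv_le _ _))// ler_wpM2l// ler_pM//; first exact: (hMx _ _ (cz1 t) Uu).1.
  by rewrite (le_trans (cp2 _ _))// ler_wpM2l.
rewrite E lerNl; apply: (@le_trans _ _ (k * d)).
  rewrite (le_trans (ler_norm _))// normrN (le_trans (ler_normD _ _))//.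
  by rewrite (le_trans (lerD b1 b2))// /k; lra.
by rewrite /d mulrA ler_pdivrMr ?ltr_wpDl// mulrC ler_pM2l// lerDl.
Qed.

Lemma mult_maximization (w0b : R -> R) (wb : R -> 'rV[R]_m) (alb : R -> 'rV[R]_q) N :
  measurable N -> mu N = 0%E ->
  (forall t, 0 <= t <= Sb -> ~ N t -> ub t = ctl (w0b t) (wb t) (alb t)) ->
  ae_on Sb (fun s => Ham f g l0 lhat1 (yb s) p0 (p s) pi lam (w0b s) (wb s) (alb s)
                       = HamMax f g l0 lhat1 C A (yb s) p0 (p s) pi lam).
Proof.
move=> mN N0 uE; have [N' [mN' N'0 hN]] := mult_ham_null.
have [mU U0] := null_setU mN N0 mN' N'0.
apply: (null_ae_on mU U0) => t tS Nt; rewrite hammax_eq0// -(hN t tS) => [|?]; last by apply: Nt; right.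
by rewrite /mult_ham uE ?ctl0K ?ctlwK ?ctlaK// => ?; apply: Nt; left.
Qed.

(** As a function of [x] the Hamiltonian is the combination of the components of the augmented field
    with coefficients [P t], so its partial derivatives are given by [DX]. *)
Lemma is_derive_ham t i : 0 <= t <= Sb ->
  is_derive (yb t) (evec i) (fun x => Ham f g l0 lhat1 x p0 (p t) pi lam (ctl0 (ub t)) (ctlw (ub t)) (ctla (ub t)))
    (\sum_l DX (lshift 3 i) (zb t) (ub t) 0 l * P t 0 l).
Proof.
move=> tS; have [zy _ _] := zbE tS.
have zrow : zb t = row_mx (yb t) (rsubmx (zb t)) by rewrite -zy hsubmxK.
have -> : (fun x => Ham f g l0 lhat1 x p0 (p t) pi lam (ctl0 (ub t)) (ctlw (ub t)) (ctla (ub t))) =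
    \sum_l P t 0 l *: (fun x => augX f g l0 lhat1 (row_mx x (rsubmx (zb t))) (ub t) 0 l).
  apply/funext => x; rewrite fct_sumE /Ham.
  transitivity (dotv (P t) (augX f g l0 lhat1 (row_mx x (rsubmx (zb t))) (ub t))).
    rewrite (mult_row tS) /augX !row_mxKl dotv_row_mx dotv_row3 row_mxKl row_mxKr !mxE /=.
    by ring.
  by [].
have -> : \sum_l DX (lshift 3 i) (zb t) (ub t) 0 l * P t 0 l =
    \sum_l P t 0 l *: DX (lshift 3 i) (zb t) (ub t) 0 l.
  by apply: eq_bigr => l _; rewrite mulrC.
apply: is_derive_sum => l; apply: is_deriveZ.
apply: (is_derive_row_mx (h := fun z => augX f g l0 lhat1 z (ub t) 0 l)).
by rewrite -zrow; exact: (sf_der sf).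
Qed.

Lemma mult_adjoint (w0b : R -> R) (wb : R -> 'rV[R]_m) (alb : R -> 'rV[R]_q) N :
  measurable N -> mu N = 0%E ->
  (forall t, 0 <= t <= Sb -> ~ N t -> ub t = ctl (w0b t) (wb t) (alb t)) ->
  ae_on Sb (fun s => is_derive s (1 : R) p
       (- gradx (fun x => Ham f g l0 lhat1 x p0 (p s) pi lam (w0b s) (wb s) (alb s)) (yb s))).
Proof.
move=> mN N0 uE.
have bD i j : bmeas (fun t => DX i (zb t) (ub t) 0 j).
  split; first by apply: (measurable_dfield sf i j ubU) => // l; exact: (vblip_bmeas l vzb).1.
  have [cz [cz1 cz2]] := vzb.
  have [N1 N10 hN1] := field_bounded sf cz; exists N1 => t.
  apply: le_trans (norm_rV_coord _ _) _; exact: (hN1 _ _ (cz1 t) (ubU t)).2.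
pose h i r := - \sum_l DX (lshift 3 i) (zb r) (ub r) 0 l * P r 0 l.
have bh i : bmeas (h i).
  by apply: bmeasN; apply: bmeas_sum => l; apply: bmeasM => //; exact: vblip_bmeas.
have [N1 [mN1 N10 hN1]] := null_set_bigcup (fun i => ae_is_derive_RInt0 (bh i)).
have [mU U0] := null_setU mN N0 mN1 N10.
(* Both end points are discarded as well: the derivative is two-sided, while the adjoint integral
   equation is known only on [[0, Sb]]. *)
have [mV V0] := null_setU mU U0 (measurable_set1 0) (lebesgue_measure_set1 0).
have [mW W0] := null_setU mV V0 (measurable_set1 Sb) (lebesgue_measure_set1 Sb).
apply: (null_ae_on mW W0) => t tS Nt.
have t0 : 0 < t.
  by case/andP: tS => t0 _; rewrite lt_neqAle t0 andbT; apply/eqP => t0'; apply: Nt; left; right.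
have tSb : t < Sb.
  by case/andP: tS => _ t1; rewrite lt_neqAle t1 andbT; apply/eqP => t1'; apply: Nt; right.
have ut : ub t = ctl (w0b t) (wb t) (alb t) by apply: uE => // ?; apply: Nt; left; left; left.
have dj i : is_derive t (1 : R) (fun s => p s 0 i) (h i t).
  have := hN1 t i (fun x => Nt (or_introl (or_introl (or_intror x)))) t0 => dJ.
  apply: (@near_eq_is_derive _ _ _ (fun s => P 0 0 (lshift 3 i) + RInt0 s (h i))).
    near=> s; have sS : 0 <= s <= Sb.
      have : s \in `]0, Sb[ by near: s; apply: near_in_itvoo; rewrite in_itv /= t0.
      by rewrite in_itv /= => /andP[/ltW -> /ltW ->].
    by case: mult => _ [ode _ _ _]; rewrite /mult_p mxE (ode s _ sS).
  rewrite -[h i t]add0r; apply: is_deriveD.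
have gE : gradx (fun x => Ham f g l0 lhat1 x p0 (p t) pi lam (w0b t) (wb t) (alb t)) (yb t) =
    \row_i - h i t.
  apply/rowP => i; rewrite !mxE /h opprK.
  by have := is_derive_ham i tS; rewrite ut ctl0K ctlwK ctlaK => dH; rewrite derive_val.
have dp : derivable p t 1 by apply/derivable_mxP => i j; rewrite ord1; have [] := dj j.
apply: DeriveDef => //; rewrite derive_mx// gE; apply/matrixP => i j; rewrite ord1 !mxE opprK.
by rewrite derive_val.
Unshelve. all: by end_near. Qed.

Let beb_RInt0 : beb Sb = RInt0 Sb (fun t => enorm (ctlw (ub t))).
Proof.
have [_ _ <-] := zbE SS; rewrite zbode//.
have -> : zb 0 0 (rshift n j1) = 0 by have := congr1 (fun x : 'rV[R]_3 => x 0 j1) zb0r; rewrite !mxE.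
by rewrite add0r; apply: RInt0_eq => r _; rewrite row_mxEr mxE.
Qed.

Let y0b_RInt0 : y0b Sb = RInt0 Sb (fun t => ctl0 (ub t)).
Proof.
have [_ <- _] := zbE SS; rewrite zbode//.
have -> : zb 0 0 (rshift n j0) = 0 by have := congr1 (fun x : 'rV[R]_3 => x 0 j0) zb0r; rewrite !mxE.
by rewrite add0r; apply: RInt0_eq => r _; rewrite row_mxEr mxE.
Qed.

Let RInt0_eq0 (h : R -> R) N : measurable N -> mu N = 0%E ->
  (forall t, 0 <= t <= Sb -> ~ N t -> h t = 0) -> RInt0 Sb h = 0.
Proof.
move=> mN N0 h0; rewrite (RInt0_null (k := fun=> 0) mN N0 h0) RInt0_cst ?mul0r//; exact: ltW.
Qed.

Let ham0 t : 0 <= t <= Sb -> p t = 0 -> lam = 0 ->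
  mult_ham t (ub t) = p0 * ctl0 (ub t) + pi * enorm (ctlw (ub t)).
Proof. by move=> tS pt l00; rewrite /mult_ham /Ham pt l00 dotv0l; ring. Qed.

(** Otherwise [nu] is concentrated in the [beta] slot, so [pi] is nonzero. The vanishing Hamiltonian
    reduces to [pi] times the norm of [w], whence [w = 0] almost everywhere and [beb Sb = 0 < K];
    the bound on [beta] is then inactive, which forces [pi = 0]. *)
Lemma mult_nontrivial : ~ (p0 = 0 /\ (forall s, 0 <= s <= Sb -> p s = 0) /\ lam = 0).
Proof.
move=> [p00 [pz l00]].
have nu2 : nu 0 (rshift n j2) = 0 by apply/eqP; rewrite -oppr_eq0; apply/eqP.
have nul : lsubmx nu = 0 by have := mult_pE; rewrite pz// l00 oppr0 scale0r add0r.
have nu0 : nu 0 (rshift n j0) = 0 by have := mult_p0E; rewrite p00 l00 oppr0 mul0r add0r.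
have nz : pi <> 0.
  move=> pi0; case: mult => [[/eqP nu_neq0 _ _] _]; apply: nu_neq0.
  apply/rowP => j; rewrite mxE; case: (split_ordP j) => [i ->|i ->].
    by have := congr1 (fun x : 'rV[R]_n => x 0 i) nul; rewrite !mxE.
  by move: i; apply: ord3P.
apply: (nz); apply: mult_pi_eq0; rewrite beb_RInt0.
have [N [mN N0 hN]] := mult_ham_null.
rewrite (RInt0_eq0 mN N0) => [//|t tS Nt].
have := hN t tS Nt; rewrite (ham0 tS (pz t tS) l00) p00 mul0r add0r => /eqP.
by rewrite mulf_eq0 => /orP[/eqP pi0|/eqP//]; case: nz.
Qed.

(* With p = 0 and lam = 0 the control (1, 0, a) forces p0 <= 0, and then H = p0 w0 + pi |w| = 0 along
   the reference control makes p0 w0 vanish almost everywhere. *)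
Lemma mult_nontrivial_pos : 0 < y0b Sb -> ~ ((forall s, 0 <= s <= Sb -> p s = 0) /\ lam = 0).
Proof.
move=> y0b_gt0 [pz l00].
have p0_neq0 : p0 <> 0 by move=> p00; exact: mult_nontrivial.
have p0_le0 : p0 <= 0.
  have [[_ [Cw _]] Aa] := ubU 0.
  have U1 : control_set C A (ctl 1 0 (ctla (ub 0))).
    split; rewrite ?ctlaK// ctl0K ctlwK; split => //; split; first exact: closed_cone_0 Cw.
    by rewrite /= /enorm dotv0l sqrtr0 addr0.
  have := mult_ham_le0 SS U1.
  rewrite /mult_ham /Ham ctl0K ctlwK pz// l00 dotv0l /enorm dotv0l sqrtr0 mul0r mulr0 !addr0 subr0.
  by rewrite mulr1.
have [N [mN N0 hN]] := mult_ham_null.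
move: y0b_gt0; rewrite y0b_RInt0 (RInt0_eq0 mN N0) ?ltxx// => t tS Nt.
have [[/= u0 _] _] := ubU t.
have := hN t tS Nt; rewrite (ham0 tS (pz t tS) l00) => h.
have h1 : p0 * ctl0 (ub t) <= 0 by rewrite mulr_le0_ge0.
have h2 : pi * enorm (ctlw (ub t)) <= 0 by rewrite mulr_le0_ge0 ?mult_pi_le0 ?enorm_ge0.
have /eqP : p0 * ctl0 (ub t) = 0 by lra.
by rewrite mulf_eq0 => /orP[/eqP//|/eqP].
Qed.

End Conclusion.

Theorem mainTheorem1 (R : realType) (n m1 m2 q : nat)
  (* (1) target, control set, cones *)
  (T : set (R * 'rV[R]_n))
  (hT_closed : closed T) (hT_pos : forall z, T z -> 0 <= z.1)
  (A : set 'rV[R]_q) (hA : compact A)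
  (C1 : set 'rV[R]_m1) (C2 : set 'rV[R]_m2)
  (hC1_closed : closed C1) (hC1_cone : is_cone C1)
  (hC1_lines : forall (i : 'I_m1) (r : R), C1 (r *: evec i))
  (hC2_closed : closed C2) (hC2_cone : is_cone C2) (hC2_noline : no_line C2)
  (* (2) drift f *)
  (f : 'rV[R]_n -> 'rV[R]_q -> 'rV[R]_n)
  (hf_cont : {within [set xa : 'rV[R]_n * 'rV[R]_q | A xa.2],
                continuous (fun xa => f xa.1 xa.2)})
  (hf_der : forall (j : 'I_n) x a, A a -> derivable (fun x' => f x' a) x (evec j))
  (hf_der_cont : forall j : 'I_n, {within [set xa : 'rV[R]_n * 'rV[R]_q | A xa.2],
                continuous (fun xa => derive (fun x' => f x' xa.2) xa.1 (evec j))})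
  (* (3) vector fields g_i, C^1 *)
  (g : 'I_(m1 + m2) -> 'rV[R]_n -> 'rV[R]_n)
  (hg_diff : forall i x, differentiable (g i) x)
  (hg_cont : forall i (v : 'rV[R]_n), continuous (fun x => 'd (g i) x v))
  (* (4) Lagrangian l = l0 + l1 and recession function lhat1 of l1 *)
  (l0 : 'rV[R]_n -> 'rV[R]_q -> R)
  (l1 : 'rV[R]_n -> 'rV[R]_(m1 + m2) -> R)
  (lhat1 : 'rV[R]_n -> R -> 'rV[R]_(m1 + m2) -> R)
  (hlhat1 : forall x (w0 : R) w, 0 <= w0 -> prod_cone C1 C2 w ->
     (fun r : R => r * l1 x (r^-1 *: w)) @ within (fun r : R => 0 < r) w0^'
       --> lhat1 x w0 w)
  (hl0_cont : {within [set xa : 'rV[R]_n * 'rV[R]_q | A xa.2],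
                continuous (fun xa => l0 xa.1 xa.2)})
  (hl0_der : forall (j : 'I_n) x a, A a -> derivable (fun x' => l0 x' a) x (evec j))
  (hl0_der_cont : forall j : 'I_n, {within [set xa : 'rV[R]_n * 'rV[R]_q | A xa.2],
                continuous (fun xa => derive (fun x' => l0 x' xa.2) xa.1 (evec j))})
  (hlhat1_cont : {within [set z : 'rV[R]_n * R * 'rV[R]_(m1 + m2) |
                            0 <= z.1.2 /\ prod_cone C1 C2 z.2],
                continuous (fun z => lhat1 z.1.1 z.1.2 z.2)})
  (hlhat1_der : forall (j : 'I_n) x (w0 : R) w, 0 <= w0 -> prod_cone C1 C2 w ->
                derivable (fun x' => lhat1 x' w0 w) x (evec j))
  (hlhat1_der_cont : forall j : 'I_n,
                {within [set z : 'rV[R]_n * R * 'rV[R]_(m1 + m2) |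
                            0 <= z.1.2 /\ prod_cone C1 C2 z.2],
                continuous (fun z => derive (fun x' => lhat1 x' z.1.2 z.2) z.1.1 (evec j))})
  (* (5) final cost Psi, C^1 *)
  (Psi : R * 'rV[R]_n -> R)
  (hPsi_diff : forall z, differentiable Psi z)
  (hPsi_cont : forall v : R * 'rV[R]_n, continuous (fun z => 'd Psi z v))
  (* K in (0, +oo] and initial point *)
  (K : \bar R) (hK : (0 < K)%E) (xc : 'rV[R]_n)
  (* the canonical local minimizer *)
  (Sb : R) (w0b : R -> R) (wb : R -> 'rV[R]_(m1 + m2)) (alb : R -> 'rV[R]_q)
  (y0b : R -> R) (yb : R -> 'rV[R]_n) (beb : R -> R)
  (hcan : canonical_ctrl Sb w0b wb)
  (hmin : local_minimizer f g l0 lhat1 Psi (prod_cone C1 C2) A xc T K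
            Sb w0b wb alb y0b yb beb) :
  forall Gam : set (R * 'rV[R]_n), boltyanski_cone Gam T (y0b Sb, yb Sb) ->
  exists (p0 : R) (p : R -> 'rV[R]_n) (pi lam : R),
    [/\ abs_cont_on Sb p, pi <= 0 & 0 <= lam] /\
    (* (i) non-triviality *)
    (~ (p0 = 0 /\ (forall s, 0 <= s <= Sb -> p s = 0) /\ lam = 0) /\
     (0 < y0b Sb -> ~ ((forall s, 0 <= s <= Sb -> p s = 0) /\ lam = 0))) /\
    (* (ii) non-transversality *)
    (exists2 qq : R * 'rV[R]_n, polar Gam qq &
       (p0, p Sb) = (- lam * 'd Psi (y0b Sb, yb Sb) (1, 0) - qq.1,
                     - lam *: (\row_(j < n) 'd Psi (y0b Sb, yb Sb) (0, evec j)) - qq.2)) /\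
    (((beb Sb)%:E < K)%E -> pi = 0) /\
    (* (iii) adjoint equation *)
    ae_on Sb (fun s => is_derive s (1 : R) p
       (- gradx (fun x => Ham f g l0 lhat1 x p0 (p s) pi lam (w0b s) (wb s) (alb s)) (yb s))) /\
    (* (iv) maximization *)
    ae_on Sb (fun s => Ham f g l0 lhat1 (yb s) p0 (p s) pi lam (w0b s) (wb s) (alb s)
                       = HamMax f g l0 lhat1 (prod_cone C1 C2) A (yb s) p0 (p s) pi lam) /\
    (* (v) vanishing of the Hamiltonian *)
    (forall s, 0 <= s <= Sb ->
       HamMax f g l0 lhat1 (prod_cone C1 C2) A (yb s) p0 (p s) pi lam = 0).

Proof.
move=> Gam [_ [_ [M [B [V [F [L [[cB B0 Vn] [[Fc FT F0] [Llin [FL LB]]]]]]]]]]].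
pose C := prod_cone C1 C2.
have clC : closed C.
  have -> : C = (fun w : 'rV[R]_(m1 + m2) => lsubmx w) @^-1` C1 `&` (fun w : 'rV[R]_(m1 + m2) => rsubmx w) @^-1` C2.
    by apply/seteqP; split => w [].
  apply: closedI; apply: preimage_closed => // w _; apply: lip_continuous => x y.
    by rewrite lsubmxB norm_lsubmx.
  by rewrite rsubmxB norm_rsubmx.
have coneC : is_cone C.
  move=> a w a0 [w1 w2]; split.
    rewrite (_ : lsubmx (a *: w) = a *: lsubmx w); first exact: hC1_cone.
    by apply/rowP => i; rewrite !mxE.
  rewrite (_ : rsubmx (a *: w) = a *: rsubmx w); first exact: hC2_cone.
  by apply/rowP => i; rewrite !mxE.
have hom x c w0 w : 0 < c -> 0 <= w0 -> C w -> lhat1 x (c * w0) (c *: w) = c * lhat1 x w0 w.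
  by apply: (recession_homogeneous (l := l1 x)) => // ? ?; exact: hlhat1.
have sf := smooth_augX clC hA hf_cont hf_der hf_der_cont hg_diff hg_cont hl0_cont hl0_der hl0_der_cont
  hlhat1_cont hlhat1_der hlhat1_der_cont.
have DX_r k z u : augD f g l0 lhat1 (rshift n k) z u = 0 := augD_r f g l0 lhat1 k z u.
have proc : process f g C A xc Sb w0b wb alb y0b yb beb by case: hmin => [[]].
have S0 : 0 < Sb by case: proc.
have [N [u [z [[mN N0 uU um uE] [vz z0 zode zE]]]]] := reference_trajectory sf proc hcan.
rewrite -F0 in FL.
have [P [nu mult]] := exists_multiplier sf hA coneC hom hPsi_diff hmin uU um vz z0 zode zE FT cB B0 Vn Fc F0 Llin FL.
have z0r : rsubmx (z 0) = 0 by rewrite z0 row_mxKr.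
have zc t : 0 <= t <= Sb -> [/\ lsubmx (z t) = yb t, z t 0 (rshift n j0) = y0b t &
     z t 0 (rshift n j1) = beb t].
  by move=> tS; rewrite zE// row_mxKl !row_mxEr !mxE.
exists (mult_p0 Sb P), (mult_p P), (mult_pi nu), (mult_lam nu).
split; last split; last split; last split; last split; last split.
- split.
  + case: mult => [[_ [c [c1 c2]] _] _]; apply: vblip_abs_cont; exists c; split => [t|s t].
      by rewrite (le_trans (norm_lsubmx _)).
    by rewrite /mult_p lsubmxB (le_trans (norm_lsubmx _)).
  + exact: (mult_pi_le0 Llin B0 mult).
  + exact: (mult_lam_ge0 Llin B0 mult).
- split.
  + exact: (mult_nontrivial sf DX_r hK S0 uU um vz z0r zode zc Llin B0 mult).
  + exact: (mult_nontrivial_pos sf DX_r coneC clC hK S0 uU um vz z0r zode zc Llin B0 mult).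
(* The polar vector is minus the part of [nu] acting on time and state; the rest of [(p0, p Sb)] is
   the differential of [Psi] with factor [- lam]. *)
- exists (- nu 0 (rshift n j0), - lsubmx nu); first by rewrite -LB; exact: (mult_polar mult).
  by rewrite [in LHS](mult_pE mult) [in LHS](mult_p0E mult) /= !opprK.
- exact: (mult_pi_eq0 Llin B0 mult).
- exact: (mult_adjoint sf DX_r S0 uU um vz zc mult mN N0 uE).
- exact: (mult_maximization sf DX_r S0 uU um vz zc mult mN N0 uE).
- by move=> s; exact: (hammax_eq0 sf DX_r S0 uU um vz zc mult).
Qed.
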